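(* Let $\mathcal{Q}_p=[0,1]^p\subset\mathbb{R}^p$. For every $s>p$ the limit $$\sigma_{s,p}:=\lim_{N\to\infty}\frac{\mathcal{P}_s(\mathcal{Q}_p;N)}{N^{s/p}}$$ exists and is positive and finite. More generally, let $d\le p$ be positive integers, $s>d$, and let $A$ be a compact subset of a $d$-dimensional $C^1$ manifold in $\mathbb{R}^p$ whose boundary relative to the manifold has $\mathcal{H}_d$-measure zero. Then $$\lim_{N\to\infty}\frac{\mathcal{P}_s(A;N)}{N^{s/d}}=\frac{\sigma_{s,d}}{\mathcal{H}_d(A)^{s/d}}.$$ Furthermore, if $\mathcal{H}_d(A)>0$, then for every asymptotically $s$-optimal sequence $\{\omega_N\}_{N\ge1}$ of $N$-point configurations in $A$, $$\nu(\omega_N)\xrightarrow{\ast}\frac{1}{\mathcal{H}_d(A)}\,\mathcal{H}_d\big|_A\quad\text{as }N\to\infty$$ (weak-star convergence of measures).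
   Context: An $N$-point configuration $\omega_N=\{x_1,\dots,x_N\}\subset A$ is a multiset of $N$ points of $A$ (repetitions allowed). For $s>0$, $P_s(A;\omega_N):=\inf_{y\in A}\sum_{j=1}^N |y-x_j|^{-s}$ and $\mathcal{P}_s(A;N):=\sup_{\omega_N\subset A}P_s(A;\omega_N)$ (supremum over all $N$-point configurations in $A$). A sequence $\{\omega_N\}_{N\ge1}$, $\omega_N$ an $N$-point configuration in $A$, is asymptotically $s$-optimal if $\lim_{N\to\infty}P_s(A;\omega_N)/\mathcal{P}_s(A;N)=1$. $\nu(\omega_N):=\frac1N\sum_{x\in\omega_N}\delta_x$ is the normalized counting measure (counted with multiplicity). $\mathcal{H}_d$ denotes $d$-dimensional Hausdorff measure on $\mathbb{R}^p$ normalized so that a $d$-dimensional unit cube embedded in $\mathbb{R}^p$ has measure $1$. *)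

(* Defs.v *)
(* R^p is modelled as 'rV[R]_p with the EUCLIDEAN
   distance [edist] below (the library norm on 'rV is the max-norm; only its
   topology -- which is the Euclidean one -- is used, for compactness,
   openness, continuity and differentiability). *)
From HB Require Import structures.
From mathcomp Require Import all_boot all_order all_algebra.
From mathcomp Require Import all_classical all_reals all_analysis.
Set Implicit Arguments. Unset Strict Implicit. Unset Printing Implicit Defensive.
Import Order.TTheory GRing.Theory Num.Theory.
Import numFieldNormedType.Exports.
Local Open Scope classical_set_scope.
Local Open Scope ring_scope.

Section Defs.
Variable R : realType.

Definition edist (n : nat) (x y : 'rV[R]_n) : R :=
  Num.sqrt (\sum_(i < n) (x ord0 i - y ord0 i) ^+ 2).

Definition rkern (n : nat) (s : R) (y x : 'rV[R]_n) : \bar R :=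
  if y == x then +oo%E else ((edist y x) `^ (- s))%:E.

Definition Pconf (n : nat) (A : set 'rV[R]_n) (s : R) (N : nat)
  (w : 'I_N -> 'rV[R]_n) : \bar R :=
  ereal_inf [set (\sum_(j < N) rkern s y (w j))%E | y in A].

Definition PN (n : nat) (A : set 'rV[R]_n) (s : R) (N : nat) : \bar R :=
  ereal_sup [set Pconf A s w | w in [set w : 'I_N -> 'rV[R]_n | forall j, A (w j)]].

Definition nratio (x : \bar R) (N : nat) (r : R) : \bar R :=
  (x * ((N%:R `^ r)^-1)%:E)%E.

Definition cube (n : nat) : set 'rV[R]_n :=
  [set x | forall i : 'I_n, 0 <= x ord0 i <= 1].

(* (diam U)^d, with diam set0 = 0 *)
Definition diam_pow (n d : nat) (U : set 'rV[R]_n) : \bar R :=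
  ereal_sup ([set z | exists x y, [/\ U x, U y & z = ((edist x y) ^+ d)%:E]]
             `|` [set 0%E]).

Definition Hdelta (n d : nat) (delta : R) (E : set 'rV[R]_n) : \bar R :=
  ereal_inf [set (\sum_(0 <= i <oo) diam_pow d (F i))%E
            | F in [set F : nat -> set 'rV[R]_n |
                     E `<=` \bigcup_i F i /\
                     forall i x y, F i x -> F i y -> edist x y <= delta]].

Definition Hraw (n d : nat) (E : set 'rV[R]_n) : \bar R :=
  ereal_sup [set Hdelta d delta E | delta in [set delta : R | 0 < delta]].

(* normalized so that a d-dimensional unit cube has measure 1 *)
Definition Hd (n d : nat) (E : set 'rV[R]_n) : \bar R :=
  (Hraw d E * ((fine (Hraw d (@cube d)))^-1)%:E)%E.

Definition C1_on (n m : nat) (W : set 'rV[R]_n) (phi : 'rV[R]_n -> 'rV[R]_m) :=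
  forall x, W x -> differentiable phi x /\
    forall i : 'I_n, {for x, continuous (fun z => 'D_(delta_mx ord0 i) phi z)}.

(* M is a d-dimensional (embedded) C^1 submanifold of R^p: locally the image
   of a C^1 immersion which is a homeomorphism onto its image *)
Definition C1_submanifold (p d : nat) (M : set 'rV[R]_p) :=
  forall x, M x -> exists (U : set 'rV[R]_p) (W : set 'rV[R]_d)
    (phi : 'rV[R]_d -> 'rV[R]_p) (psi : 'rV[R]_p -> 'rV[R]_d),
    [/\ open U, U x, open W & C1_on W phi] /\
    [/\ (forall w, W w -> injective ('d phi w)),
        phi @` W = setI M U,
        (forall w, W w -> psi (phi w) = w) &
        {within setI M U, continuous psi}].

Definition rel_interior (p : nat) (M A : set 'rV[R]_p) : set 'rV[R]_p :=
  [set x | A x /\ exists U : set 'rV[R]_p, open U /\ U x /\ (M `&` U `<=` A)].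

Definition rel_boundary (p : nat) (M A : set 'rV[R]_p) : set 'rV[R]_p :=
  (closure A `&` M) `\` rel_interior M A.

Definition sigma_sp (s : R) (p : nat) : R :=
  fine (lim ((fun N => nratio (PN (@cube p) s N) N (s / p%:R)) @ \oo)).

Definition limval (sigma : R) (h : \bar R) (r : R) : \bar R :=
  match h with
  | EFin x => if x == 0 then +oo%E else (sigma / x `^ r)%:E
  | +oo%E => 0%E
  | -oo%E => +oo%E
  end.

Definition asympt_optimal (p : nat) (A : set 'rV[R]_p) (s : R)
  (w : forall N : nat, 'I_N -> 'rV[R]_p) :=
  (forall N j, A (w N j)) /\
  (fun N => fine (Pconf A s (w N)) / fine (PN A s N)) @ \oo --> (1 : R).

Definition BorelV (p : nat) := g_sigma_algebraType (@open 'rV[R]_p).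

End Defs.

(* Main.v *)
Require Import Defs.
(* On the unit cube, placing scaled copies of an N-point configuration in the
   m^d subcubes gives P(m^d N) >= m^s P(N), and P is monotone in N; hence
   P(N) / N^(s/d) converges to its supremum sigma, so that
   P(N) <= sigma N^(s/d) holds for every N.  Finiteness of sigma comes from
   averaging the potential over the points of a grid that avoid the
   configuration.

   For A in a C^1 manifold M and L > 1, small cells of charts that are
   L-bi-Lipschitz onto their images yield finitely many disjoint relatively open
   "cubes" G_i in A, of side l_i, whose complement in A is compact and of small
   Hausdorff measure.  Lower bound: put about alpha l_i^d N optimally placed
   points in each G_i and an r-net, with r of order N^(-1/d), on the remaining
   small set.  Upper bound: a point y in a slightly shrunken cube of G_i is at
   a positive distance from A \ G_i, whose contribution O(N) is negligible
   because s > d, while the points of the configuration in G_i, pulled back and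
   projected to the shrunken cube, contribute at most about
   sigma n_i^(s/d) / l_i^s at some y.  This bounds the number n_i of points in
   G_i from below; summing over i gives the upper bound for the limit, and for
   asymptotically optimal configurations it gives the weak-star convergence. *)
From HB Require Import structures.
From mathcomp Require Import all_boot all_order all_algebra.
From mathcomp Require Import all_classical all_reals all_analysis.
From mathcomp Require Import measurable_realfun.
From mathcomp Require Import ring lra zify.
Set Implicit Arguments. Unset Strict Implicit. Unset Printing Implicit Defensive.
Import Order.TTheory GRing.Theory Num.Theory.
Import numFieldNormedType.Exports.
Local Open Scope classical_set_scope.
Local Open Scope ring_scope.

Local Notation edist := Defs.edist.

(** * Euclidean distance on row vectors *)

Section Euclid.
Context {R : realType}.

(** Levels of the potential are written (tau * N)^(s/d). In this form the number of points that a
    piece needs is linear in tau and in the mass of the piece, so the needs of the pieces add up,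
    and the critical tau is the one at which they add up to N.

    Only lower bounds on the number of points in a piece can be read off from the potential, because
    additional points never decrease it. They suffice: they hold for all pieces at once, and the
    masses of the pieces nearly exhaust A, so the counts cannot be much larger either.

    Hausdorff measure is never identified with Lebesgue measure. What is used is that it is a Borel
    measure, its behaviour under Lipschitz maps, that the unit cube has positive finite measure, and
    that the faces of a cube are null. The normalization enters through ratios to the measure of the
    unit cube.

    The boundary hypothesis is used in the form that A coincides, up to a null set, with a
    relatively open subset of M contained in A. *)

Definition enorm n (x : 'rV[R]_n) : R := Num.sqrt (\sum_(i < n) (x ord0 i) ^+ 2).

Lemma eucE n (x y : 'rV[R]_n) : edist x y = enorm (x - y).
Proof. by congr Num.sqrt; apply: eq_bigr => i _; rewrite !mxE. Qed.

Lemma enorm_ge0 n (x : 'rV[R]_n) : 0 <= enorm x.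
Proof. exact: sqrtr_ge0. Qed.

Lemma sumsq_ge0 n (x : 'rV[R]_n) : 0 <= \sum_(i < n) (x ord0 i) ^+ 2.
Proof. by apply: sumr_ge0 => i _; exact: sqr_ge0. Qed.

Lemma enorm_sqr n (x : 'rV[R]_n) : enorm x ^+ 2 = \sum_(i < n) (x ord0 i) ^+ 2.
Proof. by rewrite sqr_sqrtr// sumsq_ge0. Qed.

Lemma enormZ n (a : R) (x : 'rV[R]_n) : enorm (a *: x) = `|a| * enorm x.
Proof.
rewrite /enorm -sqrtr_sqr -sqrtrM ?sqr_ge0//; congr Num.sqrt.
by rewrite mulr_sumr; apply: eq_bigr => i _; rewrite mxE exprMn.
Qed.

Lemma enormN n (x : 'rV[R]_n) : enorm (- x) = enorm x.
Proof. by rewrite -scaleN1r enormZ normrN1 mul1r. Qed.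

Lemma cauchy_schwarz n (x y : 'rV[R]_n) :
  \sum_(i < n) x ord0 i * y ord0 i <= enorm x * enorm y.
Proof.
apply: le_trans (ler_norm _) _.
rewrite -sqrtr_sqr /enorm -sqrtrM ?sumsq_ge0// ler_wsqrtr//.
set a := fun i : 'I_n => x ord0 i; set b := fun i : 'I_n => y ord0 i.
(* Lagrange's identity *)
have : 0 <= \sum_i \sum_j (a i * b j - a j * b i) ^+ 2.
  by apply: sumr_ge0 => i _; apply: sumr_ge0 => j _; exact: sqr_ge0.
have -> : \sum_i \sum_j (a i * b j - a j * b i) ^+ 2 =
  2 * ((\sum_i a i ^+ 2) * (\sum_i b i ^+ 2) - (\sum_i a i * b i) ^+ 2).
  have E1 : (\sum_i a i ^+ 2) * (\sum_i b i ^+ 2) =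
     \sum_i \sum_j a i ^+ 2 * b j ^+ 2.
    by rewrite mulr_suml; apply: eq_bigr => i _; rewrite mulr_sumr.
  have E2 : (\sum_i a i ^+ 2) * (\sum_i b i ^+ 2) =
     \sum_i \sum_j a j ^+ 2 * b i ^+ 2.
    by rewrite E1 exchange_big.
  have E3 : (\sum_i a i * b i) ^+ 2 = \sum_i \sum_j (a i * b i) * (a j * b j).
    by rewrite expr2 mulr_suml; apply: eq_bigr => i _; rewrite mulr_sumr.
  rewrite mulrBr [2 * (_ * _)]mulrDl mul1r {1}E1 E2 E3 mulr_sumr -big_split/= -sumrB.
  apply: eq_bigr => i _; rewrite mulr_sumr -big_split/= -sumrB.
  by apply: eq_bigr => j _; ring.
by rewrite pmulr_rge0// subr_ge0.
Qed.

Lemma enormD n (x y : 'rV[R]_n) : enorm (x + y) <= enorm x + enorm y.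
Proof.
rewrite -(@ler_pXn2r _ 2)// ?nnegrE ?addr_ge0 ?enorm_ge0//.
rewrite sqrrD !enorm_sqr.
have -> : \sum_(i < n) (x + y) ord0 i ^+ 2 = \sum_(i < n) x ord0 i ^+ 2
   + (\sum_(i < n) x ord0 i * y ord0 i) *+ 2 + \sum_(i < n) y ord0 i ^+ 2.
  by rewrite -sumrMnl -!big_split/=; apply: eq_bigr => i _; rewrite mxE; ring.
by rewrite lerD2r lerD2l lerMn2r cauchy_schwarz orbT.
Qed.

Lemma enorm_eq0 n (x : 'rV[R]_n) : (enorm x == 0) = (x == 0).
Proof.
apply/eqP/eqP => [|->]; last first.
  by rewrite /enorm big1 ?sqrtr0// => i _; rewrite mxE expr0n.
move=> x0; apply/rowP => i; rewrite mxE; apply/eqP; rewrite -sqrf_eq0.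
have := enorm_sqr x; rewrite x0 expr0n/= => /esym/eqP.
by rewrite psumr_eq0 => [/allP/(_ i)/=->//|j _]; rewrite ?mem_index_enum ?sqr_ge0.
Qed.

Lemma euc_ge0 n (x y : 'rV[R]_n) : 0 <= edist x y.
Proof. by rewrite eucE enorm_ge0. Qed.

Lemma eucC n (x y : 'rV[R]_n) : edist x y = edist y x.
Proof. by rewrite !eucE -enormN opprB. Qed.

Lemma euc_eq0 n (x y : 'rV[R]_n) : (edist x y == 0) = (x == y).
Proof. by rewrite eucE enorm_eq0 subr_eq0. Qed.

Lemma eucxx n (x : 'rV[R]_n) : edist x x = 0.
Proof. by apply/eqP; rewrite euc_eq0. Qed.

Lemma euc_triangle n (y x z : 'rV[R]_n) : edist x z <= edist x y + edist y z.
Proof.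
rewrite !eucE; apply: le_trans (enormD _ _).
by rewrite addrA subrK.
Qed.

Lemma coord_le_enorm n (x : 'rV[R]_n) i : `|x ord0 i| <= enorm x.
Proof.
rewrite -(@ler_pXn2r _ 2)// ?nnegrE ?enorm_ge0// enorm_sqr real_normK ?num_real//.
by rewrite (bigD1 i)//= lerDl sumr_ge0// => j _; exact: sqr_ge0.
Qed.

Lemma coord_le_norm n (x : 'rV[R]_n) i : `|x ord0 i| <= `|x|.
Proof.
rewrite [leRHS]/Num.norm/= mx_normrE.
by apply/bigmax_geP; right => /=; exists (ord0, i).
Qed.

(** The crude factor [n] in place of its square root avoids a root; every use leaves a
    multiplicative constant free. *)
Lemma enorm_le_coord n (x : 'rV[R]_n) (a : R) :
  (forall i, `|x ord0 i| <= a) -> enorm x <= n%:R * a.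
Proof.
case: n x => [x _|n x xa].
  by rewrite mul0r /enorm big_ord0 sqrtr0.
have a0 : 0 <= a by apply: le_trans (xa ord0).
rewrite -(@ler_pXn2r _ 2)// ?nnegrE ?enorm_ge0 ?mulr_ge0// enorm_sqr.
apply: (@le_trans _ _ (\sum_(i < n.+1) a ^+ 2)).
  apply: ler_sum => i _; rewrite -(real_normK (num_real _)).
  by rewrite lerXn2r// ?nnegrE.
rewrite sumr_const card_ord exprMn -[leLHS]mulr_natl ler_wpM2r ?sqr_ge0//.
by rewrite -natrX ler_nat -mulnn leq_pmulr.
Qed.

Lemma norm_le_enorm n (x : 'rV[R]_n) : `|x| <= enorm x.
Proof.
rewrite [leLHS]/Num.norm/= mx_normrE; apply/bigmax_leP; split; first exact: enorm_ge0.
by move=> [i j] _ /=; rewrite ord1 coord_le_enorm.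
Qed.

Lemma enorm_le_norm n (x : 'rV[R]_n) : enorm x <= n%:R * `|x|.
Proof. by apply: enorm_le_coord => i; exact: coord_le_norm. Qed.

Definition eball n (x : 'rV[R]_n) (r : R) : set 'rV[R]_n :=
  [set y | edist x y < r].

(** Bridge from the library topology, given by the max-norm, to Euclidean balls. *)
Lemma nbhs_edistP n (x : 'rV[R]_n) (U : set 'rV[R]_n) :
  nbhs x U <-> exists2 r : R, 0 < r & eball x r `<=` U.
Proof.
split=> [/(nbhs_normP x U).1[e /= e0 eU]|[r r0 rU]].
  exists e => // y xy; apply: eU => /=.
  by apply: le_lt_trans xy; rewrite eucE norm_le_enorm.
(* [n.+1] rather than [n] keeps the radius positive in dimension 0. *)
apply/(nbhs_normP x U).2; exists (r / n.+1%:R); first by rewrite /= divr_gt0.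
move=> y /= xy; apply: rU; rewrite /eball/= eucE.
apply: le_lt_trans (enorm_le_norm _) _.
apply: (@le_lt_trans _ _ (n.+1%:R * `|x - y|)); first by rewrite ler_wpM2r// ler_nat.
by rewrite mulrC -ltr_pdivlMr.
Qed.

Lemma open_edistP n (U : set 'rV[R]_n) :
  open U <-> forall x, U x -> exists2 r : R, 0 < r & eball x r `<=` U.
Proof.
rewrite openE; split=> [UU x /UU|UU x /UU]; rewrite /interior.
  by move=> /nbhs_edistP.
by move=> h; exact/nbhs_edistP.
Qed.

Lemma open_eball n (x : 'rV[R]_n) r : open (eball x r).
Proof.
apply/open_edistP => y xy; exists (r - edist x y); first by rewrite subr_gt0.
move=> z; rewrite /eball/= ltrBrDl; apply: le_lt_trans; exact: euc_triangle.
Qed.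

Lemma eball_center n (x : 'rV[R]_n) r : 0 < r -> eball x r x.
Proof. by rewrite /eball/= eucxx. Qed.

(** Lebesgue's number lemma for an arbitrary predicate [P] on balls, so that both the separation of
    a compact set from the complement of an open set and uniform continuity are instances. The cover
    uses balls of half the radius; the other half absorbs the move from [x] to [y]. *)
Lemma lebesgue_number n (K : set 'rV[R]_n) (P : 'rV[R]_n -> R -> Prop) :
  compact K -> (forall x, K x -> exists2 r, 0 < r & P x r) ->
  exists2 h : R, 0 < h & forall x, K x ->
    exists z r, P z r /\ forall y, edist x y < h -> eball z r y.
Proof.
move=> cK hP.
pose f (xr : 'rV[R]_n * R) := eball xr.1 (xr.2 / 2).
have := cK; rewrite compact_cover => /(_ _ [set xr : 'rV[R]_n * R | 0 < xr.2 /\ P xr.1 xr.2] f).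
case.
- by move=> i _; exact: open_eball.
- move=> x Kx; have [r r0 Pr] := hP x Kx.
  by exists (x, r); [split|apply: eball_center; rewrite divr_gt0].
move=> D Dsub Kcov.
have [h h0 hD] : exists2 h : R, 0 < h & forall i, i \in finmap.enum_fset D -> h <= i.2 / 2.
  have : forall i, i \in finmap.enum_fset D -> 0 < i.2 by move=> i /Dsub; rewrite inE => -[].
  move: (finmap.enum_fset D) => {Dsub Kcov D} s; elim: s => [|a s IH] as_; first by exists 1.
  have [|h h0 hs] := IH; first by move=> i si; apply: as_; rewrite inE si orbT.
  exists (Num.min h (a.2 / 2)); first by rewrite lt_min h0 divr_gt0// as_// inE eqxx.
  by move=> i; rewrite inE ge_min => /orP[/eqP->|/hs->//]; rewrite lexx orbT.
exists h => // x /Kcov[i /= iD xi].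
have := Dsub _ iD; rewrite inE => -[i0 Pi]; exists i.1, i.2; split=> // y xy.
rewrite /eball/= [i.2]splitr; apply: (le_lt_trans (euc_triangle x _ _)).
by rewrite ltrD// (lt_le_trans xy)// hD.
Qed.

Lemma euc_separation n (K : set 'rV[R]_n) (V : set 'rV[R]_n) :
  compact K -> open V -> K `<=` V ->
  exists2 h : R, 0 < h & forall x y, K x -> edist x y < h -> V y.
Proof.
move=> cK oV KV.
have [|h h0 hh] := @lebesgue_number n K (fun x r => eball x r `<=` V) cK.
  by move=> x Kx; have /open_edistP/(_ _ (KV _ Kx))[r r0 rV] := oV; exists r.
by exists h => // x y /hh[z [r [zV xz]]] /xz/zV.
Qed.

Lemma compact_unif_continuous n (K : set 'rV[R]_n) (f : 'rV[R]_n -> R) (e : R) :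
  compact K -> continuous f -> 0 < e ->
  exists2 h : R, 0 < h & forall x y, K x -> edist x y < h -> `|f x - f y| <= e.
Proof.
move=> cK cf e0.
have [|h h0 hh] := @lebesgue_number n K
    (fun x r => forall y, eball x r y -> `|f x - f y| <= e / 2) cK.
  move=> x _; have /cvgrPdist_le/(_ (e / 2)) := cf x.
  by rewrite divr_gt0// => /(_ isT)/nbhs_edistP[r r0 hr]; exists r.
exists h => // x y /hh[z [r [zP xz]]] xy.
have zx := zP _ (xz x _); have zy := zP _ (xz y xy).
rewrite -(subrK (f z) (f x)) -addrA; apply: le_trans (ler_normD _ _) _.
by rewrite [e]splitr lerD ?zy// distrC zx// eucxx.
Qed.

Lemma compact_closed_rV n (K : set 'rV[R]_n) : compact K -> closed K.
Proof. by apply: compact_closed; exact: norm_hausdorff. Qed.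

End Euclid.

(** * Riesz potentials and the unit cube *)

Section Potential.
Context {R : realType}.
Implicit Types s : R.

(** The kernel as a function of the distance alone, which is where its monotonicity and homogeneity
    can be stated, the value +oo at 0 included. *)
Definition kern (s t : R) : \bar R := if t == 0 then +oo%E else (t `^ (- s))%:E.

Lemma rkernE n s (y x : 'rV[R]_n) : rkern s y x = kern s (edist y x).
Proof. by rewrite /rkern /kern euc_eq0. Qed.

Lemma kern_ge0 s t : (0 <= kern s t)%E.
Proof. by rewrite /kern; case: ifP => // _; rewrite lee_fin powR_ge0. Qed.

Lemma rkern_ge0 n s (y x : 'rV[R]_n) : (0 <= rkern s y x)%E.
Proof. by rewrite rkernE kern_ge0. Qed.

Lemma kern_anti s t t' : 0 <= s -> 0 <= t -> t <= t' -> (kern s t' <= kern s t)%E.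
Proof.
move=> s0 t0 tt'; rewrite /kern.
have [_|tn0] := eqVneq t 0; first by rewrite leey.
have tp : 0 < t by rewrite lt_def tn0.
have t'p : 0 < t' by apply: lt_le_trans tt'.
rewrite gt_eqF// lee_fin !powRN lef_pV2 ?posrE ?powR_gt0//.
by rewrite ge0_ler_powR// nnegrE ltW.
Qed.

Lemma kernM s (a t : R) : 0 < a -> 0 <= t ->
  (kern s (a * t) = (a `^ (- s))%:E * kern s t)%E.
Proof.
move=> a0 t0; rewrite /kern mulf_eq0 (gt_eqF a0)/=.
case: ifP => _; last by rewrite powRM// ltW.
by rewrite gt0_muley// lte_fin powR_gt0.
Qed.

(** The two pairs may live in different dimensions: this inequality transports potentials through
    scalings, charts and the projection onto the cube. *)
Lemma rkern_lip n m s (L : R) (y x : 'rV[R]_n) (y' x' : 'rV[R]_m) :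
  0 <= s -> 0 < L -> edist y' x' <= L * edist y x ->
  (rkern s y x <= (L `^ s)%:E * rkern s y' x')%E.
Proof.
move=> s0 L0 yx; rewrite !rkernE.
have -> : L `^ s = L^-1 `^ (- s) by rewrite -powR_inv1 ?ltW// -powRrM mulN1r opprK.
rewrite -kernM ?euc_ge0 ?invr_gt0//; apply: kern_anti => //.
  by rewrite mulr_ge0 ?euc_ge0 ?invr_ge0 ?ltW.
by rewrite mulrC ler_pdivrMr// mulrC.
Qed.

Lemma rkern_ge n s (y x : 'rV[R]_n) a : 0 <= s -> 0 <= a -> edist y x <= a ->
  ((a `^ (- s))%:E <= rkern s y x)%E.
Proof.
move=> s0 a0 yx; rewrite rkernE; apply: le_trans (kern_anti s0 (euc_ge0 _ _) yx).
by rewrite /kern; case: ifP => // _; rewrite leey.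
Qed.

Lemma rkern_le n s (y x : 'rV[R]_n) a : 0 <= s -> 0 < a -> a <= edist y x ->
  (rkern s y x <= (a `^ (- s))%:E)%E.
Proof.
move=> s0 a0 yx; rewrite rkernE; apply: le_trans (kern_anti s0 (ltW a0) yx) _.
by rewrite /kern gt_eqF.
Qed.

Lemma le_Pconf n (A : set 'rV[R]_n) s N (w : 'I_N -> 'rV[R]_n) (c : \bar R) :
  (forall y, A y -> (c <= \sum_(j < N) rkern s y (w j))%E) -> (c <= Pconf A s w)%E.
Proof. by move=> h; apply: le_ereal_inf_tmp => _ [y Ay <-]; exact: h. Qed.

Lemma Pconf_le n (A : set 'rV[R]_n) s N (w : 'I_N -> 'rV[R]_n) y :
  A y -> (Pconf A s w <= \sum_(j < N) rkern s y (w j))%E.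
Proof. by move=> Ay; apply: ereal_inf_le; exists (\sum_(j < N) rkern s y (w j))%E => //; exists y. Qed.

Lemma Pconf_ge0 n (A : set 'rV[R]_n) s N (w : 'I_N -> 'rV[R]_n) : (0 <= Pconf A s w)%E.
Proof. by apply: le_Pconf => y _; apply: sume_ge0 => i _; exact: rkern_ge0. Qed.

Lemma Pconf_le_PN n (A : set 'rV[R]_n) s N (w : 'I_N -> 'rV[R]_n) :
  (forall j, A (w j)) -> (Pconf A s w <= PN A s N)%E.
Proof. by move=> Aw; apply: ereal_sup_ge; exists (Pconf A s w) => //; exists w. Qed.

Lemma PN_le n (A : set 'rV[R]_n) s N (c : \bar R) :
  (forall w : 'I_N -> 'rV[R]_n, (forall j, A (w j)) -> (Pconf A s w <= c)%E) ->
  (PN A s N <= c)%E.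
Proof. by move=> h; apply: ge_ereal_sup => _ [w Aw <-]; exact: h. Qed.

Lemma PN_ge0 n (A : set 'rV[R]_n) s N : A !=set0 -> (0 <= PN A s N)%E.
Proof.
case=> a Aa; apply: le_trans (@Pconf_le_PN _ A s N (fun=> a) _) => //.
exact: Pconf_ge0.
Qed.

Lemma lt_PN n (A : set 'rV[R]_n) s N (c : \bar R) : (c < PN A s N)%E ->
  exists w : 'I_N -> 'rV[R]_n, (forall j, A (w j)) /\ (c < Pconf A s w)%E.
Proof. by move=> /ereal_sup_gt[_ [w Aw <-] cw]; exists w. Qed.

Lemma lt_Pconf n (A : set 'rV[R]_n) s N (w : 'I_N -> 'rV[R]_n) (c : \bar R) :
  (Pconf A s w < c)%E -> exists2 y, A y & (\sum_(j < N) rkern s y (w j) < c)%E.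
Proof. by move=> /ereal_inf_lt[_ [y Ay <-] yc]; exists y. Qed.

(** Superposition of configurations: the kernel is nonnegative, so the union has at least the
    potential of each part. Indices left over are sent to an arbitrary point of [A]. *)
Lemma assemble n (A : set 'rV[R]_n) s (I : finType) (k : I -> nat)
    (u : forall i, 'I_(k i) -> 'rV[R]_n) N :
  A !=set0 -> (forall i j, A (u i j)) -> (\sum_i k i <= N)%N ->
  exists w : 'I_N -> 'rV[R]_n, (forall j, A (w j)) /\
    forall i y, (\sum_(j < k i) rkern s y (u i j) <= \sum_(j < N) rkern s y (w j))%E.
Proof.
move=> [a Aa] Au kN.
pose T := {i : I & 'I_(k i)}.
have cT : (#|{: T}| <= N)%N.
  by rewrite card_tagged sumnE big_map big_enum/= (eq_bigr k)// => i _; rewrite card_ord.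
pose e (t : T) : 'I_N := widen_ord cT (enum_rank t).
have einj : injective e.
  by move=> t t' /(congr1 val)/= /val_inj/enum_rank_inj.
pose w j := if [pick t | e t == j] is Some t then u (tag t) (tagged t) else a.
have we t : w (e t) = u (tag t) (tagged t).
  rewrite /w; case: pickP => [t' /eqP/einj->//|/(_ t)]; by rewrite eqxx.
exists w; split=> [j|i y].
  by rewrite /w; case: pickP.
pose f (j : 'I_(k i)) : 'I_N := e (Tagged _ j).
have finj : injective f.
  by move=> j j' /einj/eqP; rewrite eq_Tagged => /eqP.
have -> : (\sum_(j < k i) rkern s y (u i j) = \sum_(j < k i) rkern s y (w (f j)))%E.
  by apply: eq_bigr => j _; rewrite we.
have /= <- := big_imset (fun j => rkern s y (w j)) (in2W finj : {in predT &, injective f}).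
rewrite [leRHS](bigID (fun j => j \in finset.imset f (mem predT)))/= leeDl//.
by apply: sume_ge0 => j _; exact: rkern_ge0.
Qed.

Lemma grid_coord (m : nat) (t : R) : (0 < m)%N -> 0 <= t <= 1 ->
  exists z : 'I_m, z%:R <= m%:R * t <= z%:R + 1.
Proof.
case: m => // m _ /andP[t0 t1].
(* The last cell takes everything from m / (m + 1) on; at t = 1 truncation would give an index out
   of range. *)
have [mt|tm] := lerP m%:R (m.+1%:R * t).
  by exists ord_max; rewrite mt /= -natr1 ler_piMr// ?ltW.
have h := truncn_itv (mulr_ge0 (ler0n R m.+1) t0).
have zm : (Num.truncn (m.+1%:R * t) < m.+1)%N.
  rewrite ltnS -(ler_nat R); apply: le_trans (ltW tm).
  by case/andP: h.
by exists (Ordinal zm) => /=; case/andP: h => -> /ltW; rewrite natr1.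
Qed.

Lemma grid_cell p (m : nat) (y : 'rV[R]_p) : (0 < m)%N -> cube y ->
  exists z : {ffun 'I_p -> 'I_m}, cube (\row_i (m%:R * y ord0 i - (z i)%:R)).
Proof.
move=> m0 cy.
have h i : exists z : 'I_m, z%:R <= m%:R * y ord0 i <= z%:R + 1.
  exact: grid_coord.
exists [ffun i => projT1 (cid (h i))] => i; rewrite mxE ffunE.
by case: cid => z /= /andP[z1 z2]; rewrite subr_ge0 z1 lerBlDr addrC.
Qed.

Lemma cube0 p : @cube R p 0.
Proof. by move=> i; rewrite mxE lexx ler01. Qed.

Lemma PN_cube_grid p s (m N N' : nat) : 0 <= s -> (0 < m)%N -> (m ^ p * N <= N')%N ->
  ((m%:R `^ s)%:E * PN (@cube R p) s N <= PN (@cube R p) s N')%E.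
Proof.
move=> s0 m0 mN.
have mp : 0 < m%:R :> R by rewrite ltr0n.
rewrite -lee_pdivlMl ?powR_gt0//; apply: PN_le => w cw.
rewrite lee_pdivlMl ?powR_gt0//.
pose u (z : {ffun 'I_p -> 'I_m}) (j : 'I_N) : 'rV[R]_p :=
  \row_i (m%:R^-1 * ((z i)%:R + w j ord0 i)).
have [| | |w' [cw' h]] := @assemble p (@cube R p) s {ffun 'I_p -> 'I_m} (fun=> N) u N'.
- by exists 0; exact: cube0.
- move=> z j i; rewrite mxE; have /andP[w0 w1] := cw j i; apply/andP; split.
    by rewrite mulr_ge0 ?invr_ge0 ?addr_ge0.
  rewrite mulrC ler_pdivrMr// mul1r; apply: le_trans (lerD (lexx _) w1) _.
  by rewrite natr1 ler_nat.
- by rewrite sum_nat_const card_ffun !card_ord.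
apply: (@le_trans _ _ (Pconf (@cube R p) s w')); last exact: Pconf_le_PN.
apply: le_Pconf => y cy.
(* The copy in the subcube of [y] alone already yields the bound. *)
have [z cz] := grid_cell m0 cy.
apply: le_trans (h z y).
apply: (@le_trans _ _ ((m%:R `^ s)%:E * \sum_(j < N)
   rkern s (\row_i (m%:R * y ord0 i - (z i)%:R)%R) (w j))%E).
  by rewrite lee_pmul2l// ?lte_fin ?powR_gt0//; exact: Pconf_le.
rewrite ge0_sume_distrr; last by move=> *; exact: rkern_ge0.
apply: lee_sum => j _.
rewrite -lee_pdivlMl ?powR_gt0// -powRN.
have -> : m%:R `^ (- s) = m%:R^-1 `^ s :> R.
  by rewrite -powR_inv1 ?ltW// -powRrM mulN1r.
apply: rkern_lip; rewrite ?invr_gt0// mulrC ler_pdivlMr// mulrC.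
have {1}-> : m%:R = `|m%:R : R| by rewrite ger0_norm ?ltW.
rewrite !eucE -enormZ le_eqVlt; apply/orP; left; apply/eqP; congr enorm.
by apply/rowP => i; rewrite !mxE mulrBr mulrA divff ?gt_eqF// mul1r; ring.
Qed.

End Potential.

Section PowR.
Context {R : realType}.
Implicit Types a b s : R.

Lemma powR_anti s a b : 0 <= s -> 0 < a -> a <= b -> b `^ (- s) <= a `^ (- s).
Proof.
move=> s0 a0 ab; have b0 := lt_le_trans a0 ab.
by rewrite !powRN lef_pV2 ?posrE ?powR_gt0// ge0_ler_powR// nnegrE ltW.
Qed.

Lemma powR_gt1 s a : 0 < s -> 1 < a -> 1 < a `^ s.
Proof.
move=> s0 a1; have <- : 1 `^ s = 1 :> R by rewrite powR1.
by rewrite gt0_ltr_powR// nnegrE// ltW// (lt_trans ltr01).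
Qed.

Lemma powR_lt1 s a : s < 0 -> 1 < a -> a `^ s < 1.
Proof.
move=> s0 a1; rewrite -[s]opprK powRN invf_lt1 ?powR_gt1 ?oppr_gt0//.
by rewrite powR_gt0// (lt_trans ltr01).
Qed.

Lemma powR_invl s a : 0 <= a -> (a^-1) `^ s = a `^ (- s).
Proof. by move=> a0; rewrite -powR_inv1// -powRrM mulN1r. Qed.

Lemma powRVK s a : 0 <= a -> s != 0 -> (a `^ s^-1) `^ s = a.
Proof. by move=> a0 s0; rewrite -powRrM mulVf// powRr1. Qed.

End PowR.

(** * Upper bound for the cube by averaging over a grid *)

Section CubeBound.
Context {R : realType}.

Lemma le_average (T : finType) (f : T -> R) (t0 : T) :
  exists t, f t *+ #|T| <= \sum_t f t.
Proof.
pose t := [arg min_(t < t0) f t]%O.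
exists t; rewrite -sumr_const; apply: ler_sum => i _.
by rewrite /t; case: arg_minP => // j _; apply.
Qed.

Lemma riemann_bounded (q : R) : 1 < q ->
  exists2 C : R, 0 < C & forall n, \sum_(i < n) (i.+1%:R) `^ (- q) <= C.
Proof.
move=> q1; pose r : R := 2 `^ (1 - q).
have r1 : r < 1 by rewrite powR_lt1//; lra.
exists (1 - r)^-1; first by rewrite invr_gt0 subr_gt0.
move=> n; pose S n := \sum_(i < n) (i.+1%:R) `^ (- q) : R.
rewrite -[leLHS]/(S n).
have SS k : S k.+1 = S k + k.+1%:R `^ (- q) by rewrite /S big_ord_recr.
have mono k l : (k <= l)%N -> S k <= S l.
  move=> /subnK <-; elim: (l - k)%N => // i IH; rewrite addSn.
  by apply: le_trans IH _; rewrite SS lerDl powR_ge0.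
have rE : r = 2 * 2 `^ (- q).
  by rewrite /r powRD ?powRr1//; apply/implyP => _; rewrite pnatr_eq0.
(* Pairing the terms 2j and 2j+1 gives S(2n+1) <= 1 + 2^(1-q) S(n). *)
have dbl k : S (2 * k).+1 <= 1 + r * S k.
  elim: k => [|k IH].
    by rewrite muln0 SS /S !big_ord0 powR1 add0r mulr0 addr0.
  have -> : (2 * k.+1).+1 = (2 * k).+3 by lia.
  rewrite (SS (2 * k).+2) (SS (2 * k).+1) (SS k) mulrDr -addrA [leRHS]addrA; apply: lerD => //.
  rewrite rE -mulrA -powRM// -natrM.
  have -> : (2 * k.+1 = (2 * k).+2)%N by lia.
  rewrite mulr_natl mulr2n lerD2l powR_anti ?ler_nat ?ltr0n//; lra.
have h : S n <= 1 + r * S n by apply: le_trans (dbl n); apply: mono; lia.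
rewrite -[leRHS]mul1r ler_pdivlMr ?subr_gt0//; lra.
Qed.

(* max(1, |a - b|), the subtractions being truncated. *)
Definition nd (a b : nat) : nat := maxn 1 (a - b + (b - a)).

(** Passing from the corner [b] to a point of its cell costs at most 1, which is at most half of an
    index difference that is at least 2. *)
Lemma nd_far (a b : nat) (t : R) : (1 < nd a b)%N -> b%:R <= t <= b%:R + 1 ->
  (nd a b)%:R / 2 <= `|a%:R - t|.
Proof.
rewrite /nd => hi /andP[t1 t2]; have [ab|ba] := leqP a b.
  have hab : (a + 2 <= b)%N by lia.
  have -> : maxn 1 (a - b + (b - a)) = (b - a)%N by lia.
  rewrite natrB//; move: hab; rewrite -(ler_nat R) natrD => hab.
  rewrite distrC ger0_norm; lra.
have hab : (b + 2 <= a)%N by lia.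
have -> : maxn 1 (a - b + (b - a)) = (a - b)%N by lia.
rewrite natrB; last exact: ltnW.
move: hab; rewrite -(ler_nat R) natrD => hab.
rewrite ger0_norm; lra.
Qed.

Lemma line_bounded (q : R) : 1 < q ->
  exists2 C : R, 0 < C & forall m k, \sum_(t < m) (nd t k)%:R `^ (- q) <= C.
Proof.
move=> /riemann_bounded[C C0 hC]; exists (2 * (1 + C)); first by rewrite mulr_gt0// addr_gt0.
move=> m k.
have g_ge0 a : 0 <= (maxn 1 a)%:R `^ (- q) by exact: powR_ge0.
have gC n : \sum_(0 <= t < n) (maxn 1 t)%:R `^ (- q) <= 1 + C.
  case: n => [|n]; first by rewrite big_geq// addr_ge0// ltW.
  rewrite big_nat_recl// powR1 lerD2l big_mkord.
  apply: le_trans (hC n); apply: ler_sum => i _.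
  by have -> : maxn 1 i.+1 = i.+1 by lia.
rewrite -(big_mkord xpredT (fun t => (nd t k)%:R `^ (- q))).
(* The range is enlarged to [k + m] terms so that it can be cut at [k] whatever the order of [m] and
   [k]. Each of the two sides is then bounded by 1 + C. *)
apply: (@le_trans _ _ (\sum_(0 <= t < k + m) (nd t k)%:R `^ (- q))).
  rewrite [leRHS](@big_cat_nat _ _ _ m)//= ?leq_addl// lerDl.
  by apply: sumr_ge0 => i _; exact: g_ge0.
rewrite (@big_cat_nat _ _ _ k)//= ?leq_addr// mulr_natl mulr2n; apply: lerD.
  rewrite big_nat_rev/= add0n; apply: le_trans (gC k.+1).
  rewrite [leRHS]big_nat_recl// -[leLHS]add0r lerD// ?powR_ge0//.
  rewrite le_eqVlt; apply/orP; left; apply/eqP.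
  rewrite big_nat_cond [RHS]big_nat_cond; apply: eq_bigr => i /andP[/andP[_ ik] _].
  by congr (_%:R `^ _); rewrite /nd; lia.
rewrite -{1}[k]add0n big_addn addKn; apply: le_trans (gC m).
rewrite le_eqVlt; apply/orP; left; apply/eqP; apply: eq_bigr => i _.
by congr (_%:R `^ _); rewrite /nd; lia.
Qed.

Lemma grid_sum p (f : nat -> nat -> R) C (k : 'I_p -> nat) (m : nat) :
  (forall t k, 0 <= f t k) -> (forall k, \sum_(t < m) f t k <= C) ->
  \sum_(z : {ffun 'I_p -> 'I_m}) \prod_i f (z i) (k i) <= C ^+ p.
Proof.
move=> f0 fC; rewrite -(bigA_distr_bigA (fun i (t : 'I_m) => f t (k i))).
apply: (@le_trans _ _ (\prod_(i < p) C)); last by rewrite prodr_const card_ord.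
by apply: ler_prod => i _; rewrite fC sumr_ge0.
Qed.

(** Every t in the window satisfies t + T = k + j for one of the 2T + 1 values of j, and each j is
    attained by at most one t. Additive inequalities avoid truncated subtraction. *)
Lemma window_count (m k T : nat) :
  \sum_(t < m) (((k <= t + T) && (t <= k + T))%N%:R : R) <= (2 * T).+1%:R.
Proof.
have one j : \sum_(t < m) ((t + T == j)%N%:R : R) <= 1.
  rewrite -natr_sum lern1.
  have [/existsP[t /eqP tj]|/existsPn h] := boolP [exists t : 'I_m, t + T == j]%N.
    rewrite (bigD1 t)//= tj eqxx big1// => i it; case: eqP => // ij.
    by case/eqP: it; apply: val_inj => /=; lia.
  by rewrite big1// => i _; have := h i; case: eqP.
apply: (@le_trans _ _ (\sum_(t < m) \sum_(j < (2 * T).+1) ((t + T == k + j)%N%:R : R))).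
  apply: ler_sum => t _; have [/andP[h1 h2]|_] := boolP (_ && _); last first.
    by apply: sumr_ge0 => *; rewrite ler0n.
  have hj : (t + T - k < (2 * T).+1)%N by lia.
  rewrite (bigD1 (Ordinal hj))//= subnKC// eqxx lerDl.
  by apply: sumr_ge0 => *; rewrite ler0n.
rewrite exchange_big/=; apply: (@le_trans _ _ (\sum_(j < (2 * T).+1) 1)).
  by apply: ler_sum => j _; exact: one.
by rewrite sumr_const card_ord.
Qed.

Lemma near_count m k : \sum_(t < m) ((nd t k <= 1)%N%:R : R) <= 3.
Proof.
apply: le_trans (window_count m k 1).
by apply: ler_sum => t _; rewrite ler_nat /nd; lia.
Qed.

(* For the grid index z of y and the cell index k of a configuration point x one
   has |y - x| >= max_i nd(z_i, k_i) / (2m) unless z and k are neighbours, so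
   |y - x|^(-s) is at most the product over i of (nd(z_i, k_i) / (2m))^(-s/p),
   whose sum over z factorizes.  The penalty B b forces the selected z not to be
   a neighbour of any configuration point. *)
Lemma PN_cube_avg p (s : R) : (0 < p)%N -> p%:R < s ->
  exists2 C : R, 0 < C & forall m N : nat, (0 < N)%N -> (2 * 3 ^ p * N <= m ^ p)%N ->
    (PN (@cube R p) s N <= ((C * m%:R `^ s))%:E)%E.
Proof.
move=> p0 ps; have pp : 0 < p%:R :> R by rewrite ltr0n.
have s0 : 0 < s by apply: lt_trans ps.
pose q := s / p%:R.
have q1 : 1 < q by rewrite ltr_pdivlMr// mul1r.
have [C C0 hC] := line_bounded q1.
exists (2 `^ s * C ^+ p + 1).
  by rewrite addr_gt0// mulr_gt0 ?powR_gt0 ?exprn_gt0.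
move=> m N N0 mN.
have mp0 : (0 < m ^ p)%N by apply: leq_trans mN; rewrite !muln_gt0 N0 expn_gt0.
have m0 : (0 < m)%N by move: mp0; rewrite expn_gt0 => /orP[//|/eqP p00]; rewrite p00 in p0.
have mR : 0 < m%:R :> R by rewrite ltr0n.
apply: PN_le => w cw.
have /choice[k hk] : forall j : 'I_N, exists z : {ffun 'I_p -> 'I_m}, cube (\row_i (m%:R * w j ord0 i - (z i)%:R)).
  by move=> j; apply: grid_cell.
pose B := (2 `^ s * C ^+ p + 1) * m%:R `^ s.
pose g (z : {ffun 'I_p -> 'I_m}) (j : 'I_N) := \prod_i (nd (z i) (k j i))%:R `^ (- q).
pose b (z : {ffun 'I_p -> 'I_m}) (j : 'I_N) := \prod_i ((nd (z i) (k j i) <= 1)%N%:R : R).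
pose f z := \sum_j ((2 * m%:R) `^ s * g z j + B * b z j).
have B0 : 0 < B by rewrite mulr_gt0 ?powR_gt0// addr_gt0// mulr_gt0 ?powR_gt0 ?exprn_gt0.
have [z hz] := le_average f [ffun => Ordinal m0].
(* By the hypothesis on [m], N * 3^p is at most half the number of grid points. Hence the penalties
   average to at most B / 2, and the kernel part, whose average per configuration point is below B /
   m^p, to less than B / 2. *)
have fz : f z < B.
  rewrite -mulr_natr card_ffun !card_ord in hz.
  have h1 : \sum_z f z <= N%:R * ((2 * m%:R) `^ s * C ^+ p + B * 3 ^+ p).
    rewrite /f exchange_big/=.
    apply: (@le_trans _ _ (\sum_(j < N) ((2 * m%:R) `^ s * C ^+ p + B * 3 ^+ p))).
      2: by rewrite sumr_const card_ord [leRHS]mulr_natl lexx.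
    apply: ler_sum => j _; rewrite big_split/= -!mulr_sumr; apply: lerD.
      rewrite ler_wpM2l ?powR_ge0//.
      by apply: (@grid_sum p (fun t k => (nd t k)%:R `^ (- q))) => // *; exact: powR_ge0.
    rewrite ler_wpM2l ?(ltW B0)//.
    by apply: (@grid_sum p (fun t k => (nd t k <= 1)%N%:R)) => // *; exact: near_count.
  have {h1}hz := le_trans hz h1.
  have M0 : 0 < (m ^ p)%:R :> R by rewrite ltr0n.
  rewrite -(ltr_pM2r M0); apply: le_lt_trans hz _.
  have mN' : 2 * 3 ^+ p * N%:R <= (m ^ p)%:R :> R.
    by rewrite -[3 ^+ p]natrX -!natrM ler_nat.
  have p3 : 1 <= 3 ^+ p :> R by rewrite exprn_ege1// ler1n.
  have NR : 0 < N%:R :> R by rewrite ltr0n.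
  have N3 : N%:R <= 3 ^+ p * N%:R :> R by rewrite ler_peMl// ltW.
  set M := (m ^ p)%:R in M0 mN' *.
  have DB : (2 * m%:R) `^ s * C ^+ p < B.
    rewrite powRM// mulrAC /B ltr_pM2r ?powR_gt0//; lra.
  have D0 : 0 <= (2 * m%:R) `^ s * C ^+ p by rewrite mulr_ge0 ?powR_ge0// exprn_ge0// ltW.
  set D := _ * C ^+ p in DB D0 *.
  have : N%:R * D < M / 2 * B.
    apply: (@le_lt_trans _ _ (M / 2 * D)); first by rewrite ler_wpM2r//; lra.
    by rewrite ltr_pM2l// divr_gt0.
  have : N%:R * (B * 3 ^+ p) <= M / 2 * B.
    by rewrite mulrCA mulrC ler_wpM2r ?(ltW B0)//; lra.
  rewrite mulrDr; lra.
pose y : 'rV[R]_p := \row_i (m%:R^-1 * (z i)%:R).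
have cy : cube y.
  move=> i; rewrite mxE mulr_ge0 ?invr_ge0//= mulrC ler_pdivrMr// mul1r ler_nat.
  by rewrite ltnW.
apply: le_trans (Pconf_le _ _ cy) _.
apply: (@le_trans _ _ (f z)%:E); last by rewrite lee_fin ltW.
rewrite -sumEFin; apply: lee_sum => j _.
have f0 z' j' : 0 <= (2 * m%:R) `^ s * g z' j' + B * b z' j'.
  rewrite addr_ge0// mulr_ge0 ?powR_ge0 ?(ltW B0)//; apply: prodr_ge0 => i _ //.
have [i0 hi0] : exists i, (1 < nd (z i) (k j i))%N.
  apply/existsP; rewrite -[[exists _, _]]negbK; apply/negP => /existsPn h.
  move: fz; apply/negP; rewrite -leNgt /f (bigD1 j)//= -[leLHS]addr0 lerD//; last first.
    by apply: sumr_ge0 => ? _.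
  rewrite [b z j]big1 ?mulr1; last by move=> i _; rewrite leqNgt (negbTE (h i)).
  by rewrite lerDr mulr_ge0 ?powR_ge0//; apply: prodr_ge0 => i _; exact: powR_ge0.
set e := edist y (w j).
have far i : (1 < nd (z i) (k j i))%N -> (nd (z i) (k j i))%:R / (2 * m%:R) <= e.
  move=> hi; apply: (@le_trans _ _ (`|y ord0 i - w j ord0 i|)); last first.
    by rewrite /e eucE; have := coord_le_enorm (y - w j) i; rewrite !mxE.
  rewrite invfM mulrA ler_pdivrMr// -[m%:R]ger0_norm// -normrM mulrBl !mxE.
  rewrite mulrAC mulVf ?gt_eqF// mul1r.
  have := hk j i; rewrite mxE mulrC; move: (w j ord0 i * m%:R) => t.
  rewrite subr_ge0 lerBlDr [1 + _]addrC; move: hi.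
  exact: nd_far.
have m20 : 0 < 2 * m%:R :> R by rewrite mulr_gt0.
(* In a coordinate where the indices are neighbours, [nd] equals 1 and the bound from the coordinate
   [i0] is stronger. *)
have all_far i : (nd (z i) (k j i))%:R / (2 * m%:R) <= e.
  have [/far//|hi] := ltnP 1 (nd (z i) (k j i)).
  apply: le_trans (far _ hi0); rewrite ler_pM2r ?invr_gt0// ler_nat.
  by apply: leq_trans hi _; apply: ltnW.
have ndp i : 0 < (nd (z i) (k j i))%:R :> R by rewrite ltr0n leq_maxl.
have e0 : 0 < e by apply: lt_le_trans (all_far i0); rewrite divr_gt0.
apply: (@le_trans _ _ (e `^ (- s))%:E); first by apply: rkern_le => //; exact: ltW.
rewrite lee_fin -[leLHS]addr0 lerD//; last first.
  by rewrite mulr_ge0 ?(ltW B0)//; apply: prodr_ge0.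
have qp : q * p%:R = s by rewrite /q divfK// gt_eqF.
have -> : (2 * m%:R) `^ s = \prod_(i < p) (2 * m%:R) `^ q.
  by rewrite prodr_const card_ord -powR_mulrn ?powR_ge0// -powRrM qp.
have -> : e `^ (- s) = \prod_(i < p) e `^ (- q).
  by rewrite prodr_const card_ord -powR_mulrn ?powR_ge0// -powRrM mulNr qp.
rewrite /g -big_split/=; apply: ler_prod => i _; rewrite powR_ge0/=.
have -> : (2 * m%:R) `^ q = (2 * m%:R)^-1 `^ (- q).
  by rewrite powR_invl ?(ltW m20)// opprK.
rewrite -powRM ?invr_ge0 ?(ltW m20)// mulrC powR_anti ?divr_gt0//.
by rewrite (le_trans ler01)// ltW.
Qed.

End CubeBound.

(** * Existence of the limit for the cube *)

Section CubeLimit.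
Context {R : realType}.

Lemma PN_cube_upper p (s : R) : (0 < p)%N -> p%:R < s ->
  exists2 C : R, 0 < C & forall N : nat, (0 < N)%N ->
    (PN (@cube R p) s N <= (C * N%:R `^ (s / p%:R))%:E)%E.
Proof.
move=> p0 ps; have [C C0 hC] := PN_cube_avg p0 ps.
have pp : 0 < p%:R :> R by rewrite ltr0n.
have s0 : 0 < s by apply: lt_trans ps.
exists (C * 12 `^ s); first by rewrite mulr_gt0 ?powR_gt0.
move=> N N0; pose x : R := N%:R `^ p%:R^-1.
have N1 : 1 <= N%:R :> R by rewrite ler1n.
have x1 : 1 <= x.
  by rewrite /x -[leLHS](@powRr0 R N%:R) ler_powR// invr_ge0 ltW.
have xp : x ^+ p = N%:R by rewrite -powR_mulrn ?powR_ge0// powRVK// gt_eqF.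
(* N <= k^p and k <= 2x. The grid size m = 6k then satisfies m^p >= 6^p N >= 2 * 3^p * N because p >
   0, and m <= 12x. *)
pose k := (Num.truncn x).+1.
have /andP[k1 k2] := truncn_itv (le_trans ler01 x1).
apply: (le_trans (hC (6 * k)%N N N0 _)).
  have kN : (N <= k ^ p)%N.
    by rewrite -(ler_nat R) natrX -xp lerXn2r// ?nnegrE ?(le_trans ler01 x1)// ltW.
  rewrite expnMn leq_mul//.
  case: (p) p0 => // p' _; rewrite !expnS mulnA leq_mul//.
  by elim: p' => // n IH; rewrite !expnS leq_mul.
rewrite lee_fin -mulrA ler_wpM2l ?(ltW C0)//.
rewrite [_ / _]mulrC powRrM -/x -powRM ?(le_trans ler01 x1)//.
rewrite ge0_ler_powR ?nnegrE ?(ltW s0)// ?mulr_ge0// ?(le_trans ler01 x1)//.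
rewrite natrM /k -natr1; lra.
Qed.

(** Since (m / (m + 1))^s tends to 1, rounding the number of subcubes per side down to an integer
    costs an arbitrarily small factor. *)
Lemma ratio_near1 (s c : R) : 0 < s -> 0 < c < 1 ->
  exists K : nat, forall m, (K <= m)%N -> c * m.+1%:R `^ s <= m%:R `^ s.
Proof.
move=> s0 /andP[c0 c1]; pose t := c `^ s^-1.
have t1 : t < 1.
  have -> : 1 = 1 `^ s^-1 :> R by rewrite powR1.
  by rewrite gt0_ltr_powR ?invr_gt0// nnegrE ltW.
have t0 : 0 < t by rewrite powR_gt0.
exists (Num.truncn (t / (1 - t))).+1 => m Km.
have -> : c = t `^ s by rewrite powRVK ?gt_eqF// ltW.
rewrite -powRM ?(ltW t0)// ge0_ler_powR ?nnegrE ?mulr_ge0 ?(ltW t0) ?(ltW s0)//.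
have : t / (1 - t) <= m%:R.
  apply: le_trans (ltW (truncnS_gt _)) _.
  by rewrite ler_nat.
rewrite ler_pdivrMr ?subr_gt0// -natr1; lra.
Qed.

Lemma cube_sigma p (s : R) : (0 < p)%N -> p%:R < s ->
  exists2 sigma : R, 0 < sigma &
   (forall N, PN (@cube R p) s N <= (sigma * N%:R `^ (s / p%:R))%:E)%E /\
   (forall t, t < sigma -> exists N0, forall N, (N0 <= N)%N ->
       ((t * N%:R `^ (s / p%:R))%:E <= PN (@cube R p) s N)%E).
Proof.
move=> p0 ps; have [C C0 hC] := PN_cube_upper p0 ps.
have pp : 0 < p%:R :> R by rewrite ltr0n.
have s0 : 0 < s by apply: lt_trans ps.
pose q := s / p%:R; rewrite -/q in hC *.
have q0 : 0 < q by rewrite divr_gt0.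
have cn0 : @cube R p !=set0 by exists 0; exact: cube0.
have fin N : (0 < N)%N -> PN (@cube R p) s N \is a fin_num.
  by move=> /hC h; rewrite ge0_fin_numE ?PN_ge0//; apply: le_lt_trans h (ltry _).
pose a N := fine (PN (@cube R p) s N) / N%:R `^ q.
have Nq N : (0 < N)%N -> 0 < N%:R `^ q :> R by move=> N0; rewrite powR_gt0 ?ltr0n.
have aE N : (0 < N)%N -> PN (@cube R p) s N = (a N * N%:R `^ q)%:E.
  by move=> N0; rewrite /a divfK ?gt_eqF ?Nq// fineK ?fin.
pose E := [set a N | N in [set N | (0 < N)%N]].
have hasE : has_sup E.
  split; first by exists (a 1%N), 1%N.
  exists C => _ [N N0 <-]; rewrite -(ler_pM2r (Nq N N0)) -lee_fin -aE//; exact: hC.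
have ub N : (0 < N)%N -> a N <= sup E.
  by move=> N0; apply: sup_upper_bound => //; exists N.
have a1 : 0 < a 1%N.
  rewrite -[ltRHS]mulr1; have <- : 1%:R `^ q = 1 :> R by rewrite powR1.
  rewrite -lte_fin -aE//.
  apply: (@lt_le_trans _ _ (p%:R `^ (- s))%:E); first by rewrite lte_fin powR_gt0.
  apply: (@le_trans _ _ (Pconf (@cube R p) s (fun _ : 'I_1 => 0))).
    apply: le_Pconf => y cy; rewrite big_ord1; apply: rkern_ge; rewrite ?(ltW s0) ?(ltW pp)//.
    rewrite eucE subr0 -[leRHS]mulr1; apply: enorm_le_coord => i.
    by have /andP[y0 y1] := cy i; rewrite ger0_norm.
  by apply: Pconf_le_PN => _; exact: cube0.
exists (sup E); first exact: lt_le_trans a1 (ub _ _).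
split=> [[|N]|t tE].
- apply: PN_le => w _; apply: le_trans (Pconf_le _ _ (@cube0 R p)) _.
  by rewrite big_ord0 powR0 ?mulr0// gt_eqF.
- by rewrite aE// lee_fin ler_wpM2r ?powR_ge0// ub.
have [t0|t0] := leP t 0.
  exists 0%N => N _; apply: le_trans (PN_ge0 _ _ cn0).
  by rewrite lee_fin mulr_le0_ge0// powR_ge0.
have [_ [N1 /= N10 <-] tN1] := sup_gt (proj1 hasE) tE.
have aN1 : 0 < a N1 by apply: lt_trans tN1.
have [K hK] : exists K : nat, forall m, (K <= m)%N -> t / a N1 * m.+1%:R `^ s <= m%:R `^ s.
  by apply: ratio_near1 => //; rewrite divr_gt0// ltr_pdivrMr// mul1r.
exists (K ^ p * N1)%N => N KN.
(* With m the integer part of x, the m^p copies of an N1-point configuration fit into N points,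
   while N <= (m + 1)^p * N1. The loss is absorbed by the factor t / a N1 < 1. *)
pose x : R := (N%:R / N1%:R) `^ p%:R^-1.
have x0 : 0 <= x by exact: powR_ge0.
have N1R : 0 < N1%:R :> R by rewrite ltr0n.
have xp : x ^+ p = N%:R / N1%:R.
  by rewrite -powR_mulrn// powRVK ?divr_ge0// gt_eqF.
pose m := Num.truncn x.
have /andP[m1 m2] := truncn_itv x0; rewrite -/m in m1 m2.
have Km : (K <= m)%N.
  rewrite -ltnS -(ltr_nat R); apply: le_lt_trans m2.
  rewrite -(@ler_pXn2r _ p)// ?nnegrE// xp ler_pdivlMr// -natrX -natrM ler_nat//.
have mN : (m ^ p * N1 <= N)%N.
  by rewrite -(ler_nat R) natrM natrX -ler_pdivlMr// -xp lerXn2r// nnegrE.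
(* If m = 0 then K = 0, and [hK] at 0 would read t / a N1 <= 0. *)
have [m0|m0] := posnP m.
  have := hK 0%N; rewrite -{1}m0 Km powR1 powR0 ?gt_eqF// mulr1 => /(_ isT).
  by rewrite leNgt divr_gt0.
apply: le_trans (PN_cube_grid (ltW s0) m0 mN).
rewrite aE// -EFinM lee_fin.
have NN : N%:R `^ q <= m.+1%:R `^ s * N1%:R `^ q.
  have -> : m.+1%:R `^ s = (m.+1%:R ^+ p) `^ q :> R.
    by rewrite -powR_mulrn// -powRrM mulrC divfK// gt_eqF.
  rewrite -powRM// ?exprn_ge0// ge0_ler_powR ?nnegrE ?(ltW q0)// ?mulr_ge0 ?exprn_ge0//.
  by rewrite -ler_pdivrMr// -xp lerXn2r// ?nnegrE// ltW.
apply: (@le_trans _ _ (t * (m.+1%:R `^ s * N1%:R `^ q))).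
  by rewrite ler_wpM2l// ltW.
rewrite mulrA mulrA ler_wpM2r ?powR_ge0//.
by have := hK m Km; rewrite -(ler_pM2r aN1) mulrAC divfK// gt_eqF.
Qed.

(** The two bounds force [P N] to be finite from some N on, which reduces the claim to convergence
    of real numbers. *)
Lemma nratio_cvg (P : nat -> \bar R) (q sigma : R) :
  (forall t, t < sigma -> \forall N \near \oo, ((t * N%:R `^ q)%:E <= P N)%E) ->
  (forall t, sigma < t -> \forall N \near \oo, (P N <= (t * N%:R `^ q)%:E)%E) ->
  (fun N => nratio (P N) N q) @ \oo --> sigma%:E.
Proof.
move=> lo hi.
have Npos : \forall N \near \oo, 0 < N%:R `^ q :> R.
  by exists 1%N => // N /= N0; rewrite powR_gt0 ?ltr0n.
have fin : \forall N \near \oo, nratio (P N) N q = (fine (P N) / N%:R `^ q)%:E.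
  have /lo l1 : sigma - 1 < sigma by lra.
  have /hi h1 : sigma < sigma + 1 by lra.
  near=> N; rewrite /nratio EFinM fineK// fin_numE; apply/andP; split; apply/eqP => PN.
    suff : (((sigma - 1) * N%:R `^ q)%:E <= -oo)%E by rewrite leeNy_eq.
    by rewrite -PN; near: N.
  suff : (+oo <= ((sigma + 1) * N%:R `^ q)%:E)%E by rewrite leye_eq.
  by rewrite -PN; near: N.
apply: (@cvg_trans _ ((fun N => (fine (P N) / N%:R `^ q)%:E) @ \oo)).
  by apply: near_eq_cvg; apply: filterS fin => N ->.
apply: cvg_EFin; first exact: nearW.
apply/cvgrPdist_le => e e0.
have /lo lo' : sigma - e < sigma by lra.
have /hi hi' : sigma < sigma + e by lra.
near=> N; have N0 : 0 < N%:R `^ q :> R by near: N.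
have NE : nratio (P N) N q = (fine (P N) / N%:R `^ q)%:E by near: N.
have N0' : (0 < (N%:R `^ q)^-1%:E)%E by rewrite lte_fin invr_gt0.
rewrite ler_distlC -!lee_fin -NE /nratio; apply/andP; split.
  by rewrite lee_pdivlMr// -EFinM; near: N.
by rewrite lee_pdivrMr// -EFinM; near: N.
Unshelve. all: end_near. Qed.

Lemma cube_limit p (s : R) : (0 < p)%N -> p%:R < s ->
  [/\ (fun N => nratio (PN (@cube R p) s N) N (s / p%:R)) @ \oo --> (sigma_sp s p)%:E,
   0 < sigma_sp s p,
   (forall N, PN (@cube R p) s N <= (sigma_sp s p * N%:R `^ (s / p%:R))%:E)%E &
   (forall t, t < sigma_sp s p -> exists N0, forall N, (N0 <= N)%N ->
       ((t * N%:R `^ (s / p%:R))%:E <= PN (@cube R p) s N)%E)].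
Proof.
move=> p0 ps; have [sigma sigma0 [ub lb]] := cube_sigma p0 ps.
have cv : (fun N => nratio (PN (@cube R p) s N) N (s / p%:R)) @ \oo --> sigma%:E.
  apply: nratio_cvg => t ht.
    by have [N0 hN0] := lb t ht; exists N0.
  by apply: nearW => N; apply: le_trans (ub N) _; rewrite lee_fin ler_wpM2r ?powR_ge0// ltW.
suff -> : sigma_sp s p = sigma by [].
by rewrite /sigma_sp (cvg_lim _ cv)//; exact: ereal_hausdorff.
Qed.

End CubeLimit.

(** * Hausdorff measure *)

Section HausdorffOuter.
Context {R : realType}.
Variables (n d : nat).
Implicit Types (U E : set 'rV[R]_n) (F : nat -> set 'rV[R]_n).
Local Open Scope ereal_scope.

Lemma diam_pow_ge0 U : 0 <= diam_pow d U.
Proof. by apply: ereal_sup_ubound; right. Qed.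

Lemma diam_pow_set0 : diam_pow d (@set0 'rV[R]_n) = 0.
Proof.
apply/eqP; rewrite eq_le diam_pow_ge0 andbT; apply: ge_ereal_sup.
by move=> z [[x [y []]]//|->].
Qed.

Lemma diam_pow_le_bound U (r : R) : (0 <= r)%R ->
  (forall x y, U x -> U y -> (edist x y <= r)%R) -> diam_pow d U <= (r ^+ d)%:E.
Proof.
move=> r0 Ur; apply: ge_ereal_sup => z [[x [y [Ux Uy ->]]]|->]; rewrite lee_fin ?exprn_ge0//.
by rewrite lerXn2r ?nnegrE ?euc_ge0// Ur.
Qed.

Definition hcover (delta : R) E F :=
  E `<=` \bigcup_i F i /\ forall i x y, F i x -> F i y -> (edist x y <= delta)%R.

Lemma Hdelta_ge0 delta E : 0 <= Hdelta d delta E.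
Proof. by apply: le_ereal_inf_tmp => _ [F _ <-]; apply: nneseries_ge0 => i _ _; exact: diam_pow_ge0. Qed.

Lemma Hdelta_le delta E F : hcover delta E F ->
  Hdelta d delta E <= \sum_(0 <= i <oo) diam_pow d (F i).
Proof. by move=> h; apply: ereal_inf_lbound; exists F. Qed.

Lemma Hdelta_lt delta E c : Hdelta d delta E < c ->
  exists2 F, hcover delta E F & \sum_(0 <= i <oo) diam_pow d (F i) < c.
Proof. by move=> /ereal_inf_lt[_ [F hF <-] h]; exists F. Qed.

Lemma le_Hdelta delta E c : (forall F, hcover delta E F ->
  c <= \sum_(0 <= i <oo) diam_pow d (F i)) -> c <= Hdelta d delta E.
Proof. by move=> h; apply: le_ereal_inf_tmp => _ [F /h hF <-]. Qed.

Lemma Hdelta_mono delta delta' E E' : (delta' <= delta)%R -> E `<=` E' ->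
  Hdelta d delta E <= Hdelta d delta' E'.
Proof.
move=> dd EE'; apply: le_Hdelta => F [F1 F2]; apply: Hdelta_le; split.
  exact: subset_trans F1.
by move=> i x y Fx Fy; apply: le_trans (F2 i x y Fx Fy) dd.
Qed.

Lemma Hdelta_le_Hraw delta E : (0 < delta)%R -> Hdelta d delta E <= Hraw d E.
Proof. by move=> d0; apply: ereal_sup_ubound; exists delta. Qed.

Lemma Hraw_le E c : (forall delta, (0 < delta)%R -> Hdelta d delta E <= c) ->
  Hraw d E <= c.
Proof. by move=> h; apply: ge_ereal_sup => _ [delta /h hd <-]. Qed.

Lemma Hraw_ge0 E : 0 <= Hraw d E.
Proof. exact: le_trans (Hdelta_ge0 1 E) (Hdelta_le_Hraw _ _). Qed.

Lemma Hraw_set0 : Hraw d (@set0 'rV[R]_n) = 0.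
Proof.
apply/eqP; rewrite eq_le Hraw_ge0 andbT; apply: Hraw_le => delta d0.
apply: le_trans (Hdelta_le (F := fun=> set0) _) _; first by split.
by rewrite eseries0// => i _ _; exact: diam_pow_set0.
Qed.

Lemma Hraw_homo : {homo (Hraw d : set 'rV[R]_n -> \bar R) : A B / A `<=` B >-> A <= B}.
Proof.
move=> A B AB; apply: Hraw_le => delta d0; apply: le_trans (Hdelta_le_Hraw B d0).
exact: Hdelta_mono.
Qed.

(** A bijection between [nat * nat] and [nat] enumerates all the covers as one; the terms are
    nonnegative, so the double sum may be rearranged. *)
Lemma hcover_merge delta (E : nat -> set 'rV[R]_n) (G : nat -> nat -> set 'rV[R]_n) :
  (forall k, hcover delta (E k) (G k)) -> exists2 F, hcover delta (\bigcup_k E k) F &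
  \sum_(0 <= i <oo) diam_pow d (F i) =
  \sum_(0 <= i <oo) \sum_(0 <= j <oo) diam_pow d (G i j).
Proof.
move=> hG; have /ppcard_eqP[f] := card_nat2.
exists (fun k => G (f^-1%FUN k).1 (f^-1%FUN k).2).
  split=> [x [k _ /(proj1 (hG k))[j _ Gx]]|k x y]; last exact: (proj2 (hG _)).
  by exists (f (k, j)) => //; rewrite invK// inE.
rewrite !nneseries_esumT; last 2 first.
- by move=> i; apply: nneseries_ge0 => j _ _; exact: diam_pow_ge0.
- by move=> i; exact: diam_pow_ge0.
rewrite (eq_esum (a := fun i => \sum_(0 <= j <oo) diam_pow d (G i j))
  (b := fun i => \esum_(j in setT) diam_pow d (G i j))); last first.
  by move=> i _; rewrite nneseries_esumT// => j; exact: diam_pow_ge0.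
rewrite esum_esum//=; last by move=> *; exact: diam_pow_ge0.
rewrite (_ : setT `*`` _ = setT); last by apply/seteqP; split.
rewrite (reindex_esum [set: nat * nat] setT f) => //=.
by apply: eq_esum => i _; rewrite funK ?inE.
Qed.

Lemma Hraw_sigma_subadditive : sigma_subadditive (Hraw d : set 'rV[R]_n -> \bar R).
Proof.
move=> A; apply: Hraw_le => delta d0.
have [[i ioo]|] := pselect (exists i, Hraw d (A i) = +oo).
  by rewrite (eseries_pinfty _ _ ioo) ?leey// => k _; rewrite -ltNye (lt_le_trans _ (Hraw_ge0 _)).
rewrite -forallNE => Aoo.
apply/lee_addgt0Pr => e e0.
rewrite (le_trans _ (epsilon_trick _ _ (ltW e0)))//; last by move=> k; exact: Hraw_ge0.
have /choice[G hG] : forall k, exists G, hcover delta (A k) G /\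
    \sum_(0 <= i <oo) diam_pow d (G i) <= Hraw d (A k) + (e / (2 ^ k.+1)%:R)%:E.
  move=> k; have [|G hG] := @Hdelta_lt delta (A k) (Hraw d (A k) + (e / (2 ^ k.+1)%:R)%:E).
    apply: le_lt_trans (Hdelta_le_Hraw _ d0) _; rewrite lteDl ?lte_fin ?divr_gt0 ?ltr0n ?expn_gt0//.
    by rewrite ge0_fin_numE ?Hraw_ge0// ltey; apply/eqP.
  by exists G; split=> //; exact: ltW.
have [F hF EF] := hcover_merge (fun k => proj1 (hG k)).
apply: le_trans (Hdelta_le hF) _; rewrite EF; apply: lee_nneseries => k _.
  by move=> _; apply: nneseries_ge0 => j _ _; exact: diam_pow_ge0.
exact: (proj2 (hG k)).
Qed.

HB.instance Definition _ := isOuterMeasure.Build R 'rV[R]_n (Hraw d : set 'rV[R]_n -> \bar R)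
  Hraw_set0 Hraw_ge0 Hraw_homo Hraw_sigma_subadditive.

Lemma HrawU (A B : set 'rV[R]_n) : Hraw d (A `|` B) <= Hraw d A + Hraw d B.
Proof. exact: outer_measureU2. Qed.

(** Metric outer measure property: a set of diameter below [h] cannot meet both [A] and [B], so a
    fine cover of the union splits into covers of the two parts. *)
Lemma Hraw_separated (A B : set 'rV[R]_n) (h : R) : (0 < h)%R ->
  (forall x y, A x -> B y -> (h <= edist x y)%R) ->
  Hraw d A + Hraw d B <= Hraw d (A `|` B).
Proof.
move=> h0 AB.
(* Two independent scales allow the two suprema to be taken one after the other. *)
have key (d1 d2 : R) : (0 < d1)%R -> (0 < d2)%R ->
    Hdelta d d1 A + Hdelta d d2 B <= Hraw d (A `|` B).
  move=> d10 d20; pose dl := Num.min (Num.min d1 d2) (h / 2)%R.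
  have dl0 : (0 < dl)%R by rewrite !lt_min d10 d20 divr_gt0.
  have dl1 : (dl <= d1)%R by rewrite !ge_min lexx.
  have dl2 : (dl <= d2)%R by rewrite !ge_min lexx orbT.
  have dlh : (dl < h)%R by rewrite gt_min; apply/orP; right; lra.
  apply: (@le_trans _ _ (Hdelta d dl A + Hdelta d dl B)).
    by rewrite leeD// Hdelta_mono.
  apply: le_trans (Hdelta_le_Hraw _ dl0); apply: le_Hdelta => F [F1 F2].
  pose FA C i := if `[< F i `&` C !=set0 >] then F i else set0.
  have cov C : C `<=` A `|` B -> Hdelta d dl C <= \sum_(0 <= i <oo) diam_pow d (FA C i).
    move=> CAB; apply: Hdelta_le; split=> [x Cx|i x y].
      have [i _ Fx] := F1 _ (CAB _ Cx); exists i => //.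
      by rewrite /FA; case: asboolP => // -[]; exists x.
    by rewrite /FA; case: asboolP => // _; exact: F2.
  apply: le_trans (leeD (cov A _) (cov B _)) _ => //.
  rewrite -nneseriesD; last 2 first.
  - by move=> *; exact: diam_pow_ge0.
  - by move=> *; exact: diam_pow_ge0.
  apply: lee_nneseries => i _; first by move=> _; rewrite adde_ge0 ?diam_pow_ge0.
  rewrite /FA; case: asboolP => [[x [Fx Ax]]|_]; last first.
    by rewrite diam_pow_set0 add0e; case: asboolP => // _; rewrite diam_pow_set0 diam_pow_ge0.
  case: asboolP => [[y [Fy By]]|_]; last by rewrite diam_pow_set0 adde0.
  by have := le_lt_trans (le_trans (AB _ _ Ax By) (F2 i x y Fx Fy)) dlh; rewrite ltxx.
have [->|fin] := eqVneq (Hraw d (A `|` B)) +oo; first by rewrite leey.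
have fU : Hraw d (A `|` B) \is a fin_num by rewrite ge0_fin_numE ?Hraw_ge0// ltey.
have fA : Hraw d A \is a fin_num.
  rewrite ge0_fin_numE ?Hraw_ge0//; apply: le_lt_trans (Hraw_homo (@subsetUl _ A B)) _.
  by rewrite ltey.
rewrite addeC -leeBrDr//; apply: Hraw_le => d2 d20.
have fB : Hdelta d d2 B \is a fin_num.
  rewrite ge0_fin_numE ?Hdelta_ge0//; apply: le_lt_trans (Hdelta_le_Hraw _ d20) _.
  by apply: le_lt_trans (Hraw_homo (@subsetUr _ A B)) _; rewrite ltey.
by rewrite leeBrDr// addeC -leeBrDr//; apply: Hraw_le => d1 d10; rewrite leeBrDr// key.
Qed.

(** Caratheodory's criterion for metric outer measures. [A k] consists of the points of [X] whose
    ball of radius 1 / (k + 1) lies in [U]. Layers [D] that are not adjacent are at positive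
    distance, so the measures of all layers have a finite sum and the tail beyond [A k] is
    negligible. *)
Lemma Hraw_caratheodory_open (U : set 'rV[R]_n) : open U ->
  caratheodory_measurable (Hraw d : set 'rV[R]_n -> \bar R) U.
Proof.
move=> oU; apply: le_caratheodory_measurable => X.
change (Hraw d (X `&` U) + Hraw d (X `&` ~` U) <= Hraw d X).
have [Xoo|XNoo] := eqVneq (Hraw d X) +oo; first by rewrite Xoo leey.
have fX : Hraw d X < +oo by rewrite ltey.
pose r (k : nat) : R := (k.+1%:R^-1)%R.
have r0 k : (0 < r k)%R by rewrite invr_gt0.
have rS k : (r k.+1 < r k)%R by rewrite ltf_pV2 ?posrE// ltr_nat.
pose A k := X `&` [set x | eball x (r k) `<=` U].
have AX k : A k `<=` X `&` U by move=> x [Xx]; split=> //; apply: b; exact: eball_center.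
have AS k : A k `<=` A k.+1.
  by move=> x [Xx xU]; split=> // y xy; apply: xU; exact: lt_trans (rS k).
pose D k := A k.+1 `\` A k.
have sep k C : C `<=` X `\` A k.+1 -> Hraw d (A k) + Hraw d C <= Hraw d (A k `|` C).
  move=> CX; apply: (@Hraw_separated _ _ (r k - r k.+1)%R); first by rewrite subr_gt0.
  move=> x y [Xx xU] /CX[Xy nAy]; rewrite leNgt; apply/negP => xy; apply: nAy; split => // z yz.
  apply: xU; rewrite /eball/=; apply: le_lt_trans (euc_triangle y _ _) _.
  by rewrite /eball/= in yz; lra.
have T_le k : Hraw d (A k) <= Hraw d X by apply: Hraw_homo => x [].
have step k : Hraw d (A k) + Hraw d (D k.+1) <= Hraw d (A k.+2).
  apply: le_trans (sep _ _ _) _; first by move=> x [[]].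
  by apply: Hraw_homo => x [/AS/AS//|[]].
(* step telescopes over the parity classes of the layers D *)
have sumD k : \sum_(i < k.+1) Hraw d (D i) <= Hraw d (A k) + Hraw d (A k.+1).
  elim: k => [|k IH].
    rewrite big_ord1; apply: (@le_trans _ _ (Hraw d (A 1%N))); first by apply: Hraw_homo => x [].
    by rewrite leeDr// Hraw_ge0.
  rewrite big_ord_recr/=; apply: le_trans (leeD IH (lexx _)) _.
  by rewrite addeAC addeC leeD2l// step.
have finD : \sum_(0 <= i <oo) Hraw d (D i) < +oo.
  apply: (@le_lt_trans _ _ (Hraw d X + Hraw d X)); last by rewrite lte_add_pinfty.
  apply: lime_le; first by apply: is_cvg_nneseries => *; exact: Hraw_ge0.
  apply: nearW => -[|k]; first by rewrite big_geq// adde_ge0 ?Hraw_ge0.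
  by rewrite big_mkord; apply: le_trans (sumD k) _; rewrite leeD.
have tl := nneseries_tail_cvg finD (fun k _ => Hraw_ge0 (D k)).
have XUA k : X `&` U `<=` A k `|` \bigcup_(i in ~` `I_k) D i.
  move=> x [Xx Ux].
  have [m0 hm0] : exists m, `[< A m x >].
    have /open_edistP/(_ x Ux)[t t0 tU] := oU.
    exists (Num.truncn t^-1); apply/asboolP; split=> // y; rewrite /eball/= => xy.
    apply: tU; apply: lt_le_trans xy _; rewrite /r invf_ple ?posrE//.
    exact: ltW (truncnS_gt _).
  have [[|m] /= /asboolP Am mmin] := @find_ex_minn (fun m => `[< A m x >]) (ex_intro _ m0 hm0).
    by left; elim: (k) => // l IH; exact: AS.
  have [mk|km] := ltnP m k.
    by left; move/subnK: mk => <-; elim: (k - m.+1)%N => // l IH; rewrite addSn; exact: AS.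
  right; exists m; first by move=> /=; rewrite ltnNge km.
  by split=> // /asboolP/mmin; rewrite ltnn.
apply/lee_addgt0Pr => e e0.
have [k] : exists k, \sum_(k <= i <oo) Hraw d (D i) <= e%:E.
  have : nbhs (0 : \bar R) [set x | x < e%:E].
    by apply: open_nbhs_nbhs; split; [exact: open_ereal_lt_ereal|rewrite /= lte_fin].
  by move=> /tl[k _ hk]; exists k; apply: ltW; apply: hk => /=.
move=> hk.
have := Hraw_homo (XUA k) => /le_trans/(_ (HrawU _ _)) h1.
have h2 := le_trans h1 (leeD (lexx _) (outer_measure_sigma_subadditive_tail (Hraw d : {outer_measure set 'rV[R]_n -> \bar R}) k D)).
apply: (@le_trans _ _ (Hraw d (A k) + e%:E + Hraw d (X `&` ~` U))).
  by rewrite leeD2r// (le_trans h2)// leeD2l.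
rewrite addeAC leeD2r//; apply: le_trans (@Hraw_separated _ _ (r k) _ _) _ => //.
  move=> x y [Xx xU] [Xy Uy]; rewrite leNgt; apply/negP => xy; exact/Uy/xU.
by apply: Hraw_homo => x [[]|[]].
Qed.

End HausdorffOuter.

(** * Hausdorff measure on Borel sets and under Lipschitz maps *)

Section HausdorffMeasure.
Context {R : realType}.
Local Open Scope ereal_scope.

Definition haus (n d : nat) : set (BorelV R n) -> \bar R := fun E => Hraw d (E : set 'rV[R]_n).

Lemma borel_caratheodory n d (B : set (BorelV R n)) : measurable B ->
  caratheodory_measurable (Hraw d : set 'rV[R]_n -> \bar R) B.
Proof.
move=> mB.
have : <<s (@open 'rV[R]_n) >> `<=` ((Hraw d : set 'rV[R]_n -> \bar R).-cara.-measurable).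
  apply: smallest_sub; last by move=> U oU; exact: Hraw_caratheodory_open.
  exact: sigma_algebra_measurable.
exact.
Qed.

Lemma haus0 n d : haus d (set0 : set (BorelV R n)) = 0.
Proof. exact: Hraw_set0. Qed.

Lemma haus_ge0 n d (E : set (BorelV R n)) : 0 <= haus d E.
Proof. exact: Hraw_ge0. Qed.

Lemma haus_sigma_additive n d : semi_sigma_additive (@haus n d).
Proof.
move=> F mF tF mU.
apply: (@caratheodory_measure_sigma_additive R 'rV[R]_n (Hraw d : {outer_measure set 'rV[R]_n -> \bar R})) => //.
  by move=> i; apply: borel_caratheodory; exact: mF.
exact: borel_caratheodory.
Qed.

HB.instance Definition _ n d := isMeasure.Build _ (BorelV R n) R (@haus n d)
  (haus0 n d) (@haus_ge0 n d) (@haus_sigma_additive n d).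

Lemma open_borel n (U : set 'rV[R]_n) : open U -> measurable (U : set (BorelV R n)).
Proof. by move=> oU; apply: sub_sigma_algebra. Qed.

Lemma closed_borel n (C : set 'rV[R]_n) : closed C -> measurable (C : set (BorelV R n)).
Proof.
by move=> cC; rewrite -[C]setCK; apply: measurableC; apply: open_borel; exact: closed_openC.
Qed.

Lemma Hraw_lip (n m d : nat) (phi : 'rV[R]_n -> 'rV[R]_m) (E : set 'rV[R]_n) (L : R) :
  (0 < L)%R -> (forall x y, E x -> E y -> edist (phi x) (phi y) <= L * edist x y)%R ->
  Hraw d (phi @` E) <= (L ^+ d)%:E * Hraw d E.
Proof.
move=> L0 Lphi; have Ld : (0 < L ^+ d)%R by rewrite exprn_gt0.
apply: Hraw_le => delta d0.
have dL : (0 < delta / L)%R by rewrite divr_gt0.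
apply: (@le_trans _ _ ((L ^+ d)%:E * Hdelta d (delta / L)%R E)); last first.
  by rewrite lee_pmul2l// Hdelta_le_Hraw.
rewrite -lee_pdivrMl//; apply: le_Hdelta => F [F1 F2]; rewrite lee_pdivrMl//.
(* The Lipschitz bound is available on [E] only, so the sets of the cover are first cut down to
   [E]. *)
apply: le_trans (@Hdelta_le _ _ _ _ _ (fun i => phi @` (F i `&` E)) _) _.
  split=> [_ [x Ex <-]|i _ _ [x [Fx Ex] <-] [y [Fy Ey] <-]].
    by have [i _ Fx] := F1 _ Ex; exists i => //; exists x.
  apply: le_trans (Lphi _ _ Ex Ey) _; rewrite mulrC -ler_pdivlMr//; exact: F2 Fx Fy.
rewrite -nneseriesZl//; last by move=> *; exact: diam_pow_ge0.
apply: lee_nneseries => i _; first by move=> _; exact: diam_pow_ge0.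
apply: ge_ereal_sup => z [[_ [_ [[x [Fx Ex] <-] [y [Fy Ey] <-] ->]]]|->]; last first.
  by rewrite mule_ge0 ?diam_pow_ge0// lee_fin ltW.
apply: (@le_trans _ _ ((L ^+ d)%:E * (edist x y ^+ d)%:E)).
  by rewrite -EFinM lee_fin -exprMn lerXn2r ?nnegrE ?mulr_ge0 ?euc_ge0 ?(ltW L0)// Lphi.
rewrite lee_pmul2l//; apply: ereal_sup_ubound; left; by exists x, y.
Qed.

Lemma Hdelta_fin n d (I : finType) (F : I -> set 'rV[R]_n) (E : set 'rV[R]_n) (delta : R) :
  (0 <= delta)%R -> E `<=` [set x | exists i, F i x] ->
  (forall i x y, F i x -> F i y -> edist x y <= delta)%R ->
  Hdelta d delta E <= (#|I|%:R * delta ^+ d)%:E.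
Proof.
move=> d0 EF Fd.
pose G k := if insub k : option 'I_#|I| is Some j then F (enum_val j) else set0.
apply: (le_trans (@Hdelta_le _ _ _ _ _ G _)).
  split=> [x /EF[i Fx]|k x y]; last by rewrite /G; case: insub => // j; exact: Fd.
  by exists (enum_rank i) => //; rewrite /G valK enum_rankK.
rewrite (nneseries_split _ #|I|); last by move=> *; exact: diam_pow_ge0.
rewrite [X in _ + X]eseries0 ?adde0; last first.
  by move=> k Ik _; rewrite /G insubF ?diam_pow_set0//; apply/negbTE; rewrite -leqNgt.
rewrite add0n big_mkord; apply: (@le_trans _ _ (\sum_(k < #|I|) (delta ^+ d)%:E)).
  apply: lee_sum => k _; rewrite /G valK; apply: diam_pow_le_bound => // x y; exact: Fd.
by rewrite sumEFin sumr_const card_ord lee_fin mulr_natl.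
Qed.

Lemma compact_cube n (l : R) : compact [set x : 'rV[R]_n | forall i, (0 <= x ord0 i <= l)%R].
Proof.
have -> : [set x : 'rV[R]_n | forall i, (0 <= x ord0 i <= l)%R] =
          [set x : 'rV[R]_n | forall i, `[0%R, l]%classic (x ord0 i)].
  by apply/seteqP; split=> x h i; have := h i; rewrite /= in_itv.
by apply: (@rV_compact R n (fun=> `[0%R, l]%classic)) => _; exact: segment_compact.
Qed.

(** The m^d cells of diameter at most d / m contribute at most d^d in total, whatever m is. *)
Lemma Hraw_cube_lty d : Hraw d (@cube R d) < +oo.
Proof.
apply: (@le_lt_trans _ _ (d%:R ^+ d)%:E); last exact: ltry.
apply: Hraw_le => delta d0.
pose m := (Num.truncn (d%:R / delta)).+1.
have mR : (0 < m%:R :> R)%R by rewrite ltr0n.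
have dm : (d%:R / m%:R <= delta)%R.
  by rewrite ler_pdivrMr// mulrC -ler_pdivrMr// ltW// truncnS_gt.
apply: le_trans (Hdelta_mono _ dm (@subset_refl _ _)) _.
pose F (z : {ffun 'I_d -> 'I_m}) := [set x : 'rV[R]_d | cube (\row_i (m%:R * x ord0 i - (z i)%:R)%R)].
apply: (le_trans (@Hdelta_fin _ d _ F _ _ _ _ _)).
- by rewrite divr_ge0.
- by move=> x cx; have [z cz] := grid_cell (ltn0Sn _ : (0 < m)%N) cx; exists z.
- move=> z x y Fx Fy; rewrite eucE; apply: enorm_le_coord => i; rewrite !mxE.
  have := Fx i; have := Fy i; rewrite !mxE => /andP[y0 y1] /andP[x0 x1].
  rewrite -(ler_pM2l mR) divff ?gt_eqF// -{1}[m%:R%R]ger0_norm// -normrM mulrBr ler_norml; lra.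
rewrite card_ffun !card_ord lee_fin exprMn natrX mulrCA -exprMn divff ?gt_eqF//.
by rewrite expr1n mulr1.
Qed.

End HausdorffMeasure.

(** * Positive measure of the cube, null measure of its faces *)

Section CubeMeasure.
Context {R : realType}.

(** Once one grid point [z0] lies in [U], every other one is within T = floor(m * t) of it in each
    coordinate. *)
Lemma grid_count d (U : set 'rV[R]_d) (m : nat) (t : R) : (0 < m)%N -> 0 <= t ->
  (forall x y, U x -> U y -> edist x y <= t) ->
  (\sum_(z : {ffun 'I_d -> 'I_m}) `[< U (\row_i ((z i)%:R / m%:R)) >]%:R <=
    (2 * (m%:R * t) + 1) ^+ d :> R).
Proof.
move=> m0 t0 Ut; have mR : 0 < m%:R :> R by rewrite ltr0n.
pose g (z : {ffun 'I_d -> 'I_m}) : 'rV[R]_d := \row_i ((z i)%:R / m%:R).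
have mt0 : 0 <= m%:R * t by rewrite mulr_ge0// ltW.
have rhs0 : 0 <= 2 * (m%:R * t) + 1 by rewrite addr_ge0// mulr_ge0.
have [[z0 Uz0]|Un] := pselect (exists z, U (g z)); last first.
  by rewrite big1 ?exprn_ge0// => z _; case: asboolP => // Uz; case: Un; exists z.
pose T := Num.truncn (m%:R * t).
apply: (@le_trans _ _ (\sum_(z : {ffun 'I_d -> 'I_m})
   \prod_i (((z0 i <= z i + T) && (z i <= z0 i + T))%N%:R : R))).
  apply: ler_sum => z _; case: asboolP => Uz; last by apply: prodr_ge0 => i _.
  rewrite big1// => i _; suff -> : ((z0 i <= z i + T) && (z i <= z0 i + T))%N by [].
  have : `|(z i)%:R - (z0 i)%:R| <= m%:R * t :> R.
    apply: (@le_trans _ _ (m%:R * edist (g z) (g z0))); last by rewrite ler_pM2l// Ut.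
    rewrite eucE -ler_pdivrMl//; apply: le_trans (coord_le_enorm _ i).
    by rewrite !mxE -mulrBl normrM normfV (ger0_norm (ltW mR)) mulrC.
  have key (a b : nat) : a%:R - b%:R <= m%:R * t -> (a <= b + T)%N.
    move=> ab; have [//|ba] := leqP a b; first by lia.
    suff : (a - b <= T)%N by lia.
    rewrite /T -ltnS -(ltr_nat R) natrB ?(ltnW ba)//; apply: le_lt_trans ab _.
    exact: truncnS_gt.
  rewrite ler_norml lerNl opprB => /andP[h1 h2].
  by rewrite !key.
apply: le_trans (grid_sum (f := fun t k => ((k <= t + T) && (t <= k + T))%N%:R) (C := (2 * T).+1%:R) _ _ _) _.
- by move=> *; rewrite ler0n.
- by move=> k; exact: window_count.
rewrite lerXn2r ?nnegrE// -natr1 natrM lerD2r ler_pM2l//.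
by have /andP[] := truncn_itv mt0.
Qed.

Local Open Scope ereal_scope.

(** A near-optimal cover is thickened to an open one, and compactness leaves finitely many sets. The
    thickening of the i-th set has d-th power [e i], and these sum to at most [c]. The bounds [t i]
    are strictly positive, so that one may divide by them. *)
Lemma Hraw_finite_cover n d (K : set 'rV[R]_n) (c : R) : (0 < d)%N -> compact K ->
  (0 < c)%R -> Hraw d K < c%:E ->
  exists (s : seq nat) (U : nat -> set 'rV[R]_n) (t : nat -> R),
  [/\ forall i, (0 < t i)%R, forall i x y, U i x -> U i y -> (edist x y <= t i)%R,
     K `<=` [set x | exists2 i, i \in s & U i x] &
     (\sum_(i <- s) t i ^+ d <= 4 ^+ d * (c + c))%R].
Proof.
move=> d0 cK c0 Kc.
(* Scale 1 merely serves to make every [diam_pow] finite. *)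
have [F [F1 F2] Fc] := Hdelta_lt (le_lt_trans (Hdelta_le_Hraw d K ltr01) Kc).
pose D i := fine (diam_pow d (F i)).
have Dfin i : diam_pow d (F i) = (D i)%:E.
  rewrite /D fineK// ge0_fin_numE ?diam_pow_ge0//.
  by apply: le_lt_trans (diam_pow_le_bound _ ler01 (F2 i)) (ltry _).
have D0 i : (0 <= D i)%R by rewrite -lee_fin -Dfin diam_pow_ge0.
have dR : (d%:R != 0 :> R)%R by rewrite pnatr_eq0 -lt0n.
pose rt (a : R) : R := (a `^ (d%:R^-1))%R.
have rtK (a : R) : (0 <= a)%R -> (rt a ^+ d = a)%R.
  by move=> a0; rewrite /rt -powR_mulrn ?powR_ge0// powRVK.
pose e i : R := (c / (2 ^ i.+1)%:R)%R.
have e0 i : (0 < e i)%R by rewrite divr_gt0// ltr0n expn_gt0.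
(* It exceeds the diameter rt (D i) + 2 * rt (e i) of the thickened set, and 2 * (a + b) <= 4 *
   max(a, b) yields the factor 4^d. *)
pose t i := (2 * (rt (D i) + rt (e i)))%R.
have rte0 i : (0 < rt (e i))%R by rewrite powR_gt0.
have rtD0 i : (0 <= rt (D i))%R by rewrite powR_ge0.
have t0 i : (0 < t i)%R by rewrite mulr_gt0// ltr_wpDl.
have rhoF i x y : F i x -> F i y -> (edist x y <= rt (D i))%R.
  move=> Fx Fy; rewrite -(@ler_pXn2r _ d)// ?nnegrE ?euc_ge0 ?powR_ge0//.
  rewrite rtK// -lee_fin -Dfin; apply: ereal_sup_ubound; left; by exists x, y.
have tD i : (t i ^+ d <= 4 ^+ d * (D i + e i))%R.
  apply: (@le_trans _ _ ((4 * Num.max (rt (D i)) (rt (e i))) ^+ d)%R).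
    rewrite lerXn2r ?nnegrE ?(ltW (t0 i))// ?mulr_ge0 ?le_max ?rtD0//.
    have : (rt (D i) <= Num.max (rt (D i)) (rt (e i)))%R by rewrite le_max lexx.
    have : (rt (e i) <= Num.max (rt (D i)) (rt (e i)))%R by rewrite le_max lexx orbT.
    by rewrite /t; lra.
  rewrite exprMn ler_pM2l ?exprn_gt0//.
  have [_|_] := leP (rt (D i)) (rt (e i)); rewrite rtK ?(ltW (e0 i))//.
    by rewrite lerDr.
  by rewrite lerDl ltW.
pose U i := [set y | exists2 x, F i x & eball x (rt (e i)) y].
have oU i : open (U i).
  have -> : U i = \bigcup_(x in F i) eball x (rt (e i)) by [].
  by apply: bigcup_open => x _; exact: open_eball.
have Ut i x y : U i x -> U i y -> (edist x y <= t i)%R.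
  move=> [x' Fx' xx'] [y' Fy' yy']; rewrite /eball/= in xx' yy'.
  apply: le_trans (euc_triangle x' _ _) _; rewrite [edist x x']eucC.
  have := euc_triangle y' x' y; have := rhoF i _ _ Fx' Fy'.
  by have := rtD0 i; rewrite /t; lra.
have := cK; rewrite compact_cover => /(_ _ setT U (fun i _ => oU i)).
case.
  move=> x cx; have [i _ Fx] := F1 x cx; exists i => //; exists x => //.
  exact: eball_center.
move=> D' _ cov; set s := finmap.enum_fset D' in cov *.
exists s, U, t; split=> //.
have us : uniq s by exact: finmap.fset_uniq.
apply: (@le_trans _ _ (\sum_(i <- s) 4 ^+ d * (D i + e i))%R).
  by apply: ler_sum.
rewrite -mulr_sumr ler_pM2l ?exprn_gt0//.
have ge0 i : 0 <= (D i + e i)%:E by rewrite lee_fin addr_ge0// ltW.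
rewrite -lee_fin -sumEFin.
apply: (@le_trans _ _ (\sum_(0 <= i <oo) (D i + e i)%:E)).
  pose N := (\max_(i <- s) i.+1)%N.
  have sN : perm_eq s [seq i <- iota 0 N | i \in s].
    apply: uniq_perm => //; first by rewrite filter_uniq// iota_uniq.
    move=> i; rewrite mem_filter mem_iota add0n leq0n/=.
    by have [is_|//] := boolP (i \in s); apply/esym/(@leq_bigmax_seq _ s xpredT (fun i => i.+1) i).
  rewrite (perm_big _ sN)/= big_filter.
  apply: (@le_trans _ _ (\sum_(0 <= i < N) (D i + e i)%:E)); last first.
    by apply: nneseries_lim_ge => i _ _; exact: ge0.
  rewrite /index_iota subn0 big_mkcond; apply: lee_sum => i _; case: ifP => // _; exact: ge0.
rewrite (eq_eseriesr (g := fun i => diam_pow d (F i) + (c / (2 ^ i.+1)%:R)%:E)); last first.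
  by move=> i _; rewrite Dfin.
apply: le_trans (epsilon_trick _ _ (ltW c0)) _; first by move=> i; exact: diam_pow_ge0.
by rewrite EFinD leeD2r// ltW.
Qed.

(** Counting replaces a volume comparison: for a grid finer than every set of a finite cover, a set
    of diameter t holds at most (3 * m * t)^d of its points, whereas m^d of them lie in the cube. *)
Lemma Hraw_cube_gt0 d : (0 < d)%N -> 0 < Hraw d (@cube R d).
Proof.
(* What matters is 2 * 12^d * c < 1, where 12 = 3 * 4 combines the grid count with the factor of
   [Hraw_finite_cover]. *)
move=> d0; pose c : R := ((40 ^+ d)^-1)%R.
have c0 : (0 < c)%R by rewrite invr_gt0 exprn_gt0.
apply: (@lt_le_trans _ _ c%:E); first by rewrite lte_fin.
rewrite leNgt; apply/negP => /(Hraw_finite_cover d0 (@compact_cube R d 1%R) c0)[s [U [t [t0 Ut cov hs]]]].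
have [m m0 hm] : exists2 m, (0 < m)%N & forall i, i \in s -> (1 <= m%:R * t i)%R.
  elim: (s) => [|i l [m m0 IH]]; first by exists 1%N.
  exists (m + (Num.truncn (t i)^-1).+1)%N; first by rewrite addn_gt0 m0.
  move=> j; rewrite inE => /orP[/eqP ->|/IH h].
    rewrite -ler_pdivrMr// mul1r; apply: le_trans (ltW (truncnS_gt _)) _.
    by rewrite ler_nat leq_addl.
  by apply: le_trans h _; rewrite ler_pM2r// ler_nat leq_addr.
have mR : (0 < m%:R :> R)%R by rewrite ltr0n.
have cnt : ((m ^ d)%:R <= \sum_(i <- s) (2 * (m%:R * t i) + 1) ^+ d :> R)%R.
  apply: (@le_trans _ _ (\sum_(i <- s) \sum_(z : {ffun 'I_d -> 'I_m})
     `[< U i (\row_j ((z j)%:R / m%:R)%R) >]%:R)%R); last first.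
    rewrite big_seq [leRHS]big_seq; apply: ler_sum => i _.
    apply: grid_count => //; first exact: ltW.
    exact: Ut.
  rewrite exchange_big/=.
  apply: (@le_trans _ _ (\sum_(z : {ffun 'I_d -> 'I_m}) 1)%R).
    by rewrite sumr_const card_ffun !card_ord.
  apply: ler_sum => z _.
  have : cube (\row_j ((z j)%:R / m%:R)%R : 'rV[R]_d).
    by move=> j; rewrite mxE divr_ge0//= ler_pdivrMr// mul1r ler_nat ltnW.
  move=> /cov[i is_ Uz].
  rewrite (big_rem i)//= asboolT// lerDl; exact: sumr_ge0.
have : ((m ^ d)%:R <= \sum_(i <- s) (3 * m%:R) ^+ d * t i ^+ d :> R)%R.
  apply: le_trans cnt _; rewrite big_seq [leRHS]big_seq; apply: ler_sum => i /hm h.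
  rewrite -exprMn lerXn2r ?nnegrE//.
  - by rewrite addr_ge0// !mulr_ge0// ltW.
  - by rewrite !mulr_ge0// ltW.
  - lra.
apply/negP; rewrite -ltNge -mulr_sumr exprMn natrX mulrAC mulrC gtr_pMr ?exprn_gt0//.
apply: (@le_lt_trans _ _ (3 ^+ d * (4 ^+ d * (c + c)))%R).
  by rewrite ler_pM2l ?exprn_gt0.
have -> : (3 ^+ d * (4 ^+ d * (c + c)) = 2 * (12 / 40) ^+ d)%R.
  have -> : (12 = 3 * 4 :> R)%R by lra.
  by rewrite expr_div_n exprMn /c; ring.
case: (d) d0 => // d' _; rewrite exprS.
have : ((12 / 40 : R) ^+ d' <= 1)%R by rewrite exprn_ile1//; lra.
lra.
Qed.

Lemma Hraw_image_le n (E : set 'rV[R]_n) d (l : R) (v : 'rV[R]_n) : (0 < l)%R ->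
  Hraw d [set (v + l *: x)%R | x in E] = (l ^+ d)%:E * Hraw d E.
Proof.
move=> l0; apply/eqP; rewrite eq_le; apply/andP; split.
  apply: Hraw_lip => // x y _ _; rewrite !eucE opprD addrACA subrr add0r -scalerBr enormZ.
  by rewrite gtr0_norm.
rewrite -lee_pdivlMl ?exprn_gt0// -exprVn.
set E' := [set _ | _ in E].
have {1}-> : E = [set (l^-1 *: (x - v))%R | x in E'].
  apply/seteqP; split=> [x Ex|_ [_ [x Ex <-] <-]].
    exists (v + l *: x)%R; first by exists x.
    by rewrite addrAC subrr add0r scalerA mulVf ?scale1r// gt_eqF.
  by rewrite addrAC subrr add0r scalerA mulVf ?scale1r// gt_eqF.
apply: Hraw_lip; rewrite ?invr_gt0// => x y _ _.
rewrite !eucE -scalerBr enormZ gtr0_norm ?invr_gt0//.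
by rewrite opprB addrA subrK.
Qed.

Definition box n (l : R) : set 'rV[R]_n := [set x | forall i, (0 <= x ord0 i <= l)%R].
Definition obox n (l : R) : set 'rV[R]_n := [set x | forall i, (0 < x ord0 i < l)%R].
Arguments box : clear implicits.
Arguments obox : clear implicits.

Lemma obox_sub n l : obox n l `<=` box n l.
Proof. by move=> x h i; have /andP[x0 x1] := h i; rewrite !ltW. Qed.

Lemma open_obox n l : open (obox n l).
Proof.
rewrite openE => x h.
apply: (@filter_forall _ _ (fun i (y : 'rV[R]_n) => (0 < y ord0 i < l)%R) (nbhs x) _ _) => i.
have oi : open ((fun x : 'rV[R]_n => x ord0 i) @^-1` `]0%R, l[%classic).
  by apply: open_comp => // y _; exact: coord_continuous.
have : nbhs x ((fun x : 'rV[R]_n => x ord0 i) @^-1` `]0%R, l[%classic).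
  by apply: open_nbhs_nbhs; split=> //=; rewrite in_itv/=; exact: h.
by apply: filterS => y; rewrite /= in_itv.
Qed.

Lemma Hraw_box d (l : R) : (0 < l)%R ->
  Hraw d (box d l) = (l ^+ d)%:E * Hraw d (@cube R d).
Proof.
move=> l0; rewrite -(@Hraw_image_le _ _ _ _ 0)//; congr Hraw.
apply/seteqP; split=> [x bx|_ [x cx <-] i].
  exists (l^-1 *: x)%R; last by rewrite add0r scalerA divff ?scale1r// gt_eqF.
  move=> i; rewrite mxE mulrC; have /andP[x0 xl] := bx i.
  by rewrite divr_ge0 ?(ltW l0)//= ler_pdivrMr// mul1r.
rewrite add0r mxE; have /andP[x0 xl] := cx i.
by rewrite mulr_ge0 ?(ltW l0)//= ler_piMr// ltW.
Qed.

(* The open box contains homothetic copies of the box with ratio arbitrarily close to 1. *)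
Lemma Hraw_box_boundary d (l : R) : (0 < d)%N -> (0 < l)%R ->
  Hraw d (box d l `\` obox d l) = 0.
Proof.
move=> d0 l0.
have mbox : measurable (box d l : set (BorelV R d)).
  by apply: closed_borel; apply: compact_closed_rV; exact: compact_cube.
have mobox : measurable (obox d l : set (BorelV R d)) by apply: open_borel; exact: open_obox.
have H0 := Hraw_cube_gt0 d0.
have Hfin : Hraw d (@cube R d) \is a fin_num by rewrite ge0_fin_numE ?Hraw_ge0// Hraw_cube_lty.
pose h := fine (Hraw d (@cube R d)).
have hE : Hraw d (@cube R d) = h%:E by rewrite /h fineK.
have h0 : (0 < h)%R by rewrite -lte_fin -hE.
have ld0 : (0 < l ^+ d)%R by rewrite exprn_gt0.
have Xfin : Hraw d (box d l `\` obox d l) \is a fin_num.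
  rewrite ge0_fin_numE ?Hraw_ge0//.
  apply: (@le_lt_trans _ _ (Hraw d (box d l))); first by apply: Hraw_homo => x [].
  by rewrite Hraw_box// hE -EFinM ltry.
pose X := fine (Hraw d (box d l `\` obox d l)).
have XE : Hraw d (box d l `\` obox d l) = X%:E by rewrite /X fineK.
have X0 : (0 <= X)%R by rewrite -lee_fin -XE Hraw_ge0.
rewrite XE; congr EFin; apply/eqP; rewrite eq_le X0 andbT leNgt; apply/negP => Xp.
have key (u : R) : (0 < u < 1)%R -> (X + (1 - d%:R * u) * l ^+ d * h <= l ^+ d * h)%R.
  move=> /andP[u0 u1].
  have bern : (1 - d%:R * u <= (1 - u) ^+ d)%R.
    elim: (d) => [|k IH]; first by rewrite mul0r subr0 expr0.
    rewrite exprS; apply: (@le_trans _ _ ((1 - u) * (1 - k%:R * u))%R); last by rewrite ler_pM2l ?subr_gt0.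
    have : (0 <= k%:R * u * u :> R)%R by rewrite !mulr_ge0// ltW.
    rewrite -natr1; lra.
  pose v : 'rV[R]_d := const_mx (u * l / 2)%R.
  pose S := [set (v + ((1 - u) * l) *: x)%R | x in @cube R d].
  have ul0 : (0 < (1 - u) * l)%R by rewrite mulr_gt0// subr_gt0.
  have SO : S `<=` obox d l.
    move=> _ [x cx <-] i; rewrite !mxE; have /andP[x0 x1] := cx i.
    have p0 : (0 < u * l)%R by rewrite mulr_gt0.
    have p1 : (0 <= (1 - u) * l * x ord0 i)%R by rewrite mulr_ge0// ltW.
    have p2 : ((1 - u) * l * x ord0 i <= (1 - u) * l)%R by rewrite ler_piMr// ltW.
    by apply/andP; split; lra.
  have hs : Hraw d (box d l `\` obox d l) + Hraw d S <= Hraw d (box d l).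
    apply: (@le_trans _ _ (haus d (box d l `\` obox d l) + haus d (obox d l))).
      by rewrite leeD2l//; exact: Hraw_homo.
    rewrite -measureU//; last 2 first.
    - exact: measurableD.
    - by apply/seteqP; split=> x // [[_ nx] /nx].
    by apply: Hraw_homo => x [[]//|/obox_sub].
  move: hs; rewrite XE Hraw_image_le// Hraw_box// hE -!EFinM -EFinD lee_fin exprMn.
  apply: le_trans; rewrite lerD2l ler_pM2r// ler_pM2r//.
(* For this u, [key] bounds X by d * u * l^d * h, which is at most X / 2. *)
pose u := Num.min (1 / 2)%R (X / (2 * d%:R * (l ^+ d * h)))%R.
have dR : (0 < d%:R :> R)%R by rewrite ltr0n.
have D0 : (0 < 2 * d%:R * (l ^+ d * h))%R by rewrite !mulr_gt0.
have u01 : (0 < u < 1)%R.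
  by rewrite lt_min divr_gt0// ?divr_gt0//= gt_min; apply/orP; left; lra.
have := key u u01.
have : (u * (2 * d%:R * (l ^+ d * h)) <= X)%R.
  by rewrite -ler_pdivlMr// ge_min lexx orbT.
by nra.
Qed.

End CubeMeasure.
Arguments box {R} n l.
Arguments obox {R} n l.

(** * Almost isometric charts *)

Section Orthonormalize.
Context {R : realType}.

Lemma mulmx_tr_enorm n (x : 'rV[R]_n) : (x *m x^T) ord0 ord0 = enorm x ^+ 2.
Proof.
by rewrite enorm_sqr mxE; apply: eq_bigr => i _; rewrite mxE expr2.
Qed.

(** Gram-Schmidt carried out on coefficients: for the scalar product with matrix [P] = L L^T on the
    domain, a vector outside the row space of [S] is made orthogonal to it and normalized.
    Injectivity of [L] keeps its norm nonzero. *)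
Lemma orthonormal_rows d p (L : 'M[R]_(d, p)) :
  (forall v : 'rV[R]_d, v *m L = 0 -> v = 0) -> forall k, (k <= d)%N ->
  exists S : 'M[R]_(k, d), S *m L *m (S *m L)^T = 1%:M.
Proof.
move=> Linj; elim=> [|k IH] kd.
  by exists 0; apply/matrixP => -[].
have [S hS] := IH (ltnW kd).
have [v vS] : exists v : 'rV[R]_d, ~~ (v <= S)%MS.
  have : ~~ (1%:M <= S)%MS.
    apply/negP => /mxrankS; rewrite mxrank1 => h.
    by have := leq_trans (leq_trans h (rank_leq_row S)) (leqnn k); rewrite leqNgt kd.
  by move=> /row_subPn[i hi]; exists (row i 1%:M).
pose P := L *m L^T.
have PE (m1 m2 : nat) (X : 'M[R]_(m1, d)) (Y : 'M[R]_(m2, d)) :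
    X *m L *m (Y *m L)^T = X *m P *m Y^T.
  by rewrite trmx_mul /P !mulmxA.
pose w := v - v *m P *m S^T *m S.
have wS : w *m P *m S^T = 0.
  by rewrite /w !mulmxBl -(mulmxA _ S P) -(mulmxA _ (S *m P)) -(PE _ _ S S) hS mulmx1 subrr.
have w0 : w != 0.
  apply: contra vS; rewrite subr_eq0 => /eqP ->; exact: submxMl.
have n0 : 0 < enorm (w *m L).
  rewrite lt_def enorm_ge0 andbT enorm_eq0; apply: contra w0 => /eqP/Linj ->.
  by rewrite eqxx.
pose u := (enorm (w *m L))^-1 *: w.
have uS : u *m P *m S^T = 0 by rewrite /u -!scalemxAl wS scaler0.
have uu : u *m P *m u^T = 1%:M.
  rewrite -PE; apply/matrixP => i j; rewrite !ord1 mulmx_tr_enorm /u -scalemxAl enormZ.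
  rewrite ger0_norm ?invr_ge0 ?enorm_ge0// mulVf ?gt_eqF// expr1n mxE eqxx//.
have Su : S *m P *m u^T = 0.
  have PT : P^T = P by rewrite /P trmx_mul trmxK.
  by apply: trmx_inj; rewrite trmx0 2!trmx_mul trmxK PT mulmxA.
suff [S' hS'] : exists S' : 'M[R]_(k + 1, d), S' *m L *m (S' *m L)^T = 1%:M.
  by move: S' hS'; rewrite addn1 => S' hS'; exists S'.
exists (col_mx S u); rewrite PE mul_col_mx tr_col_mx mul_col_row -!PE hS !PE.
by rewrite uS Su uu -scalar_mx_block.
Qed.

(** Applied to the differential of a parametrization at a point, this change of variables makes it
    an isometry there. *)
Lemma orthonormalize d p (L : 'M[R]_(d, p)) :
  (forall v : 'rV[R]_d, v *m L = 0 -> v = 0) ->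
  exists2 S : 'M[R]_d, S \in unitmx & forall v : 'rV[R]_d, enorm (v *m S *m L) = enorm v.
Proof.
move=> /orthonormal_rows/(_ d (leqnn d))[S hS]; exists S.
  have : S *m (L *m (S *m L)^T) = 1%:M by rewrite mulmxA.
  by move=> /mulmx1_unit[].
move=> v; apply/eqP; rewrite -(@eqrXn2 _ 2)// ?enorm_ge0// -!mulmx_tr_enorm.
rewrite -(mulmxA v S L); move: (S *m L) hS => T hT.
by rewrite trmx_mul mulmxA -(mulmxA v) hT mulmx1.
Qed.

Lemma mulmx_lip d p (L : 'M[R]_(d, p)) :
  exists2 C : R, 0 < C & forall v : 'rV[R]_d, enorm (v *m L) <= C * enorm v.
Proof.
pose a := \sum_i \sum_j `|L i j|.
exists (p%:R * a + 1); first by rewrite ltr_wpDl// mulr_ge0//; apply: sumr_ge0 => i _; apply: sumr_ge0.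
move=> v; apply: (@le_trans _ _ (p%:R * (a * enorm v))); last first.
  by rewrite mulrA ler_wpM2r ?enorm_ge0// lerDl.
apply: enorm_le_coord => j; rewrite mxE mulr_suml.
apply: le_trans (ler_norm_sum _ _ _) _; apply: ler_sum => i _.
rewrite normrM mulrC ler_pM// ?coord_le_enorm//.
rewrite (bigD1 j)//= lerDl; exact: sumr_ge0.
Qed.

End Orthonormalize.

(** * Strict differentiability of C^1 maps *)

Section StrictDiff.
Context {R : realType}.
Variables (d p : nat).

Lemma is_derive_path (phi : 'rV[R]_d -> 'rV[R]_p) (v h : 'rV[R]_d) (t : R) j :
  differentiable phi (v + t *: h) ->
  is_derive t (1 : R) (fun t : R => phi (v + t *: h) ord0 j) ('d phi (v + t *: h) h ord0 j).
Proof.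
set z := v + t *: h => dphi.
pose G (t : R) : 'rV[R]_p := phi (v + t *: h).
(* The difference quotient of the path at [t] is that of [phi] at [z] in the direction [h]. *)
have E : (fun u : R => u^-1 *: ((G \o shift t) (u *: (1 : R)) - G t)) =
    (fun u : R => u^-1 *: ((phi \o shift z) (u *: h) - phi z)).
  apply/funext => u; congr (_ *: (phi _ - _)).
  by rewrite /= /shift /z scalerDl addrCA [u *: (1 : R)]mulr1.
have dG : derivable G t 1 by rewrite /derivable E; exact: diff_derivable.
have DG : 'D_1 G t = 'd phi z h.
  rewrite -(deriveE h dphi).
  exact: (congr1 (fun f : R -> 'rV[R]_p => lim (f @ 0^')) E).
apply: DeriveDef; first exact: ((derivable_mxP G t 1).1 dG ord0 j).
by rewrite -DG derive_mx// mxE.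
Qed.

Lemma diff_sum (phi : 'rV[R]_d -> 'rV[R]_p) (z h : 'rV[R]_d) j :
  differentiable phi z ->
  'd phi z h ord0 j = \sum_i h ord0 i * ('D_(delta_mx ord0 i) phi z) ord0 j.
Proof.
move=> dphi; rewrite {1}(row_sum_delta h) linear_sum summxE; apply: eq_bigr => i _.
by rewrite linearZ mxE deriveE.
Qed.

Lemma rowB3 n (a b c : 'rV[R]_n) j :
  (a - b - c) ord0 j = a ord0 j - b ord0 j - c ord0 j.
Proof. by rewrite !mxE. Qed.

(** The mean value theorem is applied to each coordinate along the segment from [v] to [u], on which
    all partial derivatives are within [e'] of their values at [w]. *)
Lemma strict_diff (W : set 'rV[R]_d) (phi : 'rV[R]_d -> 'rV[R]_p) (w : 'rV[R]_d) (e : R) :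
  open W -> C1_on W phi -> W w -> 0 < e ->
  exists2 r : R, 0 < r & eball w r `<=` W /\
    forall u v, eball w r u -> eball w r v ->
      enorm (phi u - phi v - 'd phi w (u - v)) <= e * enorm (u - v).
Proof.
move=> oW C1 Ww e0.
(* The denominator absorbs the factor p of the passage from coordinates to the norm and the d
   partial derivatives. *)
pose e' := e / (p.+1%:R * d.+1%:R).
have e'0 : 0 < e' by rewrite divr_gt0// mulr_gt0.
have near_D : \forall z \near w, forall i : 'I_d,
    `|'D_(delta_mx ord0 i) phi w - 'D_(delta_mx ord0 i) phi z| <= e'.
  apply: (@filter_forall _ _ (fun i (z : 'rV[R]_d) =>
     `|'D_(delta_mx ord0 i) phi w - 'D_(delta_mx ord0 i) phi z| <= e') (nbhs w) _ _) => i.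
  have cD := (C1 w Ww).2 i.
  have {}cD : 'D_(delta_mx ord0 i) phi z @[z --> w] --> 'D_(delta_mx ord0 i) phi w := cD.
  exact: ((cvgrPdist_le _ _).1 cD e' e'0).
have near_W : \forall z \near w, W z by move: oW; rewrite openE => /(_ w Ww).
have [r r0 hr] : exists2 r : R, 0 < r & eball w r `<=` [set z | W z /\ forall i : 'I_d,
    `|'D_(delta_mx ord0 i) phi w - 'D_(delta_mx ord0 i) phi z| <= e'].
  by apply/nbhs_edistP; apply: filterI.
exists r => //; split=> [z /hr[]//|u v ur vr].
set h := u - v.
have conv t : 0 <= t <= 1 -> eball w r (v + t *: h).
  move=> /andP[t0 t1]; rewrite /eball/= eucE.
  have -> : w - (v + t *: h) = t *: (w - u) + (1 - t) *: (w - v).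
    by apply/rowP => i; rewrite !mxE; ring.
  apply: le_lt_trans (enormD _ _) _; rewrite !enormZ !ger0_norm ?subr_ge0//.
  move: ur vr; rewrite /eball/= !eucE => ur vr.
  have [->|tn0] := eqVneq t 0; first by rewrite mul0r add0r subr0 mul1r.
  have tp : 0 < t by rewrite lt_def tn0.
  have : t * enorm (w - u) < t * r by rewrite ltr_pM2l.
  have : (1 - t) * enorm (w - v) <= (1 - t) * r by rewrite ler_wpM2l ?subr_ge0// ltW.
  lra.
have [hW hD] : (forall t : R, 0 <= t <= 1 -> W (v + t *: h)) /\
   (forall t : R, 0 <= t <= 1 -> forall i, `|'D_(delta_mx ord0 i) phi w - 'D_(delta_mx ord0 i) phi (v + t *: h)| <= e').
  by split=> t /conv/hr[].
apply: (@le_trans _ _ (p%:R * (d%:R * e' * enorm h))); last first.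
  rewrite mulrA ler_wpM2r ?enorm_ge0// /e' mulrA mulrCA ler_piMr ?(ltW e0)//.
  rewrite ler_pdivrMr ?mulr_gt0// mul1r ler_pM// ler_nat//.
apply: enorm_le_coord => j.
pose k : R := 'd phi w h ord0 j.
pose g (t : R) := phi (v + t *: h) ord0 j - t * k.
pose dg (t : R) := ('d phi (v + t *: h) h) ord0 j - k.
have dgP (t : R) : 0 <= t <= 1 -> is_derive t (1 : R) g (dg t).
  move=> t01; have dp := @is_derive_path phi v h t j (C1 _ (hW t t01)).1.
  have gE : g = (fun t : R => phi (v + t *: h) ord0 j) - k \*: (@id R).
    by apply/funext => x; rewrite /g mulrC.
  have dk := is_deriveZ k (is_derive_id t (1 : R)).
  rewrite gE; have := is_deriveB dp dk; rewrite [k *: 1]mulr1; exact.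
have [c c01] : exists2 c, c \in `]0, 1[ & g 1 - g 0 = dg c * (1 - 0).
  apply: MVT => // [t|].
    by rewrite in_itv/= => /andP[t0 t1]; apply: dgP; rewrite !ltW.
  apply: derivable_within_continuous => t; rewrite in_itv/= => t01.
  by have := dgP t t01 => -[].
have {}c01 : 0 <= c <= 1 by move: c01; rewrite in_itv/= => /andP[? ?]; rewrite !ltW.
have vh : v + h = u by rewrite /h addrC subrK.
rewrite /g scale1r scale0r addr0 mul0r mul1r !subr0 mulr1 /dg vh => E.
have kE : k = _ := @diff_sum phi w h j (C1 _ Ww).1.
have cE := @diff_sum phi (v + c *: h) h j (C1 _ (hW c c01)).1.
have {}E : phi u ord0 j - phi v ord0 j - k = 'd phi (v + c *: h) h ord0 j - k.
  by rewrite addrAC; exact: E.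
have E4 : (phi u - phi v - 'd phi w h) ord0 j = phi u ord0 j - phi v ord0 j - k.
  exact: (rowB3 (phi u) (phi v) ('d phi w h) j).
rewrite E4 E cE kE.
rewrite -sumrB; apply: le_trans (ler_norm_sum _ _ _) _.
apply: (@le_trans _ _ (\sum_(i < d) (e' * enorm h))); last first.
  by rewrite sumr_const card_ord -mulrA mulr_natl.
apply: ler_sum => i _; rewrite -mulrBr normrM mulrC ler_pM// ?coord_le_enorm//.
apply: le_trans (hD c c01 i).
set A := 'D_ _ _ _; set B := 'D_ _ _ _.
by rewrite distrC; have := coord_le_norm (B - A) j; rewrite !mxE.
Qed.

End StrictDiff.

(** * Bi-Lipschitz charts with constant close to 1 *)

Section Charts.
Context {R : realType}.

Definition bilip n m (L : R) (E : set 'rV[R]_n) (phi : 'rV[R]_n -> 'rV[R]_m) :=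
  forall u v, E u -> E v -> edist (phi u) (phi v) <= L * edist u v /\
                            edist u v <= L * edist (phi u) (phi v).

(** The last clause is what is retained of the homeomorphism property: open subsets of the open box
    have relatively open images in [M]. *)
Definition good_chart d p (M : set 'rV[R]_p) (L : R) (phi : 'rV[R]_d -> 'rV[R]_p) (c : R) :=
  [/\ 0 < c, bilip L (box d c) phi, (forall u, box d c u -> M (phi u)) &
      forall O, open O -> O `<=` obox d c -> exists2 U, open U & phi @` O = M `&` U].

Lemma within_open_preimage n m (E : set 'rV[R]_n) (psi : 'rV[R]_n -> 'rV[R]_m) O :
  {within E, continuous psi} -> open O ->
  exists2 V, open V & forall x, E x -> (V x <-> O (psi x)).
Proof.
move=> cpsi oO; have := (continuousP _).1 cpsi O oO => /(open_subspaceP E _).1[V oV VE].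
exists V => // x Ex; have := VE; rewrite predeqE => /(_ x)[h1 h2]; split=> h.
  by have [] := h1 (conj h Ex).
by have [] := h2 (conj h Ex).
Qed.

(** The parametrization is precomposed with an affine map [T] whose linear part makes the
    differential at [w0] isometric; by strict differentiability a small box is then distorted by
    factors between 1 - dl and 1 + dl. *)
Lemma exists_good_chart d p (M : set 'rV[R]_p) (L : R) x :
  C1_submanifold d M -> M x -> 1 < L ->
  exists (phi : 'rV[R]_d -> 'rV[R]_p) c,
    good_chart M L phi c /\ exists2 u, obox d c u & phi u = x.
Proof.
move=> C1M Mx L1; have [U [W [phi [psi [[oU Ux oW C1] [injd phiW psiphi cpsi]]]]]] := C1M x Mx.
have [w0 Ww0 phiw0] : (phi @` W) x by rewrite phiW.
have fE (v : 'rV[R]_d) : 'd phi w0 v = v *m lin1_mx ('d phi w0) by rewrite mul_rV_lin1.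
have [S uS hS] : exists2 S : 'M[R]_d, S \in unitmx &
    forall v : 'rV[R]_d, enorm (v *m S *m lin1_mx ('d phi w0)) = enorm v.
  apply: orthonormalize => v; rewrite -fE => fv.
  by apply: (injd _ Ww0); rewrite fv linear0.
have [C C0 hC] := mulmx_lip S.
have L0 : 0 < L by apply: lt_trans L1.
(* Then 1 - dl = 1 / L exactly, and 1 + dl <= L because L + 1 / L >= 2. *)
pose dl := 1 - L^-1.
have dl0 : 0 < dl by rewrite subr_gt0 invf_lt1.
have dl1 : 1 + dl <= L.
  rewrite /dl -(ler_pM2r L0) mulrDl mulrBl mul1r mulVf ?gt_eqF//.
  have : 0 <= (L - 1) ^+ 2 by exact: sqr_ge0.
  nra.
(* The error is relative to T u - T v, whose norm is at most [C] times that of u - v; hence the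
   division by [C]. *)
have [r r0 [rW hr]] := strict_diff oW C1 Ww0 (divr_gt0 dl0 C0).
pose c := r / (2 * C * d.+1%:R).
have c0 : 0 < c by rewrite divr_gt0// !mulr_gt0.
pose ctr : 'rV[R]_d := const_mx (c / 2).
pose T (u : 'rV[R]_d) := w0 + (u - ctr) *m S.
pose Ti (w : 'rV[R]_d) := (w - w0) *m invmx S + ctr.
have TiK u : Ti (T u) = u by rewrite /Ti /T [w0 + _]addrC addrK mulmxK// subrK.
have TK w : T (Ti w) = w by rewrite /Ti /T addrK mulmxKV// addrC subrK.
have Tsub u v : T u - T v = (u - v) *m S.
  by rewrite /T opprD addrACA subrr add0r -mulmxBl opprB addrA subrK.
have Tr u : box d c u -> eball w0 r (T u).
  move=> bu; rewrite /eball/= eucE /T opprD addrA subrr add0r enormN.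
  apply: le_lt_trans (hC _) _.
  have : enorm (u - ctr) <= d%:R * c.
    apply: enorm_le_coord => i; rewrite !mxE; have := bu i => /andP[u0 u1].
    by rewrite ler_norml; apply/andP; split; lra.
  move=> /(ler_wpM2l (ltW C0))/le_lt_trans; apply.
  have cr : C * (d.+1%:R * c) * 2 = r.
    have : c * (2 * C * d.+1%:R) = r by rewrite /c divfK// gt_eqF// !mulr_gt0.
    by move=> <-; ring.
  have : C * (d%:R * c) <= C * (d.+1%:R * c).
    by rewrite ler_pM2l// ler_pM2r// ler_nat.
  lra.
exists (phi \o T), c; split; last first.
  exists ctr; first by move=> i; rewrite mxE; apply/andP; split; lra.
  by rewrite /= /T subrr mul0mx addr0.
split=> //.
- move=> u v bu bv; rewrite /= !eucE.
  have h1 := hr _ _ (Tr u bu) (Tr v bv).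
  have h2 : enorm ('d phi w0 (T u - T v)) = enorm (u - v) by rewrite Tsub fE hS.
  have h3 : dl / C * enorm (T u - T v) <= dl * enorm (u - v).
    by rewrite -mulrA ler_pM2l// mulrC ler_pdivrMr// mulrC Tsub hC.
  set X := phi (T u) - phi (T v) in h1 *; set Y := 'd phi w0 (T u - T v) in h1 h2.
  have h4 : enorm X <= enorm (X - Y) + enorm Y.
    by have := enormD (X - Y) Y; rewrite subrK.
  have h5 : enorm Y <= enorm (X - Y) + enorm X.
    have := enormD (Y - X) X; rewrite subrK.
    by rewrite -(enormN (Y - X)) opprB.
  rewrite -h2 in h3 *.
  have Y0 := enorm_ge0 Y.
  split; first by have := ler_wpM2r Y0 dl1; lra.
  have : (1 - dl) * enorm Y <= enorm X by lra.
  by rewrite /dl opprB addrCA subrr addr0 mulrC ler_pdivrMr// mulrC.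
- move=> u /Tr/rW WT; have : (phi @` W) (phi (T u)) by exists (T u).
  by rewrite phiW => -[].
move=> O oO Oc.
(* The image of [O] is the part of M and U that [psi] sends into [O'], and [psi] is continuous
   there. *)
pose O' := [set w | O (Ti w)].
have oO' : open O'.
  apply/open_edistP => w Ow; have /open_edistP/(_ _ Ow)[t t0 tO] := oO.
  have [C' C'0 hC'] := mulmx_lip (invmx S).
  exists (t / C'); first by rewrite divr_gt0.
  move=> w'; rewrite /eball/= eucE => ww'; apply: tO; rewrite /eball/= eucE /Ti.
  rewrite opprD addrACA subrr addr0 -mulmxBl opprB addrA subrK.
  by apply: le_lt_trans (hC' _) _; rewrite mulrC -ltr_pdivlMr.
have [V oV hV] := within_open_preimage cpsi oO'.
exists (U `&` V); first exact: openI.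
have O'W w : O' w -> W w by move=> /Oc/obox_sub/Tr; rewrite TK; exact: rW.
apply/seteqP; split=> [_ [u Ou <-]|y [My [Uy Vy]]] /=.
  have O'T : O' (T u) by rewrite /O'/= TiK.
  have WT := O'W _ O'T.
  have [Mu Uu] : (M `&` U) (phi (T u)) by rewrite -phiW; exists (T u).
  by split=> //; split=> //; apply/hV => //; rewrite psiphi.
have [w Ww wy] : (phi @` W) y by rewrite phiW.
have : O' (psi y) by apply/hV.
rewrite -wy psiphi// => O'w; exists (Ti w) => //=.
by rewrite TK.
Qed.

End Charts.

(** * Decomposition into almost isometric cubes *)

Section FillChart.
Context {R : realType}.
Variables (d p : nat).
Hypothesis d0 : (0 < d)%N.
Implicit Types (phi : 'rV[R]_d -> 'rV[R]_p) (L c : R) (M A V : set 'rV[R]_p).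

Lemma lip_compact n m (phi : 'rV[R]_n -> 'rV[R]_m) (L : R) E : 0 < L ->
  (forall u v, E u -> E v -> edist (phi u) (phi v) <= L * edist u v) ->
  compact E -> compact (phi @` E).
Proof.
move=> L0 lip cE; apply: continuous_compact => //.
apply/subspace_continuousP => x Ex U /nbhs_edistP[r r0 rU].
rewrite /nbhs/= /within/=; apply/nbhs_edistP; exists (r / L); first by rewrite divr_gt0.
move=> y xy Ey; apply: rU; rewrite /eball/=; apply: le_lt_trans (lip _ _ Ex Ey) _.
by rewrite mulrC -ltr_pdivlMr.
Qed.

Lemma Hraw_fin_null n (I : finType) (F : I -> set 'rV[R]_n) :
  (forall i, Hraw d (F i) = 0%E) -> Hraw d [set x | exists i, F i x] = 0%E.
Proof.
move=> F0; apply/eqP; rewrite eq_le Hraw_ge0 andbT.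
pose G k := if insub k : option 'I_#|I| is Some j then F (enum_val j) else set0.
apply: (@le_trans _ _ (Hraw d (\bigcup_k G k))).
  apply: Hraw_homo => x [i Fx]; exists (enum_rank i) => //.
  by rewrite /G valK enum_rankK.
apply: le_trans (@Hraw_sigma_subadditive _ n d G) _.
by rewrite eseries0// => k _ _; rewrite /G; case: insub => [j|]; rewrite ?F0 ?Hraw_set0.
Qed.

Lemma Hraw_bilip_boundary phi L l : 0 < L -> 0 < l -> bilip L (box d l) phi ->
  Hraw d (phi @` (box d l `\` obox d l)) = 0%E.
Proof.
move=> L0 l0 bi; apply/eqP; rewrite eq_le Hraw_ge0 andbT.
apply: le_trans (@Hraw_lip _ _ _ d phi _ L L0 _) _.
  by move=> x y [bx _] [bt _]; exact: (bi x y bx bt).1.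
by rewrite Hraw_box_boundary// mule0.
Qed.

Lemma good_chart_inj M L phi c : good_chart M L phi c ->
  forall u v, box d c u -> box d c v -> phi u = phi v -> u = v.
Proof.
move=> [c0 bi _ _] u v bu bv uv; apply/eqP; rewrite -euc_eq0 eq_le euc_ge0 andbT.
by have := (bi u v bu bv).2; rewrite uv eucxx mulr0.
Qed.

Lemma Hraw_bilip_box_lty phi L l : 0 < L -> 0 < l -> bilip L (box d l) phi ->
  (Hraw d (phi @` box d l) < +oo)%E.
Proof.
move=> L0 l0 bi; apply: le_lt_trans (@Hraw_lip _ _ _ d phi _ L L0 _) _.
  by move=> x y bx bt; exact: (bi x y bx bt).1.
rewrite Hraw_box// muleA -EFinM lte_mul_pinfty ?Hraw_cube_lty//.
by rewrite lee_fin mulr_ge0// exprn_ge0// ltW.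
Qed.

(* Cells of the grid that are not mapped into V lie in this layer. *)
Lemma boundary_layer_small V (K : set 'rV[R]_p) (eps C : R) : 0 <= C -> open V -> compact K ->
  (Hraw d K < +oo)%E -> 0 < eps -> exists2 m : nat, (0 < m)%N &
  (Hraw d (K `&` V `&` [set x | exists2 y, ~ V y & (edist x y < C / m%:R)%R]) <= eps%:E)%E.
Proof.
move=> C0 oV cK Kfin eps0.
pose D (k : nat) : set 'rV[R]_p := [set x | exists2 y, ~ V y & edist x y < C / k.+1%:R].
have oD k : open (D k).
  have -> : D k = \bigcup_(y in ~` V) eball y (C / k.+1%:R).
    apply/seteqP; split=> x [y Vy xy]; exists y => //; by rewrite /eball/= eucC.
  by apply: bigcup_open => y _; exact: open_eball.
pose E k : set (BorelV R p) := K `&` V `&` D k.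
have mE k : measurable (E k).
  apply: measurableI; last by apply: open_borel; exact: oD.
  apply: measurableI; last exact: open_borel.
  by apply: closed_borel; exact: compact_closed_rV.
have E0 : \bigcap_k E k = set0.
  apply/seteqP; split=> // x Ex; have [[Kx Vx] _] := Ex 0%N I.
  have /open_edistP/(_ _ Vx)[r r0 rV] := oV.
  have [_ [y Vy xy]] := Ex (Num.truncn (C / r)) I.
  apply: Vy; apply: rV; rewrite /eball/=; apply: lt_le_trans xy _.
  by rewrite ler_pdivrMr// mulrC -ler_pdivrMr// ltW// truncnS_gt.
have Emono : nonincreasing_seq E.
  apply/nonincreasing_seqP => k; apply/subsetPset => x [KVx [y Vy xy]]; split=> //.
  exists y => //; apply: lt_le_trans xy _.
  by rewrite ler_wpM2l// lef_pV2 ?posrE// ler_nat.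
have cv : haus d (E k) @[k --> \oo] --> haus d (\bigcap_k E k).
  apply: nonincreasing_cvg_mu => //; last by rewrite E0.
  by apply: le_lt_trans Kfin; apply: Hraw_homo => x [[]].
rewrite E0 haus0 in cv.
have : nbhs (0 : \bar R)%E [set x | (x < eps%:E)%E].
  by apply: open_nbhs_nbhs; split; [exact: open_ereal_lt_ereal|rewrite /= lte_fin].
move=> /cv[k _ hk]; exists k.+1 => //; apply: ltW; exact: (hk k (leqnn k)).
Qed.

(** The closed box is mapped into [V], but a relatively open image is required of the open box only:
    neighbouring pieces can be disjoint although their closed boxes share faces. *)
Definition piece M (V : set 'rV[R]_p) L eta phi l :=
  [/\ 0 < l <= eta, bilip L (box d l) phi,
      (forall u, box d l u -> V (phi u)) &
      exists2 U, open U & phi @` obox d l = M `&` U].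

(** The pieces are the grid cells mapped into [V]. What they miss lies either on images of faces,
    which are null, or in cells whose image leaves [V], hence in a thin layer along the complement
    of [V]. *)
Lemma fill_chart M V L phi c (eps eta : R) : 1 < L -> good_chart M L phi c -> open V ->
  0 < eps -> 0 < eta ->
  exists (I : finType) (phis : I -> 'rV[R]_d -> 'rV[R]_p) (l : I -> R),
  [/\ forall i, piece M (M `&` V) L eta (phis i) (l i),
      forall i, phis i @` obox d (l i) `<=` phi @` obox d c,
      forall i j, i != j -> phis i @` obox d (l i) `&` phis j @` obox d (l j) = set0 &
      (Hraw d ((phi @` box d c `&` V) `\` [set x | exists i, (phis i @` obox d (l i)) x]) <= eps%:E)%E].
Proof.
move=> L1 gc oV eps0 eta0; have [c0 bi bM bO] := gc.
have L0 : 0 < L by apply: lt_trans L1.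
have cK : compact (phi @` box d c).
  apply: (lip_compact L0); last exact: compact_cube.
  by move=> u v bu bv; exact: (bi u v bu bv).1.
have Kfin := Hraw_bilip_box_lty L0 c0 bi.
(* The image of a cell of side c / m has diameter at most L * d * c / m; the summand 1 makes the
   comparison with C / m strict. *)
pose C := L * (d%:R * c) + 1.
have C0 : 0 < C by rewrite ltr_wpDl// !mulr_ge0// ltW.
have [m1 m10 hm1] := boundary_layer_small (ltW C0) oV cK Kfin eps0.
pose m2 := (Num.truncn (c / eta)).+1.
(* [m1] makes the layer small, [m2] makes the side at most [eta]. *)
pose m := (m1 + m2)%N.
have m0 : (0 < m)%N by rewrite addn_gt0 m10.
have mR : 0 < m%:R :> R by rewrite ltr0n.
pose l := c / m%:R.
have l0 : 0 < l by rewrite divr_gt0.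
have leta : l <= eta.
  rewrite ler_pdivrMr// mulrC -ler_pdivrMr//; apply: le_trans (ltW (truncnS_gt _)) _.
  by rewrite ler_nat leq_addl.
have hm : (Hraw d (phi @` box d c `&` V `&`
   [set x | exists2 y, ~ V y & (edist x y < C / m%:R)%R]) <= eps%:E)%E.
  apply: le_trans hm1; apply: Hraw_homo => x [KV [y Vy xy]]; split=> //; exists y => //.
  apply: lt_le_trans xy _; rewrite ler_wpM2l ?(ltW C0)//.
  by rewrite lef_pV2 ?posrE ?ltr0n// ler_nat leq_addr.
pose sh (z : {ffun 'I_d -> 'I_m}) (u : 'rV[R]_d) : 'rV[R]_d := \row_i (l * (z i)%:R + u ord0 i).
have lm : l * m%:R = c by rewrite /l divfK// gt_eqF.
have shbox z u : box d l u -> box d c (sh z u).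
  move=> bu i; rewrite mxE; have /andP[u0 u1] := bu i; apply/andP; split.
    by rewrite addr_ge0// mulr_ge0// ltW.
  have : l * (z i)%:R + l <= c.
    by have := ltn_ord (z i); rewrite -(ler_nat R) -natr1 -(ler_pM2l l0) lm; lra.
  lra.
have shobox z u : obox d l u -> obox d c (sh z u).
  move=> bu i; rewrite mxE; have /andP[u0 u1] := bu i; apply/andP; split.
    by rewrite ltr_wpDl// mulr_ge0// ltW.
  have : l * (z i)%:R + l <= c.
    by have := ltn_ord (z i); rewrite -(ler_nat R) -natr1 -(ler_pM2l l0) lm; lra.
  lra.
have she z u v : edist (sh z u) (sh z v) = edist u v.
  by rewrite !eucE; congr enorm; apply/rowP => i; rewrite !mxE; ring.
pose P z := `[< forall u, box d l u -> V (phi (sh z u)) >].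
pose I : finType := {z : {ffun 'I_d -> 'I_m} | P z}.
exists I, (fun i => phi \o sh (val i)), (fun=> l).
have shO z : open [set sh z u | u in obox d l].
  have -> : [set sh z u | u in obox d l] =
      [set x | obox d l (\row_i (x ord0 i - l * (z i)%:R))].
    apply/seteqP; split=> [_ [u ou <-] i|x ox]; first by rewrite !mxE addrC addKr; exact: ou.
    exists (\row_i (x ord0 i - l * (z i)%:R)) => //.
    by apply/rowP => i; rewrite !mxE addrC subrK.
  have := @open_obox R d l => /open_edistP oo; apply/open_edistP => x /oo[r r0 hr].
  exists r => // y xy; apply: hr; move: xy; rewrite /eball/= !eucE.
  apply: le_lt_trans; rewrite le_eqVlt; apply/orP; left; apply/eqP; congr enorm.
  by apply/rowP => i; rewrite !mxE; ring.
have subc z : [set sh z u | u in obox d l] `<=` obox d c by move=> _ [u ou <-]; exact: shobox.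
have im z : (phi \o sh z) @` obox d l = phi @` [set sh z u | u in obox d l].
  by rewrite image_comp.
split.
- move=> [z /= /asboolP Pz]; split=> //=; first by rewrite l0 leta.
  + by move=> u v bu bv /=; rewrite -(she z); apply: bi; exact: shbox.
  + by move=> u bu; split; [apply: bM; exact: shbox|exact: Pz].
  + by have [U oU UE] := bO _ (shO z) (subc z); exists U => //; rewrite im.
- by move=> i; rewrite im; exact: image_subset.
- move=> [z Pz] [z' Pz'] zz'; rewrite /= !im; apply/seteqP; split=> // x.
  move=> [[_ [u ou <-] <-] [_ [v ov <-]] /esym e].
  have {}e : sh z u = sh z' v.
    by apply: (good_chart_inj gc) => //; apply: shbox; exact: obox_sub.
  case/eqP: zz'; apply: val_inj => /=; apply/ffunP => i; apply/val_inj => /=.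
  have := congr1 (fun x : 'rV[R]_d => x ord0 i) e; rewrite !mxE.
  have /andP[u0 u1] := ou i; have /andP[v0 v1] := ov i => ez.
  have key (a b : nat) (s t : R) : 0 < s < l -> 0 < t < l ->
      l * a%:R + s = l * b%:R + t -> (a <= b)%N.
    move=> /andP[s0 s1] /andP[t0 t1] e'; rewrite leqNgt; apply/negP => ba.
    have : l * (b%:R + 1) <= l * a%:R by rewrite ler_pM2l// natr1 ler_nat.
    lra.
  apply/eqP; rewrite eqn_leq (key _ _ _ _ (ou i) (ov i) ez).
  by rewrite (key _ _ _ _ (ov i) (ou i) (esym ez)).
apply: (@le_trans _ _ (Hraw d ([set x | exists z, ((phi \o sh z) @` (box d l `\` obox d l)) x] `|`
   (phi @` box d c `&` V `&` [set x | exists2 y, ~ V y & (edist x y < C / m%:R)%R])))).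
  apply: Hraw_homo => _ [[[u bu <-] Vu] nG].
  have [z cz] : exists z : {ffun 'I_d -> 'I_m}, cube (\row_i (m%:R * (c^-1 *: u) ord0 i - (z i)%:R)).
    apply: grid_cell => // i; rewrite mxE; have /andP[u0 u1] := bu i.
    by rewrite mulr_ge0 ?invr_ge0 ?(ltW c0)//= mulrC ler_pdivrMr// mul1r.
  pose u' : 'rV[R]_d := \row_i (u ord0 i - l * (z i)%:R).
  have uE : sh z u' = u by apply/rowP => i; rewrite !mxE; ring.
  have bu' : box d l u'.
    move=> i; have := cz i; rewrite !mxE.
    have -> : m%:R * (c^-1 * u ord0 i) = l^-1 * u ord0 i.
      by rewrite /l invfM invrK mulrA [m%:R * _]mulrC.
    rewrite -(ler_pM2l l0) -[in X in _ && X](ler_pM2l l0) mulr0 mulr1 mulrBr mulrA.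
    by rewrite divff ?gt_eqF// mul1r.
  have [Pz|nPz] := boolP (P z).
    left; exists z; exists u'; last by rewrite /= uE.
    split=> // ou'; apply: nG; exists (exist _ z Pz), u' => //=.
    by rewrite uE.
  right; split; first by split=> //; exists u.
  move: nPz => /asboolPn/existsNP[v /not_implyP[bv nV]].
  exists (phi (sh z v)) => //; rewrite -uE.
  apply: le_lt_trans (bi _ _ (shbox z _ bu') (shbox z _ bv)).1 _.
  rewrite she ltr_pdivlMr// mulrC.
  have : edist u' v <= d%:R * l.
    rewrite eucE; apply: enorm_le_coord => i.
    have := bu' i; have := bv i => /andP[v0 v1] /andP[w0 w1].
    by rewrite !mxE in w0 w1 *; rewrite ler_norml; apply/andP; split; lra.
  move=> /(ler_wpM2l (ltW L0))/(ler_wpM2l (ltW mR))/le_lt_trans; apply.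
  rewrite /C -lm; have -> : m%:R * (L * (d%:R * l)) = L * (d%:R * (l * m%:R)) by ring.
  lra.
apply: le_trans (HrawU _ _ _) _; rewrite Hraw_fin_null ?add0e//.
move=> z; apply: (Hraw_bilip_boundary L0 l0).
by move=> u v bu bv /=; rewrite -(she z); apply: bi; exact: shbox.
Qed.

End FillChart.

(** * Exhaustion of A by charts one after the other *)

Section Decomposition.
Context {R : realType}.
Variables (d p : nat).
Hypothesis d0 : (0 < d)%N.
Implicit Types (phi : 'rV[R]_d -> 'rV[R]_p) (M A V : set 'rV[R]_p).

(** A form of the boundary hypothesis that survives the removal of the open image of a chart from
    [A], as the induction over charts requires. *)
Definition null_boundary M A :=
  [/\ compact A, A `<=` M & exists V, [/\ open V, M `&` V `<=` A & Hraw d (A `\` V) = 0%E]].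

Definition decomposition M A (L eta eps : R) (I : finType)
    (phi : I -> 'rV[R]_d -> 'rV[R]_p) (l : I -> R) :=
  [/\ forall i, piece M A L eta (phi i) (l i),
      forall i j, i != j -> phi i @` obox d (l i) `&` phi j @` obox d (l j) = set0 &
      (Hraw d (A `\` [set x | exists i, (phi i @` obox d (l i)) x]) <= eps%:E)%E].

(** The last chart is filled inside [V]; its open image is then removed from [A], and the remaining
    charts cover what is left. Half of [eps] is spent on the chart, half on the rest. *)
Lemma decomposition_charts M (L eta : R) (ch : nat -> ('rV[R]_d -> 'rV[R]_p) * R) n :
  1 < L -> 0 < eta -> (forall k, (k < n)%N -> good_chart M L (ch k).1 (ch k).2) ->
  forall A (eps : R), 0 < eps -> null_boundary M A ->
  A `<=` [set x | exists2 k, (k < n)%N & ((ch k).1 @` obox d (ch k).2) x] ->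
  exists (I : finType) (phi : I -> 'rV[R]_d -> 'rV[R]_p) (l : I -> R), @decomposition M A L eta eps I phi l.
Proof.
move=> L1 eta0; have L0 : 0 < L by apply: lt_trans L1.
elim: n => [|n IH] gc A eps eps0 [cA AM [V [oV MVA AV0]]] Acov.
  exists void, (fun=> fun=> 0), (fun=> 0); split; [by case|by case|].
  apply: (@le_trans _ _ (Hraw d (@set0 'rV[R]_p))); last by rewrite Hraw_set0 lee_fin ltW.
  by apply: Hraw_homo => x [/Acov[]].
have gcn := gc n (leqnn n).
set phi := (ch n).1 in gcn *; set c := (ch n).2 in gcn *.
have [c0 bi bM bO] := gcn.
have e20 : 0 < eps / 2 by rewrite divr_gt0.
have [I1 [phi1 [l1 [pc1 sub1 dis1 left1]]]] := fill_chart d0 L1 gcn oV e20 eta0.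
have [U oU UE] := bO _ (@open_obox R d c) (@subset_refl _ _).
pose A' := A `\` (phi @` obox d c).
have A'E : A' = A `&` ~` U.
  apply/seteqP; split=> x [Ax nx]; split=> //.
    by move=> Ux; apply: nx; rewrite UE; split=> //; exact: AM.
  by rewrite UE => -[].
have cK : compact (phi @` box d c).
  apply: (lip_compact L0); last exact: compact_cube.
  by move=> u v bu bv; exact: (bi u v bu bv).1.
have nA' : null_boundary M A'.
  split.
  - by rewrite A'E; apply: compact_closedI => //; exact: open_closedC.
  - by move=> x [/AM].
  (* The image of the closed box is compact, so its complement is open; the faces that stay in [A']
     are null. *)
  - exists (V `&` ~` (phi @` box d c)); split.
    + by apply: openI => //; apply: closed_openC; exact: compact_closed_rV.
    + move=> x [Mx [Vx nx]]; split; first exact: MVA.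
      by move=> [u /obox_sub bu ux]; apply: nx; exists u.
    + apply/eqP; rewrite eq_le Hraw_ge0 andbT.
      apply: (@le_trans _ _ (Hraw d ((A `\` V) `|` (phi @` (box d c `\` obox d c))))).
        apply: Hraw_homo => x [[Ax nx] nVx].
        have [Vx|Vx] := pselect (V x); last by left.
        right; have [u bu ux] : (phi @` box d c) x by apply: contrapT => h; apply: nVx.
        by exists u => //; split=> // ou; apply: nx; exists u.
      apply: le_trans (HrawU _ _ _) _.
      by rewrite AV0 (Hraw_bilip_boundary d0 L0 c0 bi) adde0.
have [||I2 [phi2 [l2 [pc2 dis2 left2]]]] := IH _ A' _ e20 nA'.
- by move=> k kn; apply: gc; exact: ltnW.
- move=> x [/Acov[k]]; rewrite ltnS leq_eqVlt => /orP[/eqP -> //|kn] h _.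
  by exists k.
exists (I1 + I2)%type, (fun i => match i with inl i => phi1 i | inr i => phi2 i end),
  (fun i => match i with inl i => l1 i | inr i => l2 i end); split.
- case=> i.
    have [h1 h2 h3 h4] := pc1 i; split=> // u bu.
    by apply: MVA; exact: h3.
  by have [h1 h2 h3 h4] := pc2 i; split=> // u bu; have [] := h3 u bu.
- have cross i j : phi1 i @` obox d (l1 i) `&` phi2 j @` obox d (l2 j) = set0.
    apply/seteqP; split=> // x [/sub1 xc [u /obox_sub bu ux]].
    by have [_ _ h3 _] := pc2 j; have [_] := h3 u bu; rewrite ux.
  case=> i [] j ij; [exact: dis1|exact: cross|by rewrite setIC; exact: cross|exact: dis2].
apply: (@le_trans _ _ (Hraw d ((A `\` V) `|`
  (((phi @` box d c `&` V) `\` [set x | exists i, (phi1 i @` obox d (l1 i)) x])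
   `|` (A' `\` [set x | exists i, (phi2 i @` obox d (l2 i)) x]))))).
  apply: Hraw_homo => x [Ax nx].
  have n1 : ~ exists i, (phi1 i @` obox d (l1 i)) x.
    by move=> [i h]; apply: nx; exists (inl i).
  have n2 : ~ exists i, (phi2 i @` obox d (l2 i)) x.
    by move=> [i h]; apply: nx; exists (inr i).
  have [xo|xo] := pselect ((phi @` obox d c) x); last by right; right.
  have [Vx|Vx] := pselect (V x); last by left.
  by right; left; split=> //; split=> //; case: xo => u /obox_sub bu ux; exists u.
apply: le_trans (HrawU _ _ _) _; rewrite AV0 add0e; apply: le_trans (HrawU _ _ _) _.
by apply: le_trans (leeD left1 left2) _; rewrite -EFinD lee_fin; lra.
Qed.

Lemma chart_cover M A (L : R) : C1_submanifold d M -> compact A -> A `<=` M -> 1 < L ->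
  exists n (ch : nat -> ('rV[R]_d -> 'rV[R]_p) * R),
   (forall k, (k < n)%N -> good_chart M L (ch k).1 (ch k).2) /\
   A `<=` [set x | exists2 k, (k < n)%N & ((ch k).1 @` obox d (ch k).2) x].
Proof.
move=> C1M cA AM L1.
have /choice[f hf] : forall x, exists chU : (('rV[R]_d -> 'rV[R]_p) * R) * set 'rV[R]_p,
    A x -> [/\ good_chart M L chU.1.1 chU.1.2, open chU.2, chU.2 x &
      chU.1.1 @` obox d chU.1.2 = M `&` chU.2].
  move=> x; have [Ax|nAx] := pselect (A x); last by exists ((fun=> 0, 0), set0).
  have [phi [c [gc [u ou ux]]]] := exists_good_chart C1M (AM _ Ax) L1.
  have [_ _ _ bO] := gc.
  have [U oU UE] := bO _ (@open_obox R d c) (@subset_refl _ _).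
  exists ((phi, c), U) => _; split=> //=.
  have : (phi @` obox d c) x by exists u.
  by rewrite UE => -[].
have := cA; rewrite compact_cover => /(_ _ A (fun x => (f x).2)).
case=> [x /hf[]//|x Ax|D DA Dcov].
  by exists x => //; have [] := hf x Ax.
pose s := finmap.enum_fset D.
exists (size s), (fun k => (f (nth 0 s k)).1); split.
  move=> k ks; have : nth 0 s k \in s by exact: mem_nth.
  by move=> /DA; rewrite inE => /hf[].
move=> x Ax; have [i /= iD xi] := Dcov _ Ax.
have := DA _ iD; rewrite inE => /hf[_ _ _ E].
have xE : ((f i).1.1 @` obox d (f i).1.2) x by rewrite E; split=> //; exact: AM.
exists (index i s); first by rewrite index_mem.
by rewrite (nth_index 0 (iD : i \in s)).
Qed.

Lemma decomposition_exists M A (L eta eps : R) : C1_submanifold d M -> null_boundary M A ->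
  1 < L -> 0 < eta -> 0 < eps ->
  exists (I : finType) (phi : I -> 'rV[R]_d -> 'rV[R]_p) (l : I -> R), @decomposition M A L eta eps I phi l.
Proof.
move=> C1M nA L1 eta0 eps0; have [cA AM _] := nA.
have [n [ch [gc Acov]]] := chart_cover C1M cA AM L1.
exact: decomposition_charts Acov.
Qed.

Lemma Hraw_lty M A : C1_submanifold d M -> compact A -> A `<=` M -> (Hraw d A < +oo)%E.
Proof.
move=> C1M cA AM; have L1 : (1 < 2 :> R) by rewrite ltr1n.
have [n [ch [gc Acov]]] := chart_cover C1M cA AM L1.
elim: n gc A {cA AM} Acov => [|n IH] gc A Acov.
  by apply: (@le_lt_trans _ _ (Hraw d (@set0 'rV[R]_p))); [apply: Hraw_homo => x /Acov[]|rewrite Hraw_set0].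
have [c0 bi _ _] := gc n (leqnn n).
set phi := (ch n).1 in bi *; set c := (ch n).2 in c0 bi *.
apply: (@le_lt_trans _ _ (Hraw d ((phi @` box d c) `|` (A `\` (phi @` obox d c))))).
  apply: Hraw_homo => x Ax; have [xo|xo] := pselect ((phi @` obox d c) x); last by right.
  by left; case: xo => u /obox_sub bu ux; exists u.
apply: le_lt_trans (HrawU _ _ _) _; apply: lte_add_pinfty.
  apply: (@Hraw_bilip_box_lty R d p phi 2 c) => //.
apply: IH => [k kn|x [/Acov[k]]]; first by apply: gc; exact: ltnW.
by rewrite ltnS leq_eqVlt => /orP[/eqP -> //|kn] h _; exists k.
Qed.

End Decomposition.

(** * Lower and upper estimates *)

Section Nets.
Context {R : realType}.
Variables (d p : nat).
Hypothesis d0 : (0 < d)%N.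
Implicit Types (M A E : set 'rV[R]_p).

Definition net A E (r : R) (a : seq 'rV[R]_p) :=
  (forall x, x \in a -> A x) /\ forall y, E y -> exists2 x, x \in a & edist y x <= r.

(** One representative is chosen for each value of the key. *)
Lemma net_of_key A E (T : finType) (key : 'rV[R]_p -> T) (r : R) : E `<=` A ->
  (forall x y, E x -> E y -> key x = key y -> edist x y <= r) ->
  exists2 a, net A E r a & (size a <= #|T|)%N.
Proof.
move=> EA kr.
have /choice[f hf] : forall t, exists x, (exists2 x', E x' & key x' = t) -> E x /\ key x = t.
  move=> t; have [[x Ex xt]|h] := pselect (exists2 x', E x' & key x' = t).
    by exists x.
  by exists 0.
pose P t := `[< exists2 x', E x' & key x' = t >].
exists [seq f t | t <- enum T & P t].
  split=> [x /mapP[t]|y Ey].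
    by rewrite mem_filter => /andP[/asboolP/hf[Ef _] _] ->; exact: EA.
  have Py : exists2 x', E x' & key x' = key y by exists y.
  exists (f (key y)).
    by apply: map_f; rewrite mem_filter mem_enum andbT; apply/asboolP.
  by have [Ef kf] := hf _ Py; apply: kr.
by rewrite size_map size_filter cardT count_size.
Qed.

(** The key of a point is a chart containing it and the grid cell of its preimage. In a given chart
    the preimages of [E] are within 2 * rho of each other, so the number of relevant cells depends
    on rho / r alone. *)
Lemma doubling M A : C1_submanifold d M -> compact A -> A `<=` M ->
  exists2 K : R, 0 < K & forall E (rho r : R), 0 <= rho -> 0 < r -> E `<=` A ->
    (forall x y, E x -> E y -> edist x y <= rho) ->
    exists2 a, net A E r a & (size a)%:R <= K * (rho / r + 1) ^+ d.
Proof.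
move=> C1M cA AM; have L1 : 1 < 2 :> R by rewrite ltr1n.
have dR : 0 < d%:R :> R by rewrite ltr0n.
have [n [ch [gc Acov]]] := chart_cover C1M cA AM L1.
exists (n.+1%:R * (8 * d%:R) ^+ d); first by rewrite mulr_gt0// exprn_gt0// mulr_gt0.
move=> E rho r rho0 r0 EA Erho.
have /choice[ku hku] : forall x, exists ku : 'I_n.+1 * 'rV[R]_d, E x ->
   [/\ (ku.1 < n)%N, box d (ch ku.1).2 ku.2 & (ch ku.1).1 ku.2 = x].
  move=> x; have [Ex|nEx] := pselect (E x); last by exists (ord0, 0).
  have [k kn [u /obox_sub bu ux]] := Acov _ (EA _ Ex).
  by exists (Ordinal (ltnW kn : k < n.+1)%N, u).
have /choice[u0 hu0] : forall k, exists u0, forall u,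
    E ((ch k).1 u) -> box d (ch k).2 u -> E ((ch k).1 u0) /\ box d (ch k).2 u0.
  move=> k; have [[u [Eu bu]]|h] := pselect (exists u, E ((ch k).1 u) /\ box d (ch k).2 u).
    by exists u.
  by exists 0 => u Eu bu; case: h; exists u.
(* Preimages in one cell are within d * h = r / 2, and charts expand distances by at most 2. *)
pose h := r / (2 * d%:R).
have h0 : 0 < h by rewrite divr_gt0// mulr_gt0.
pose m := (Num.truncn (4 * rho / h)).+1.
(* Coordinates relative to a base preimage in the same chart, shifted by 2 * rho to be nonnegative
   before truncation. *)
pose f x i : R := (ku x).2 ord0 i - u0 (ku x).1 ord0 i + 2 * rho.
have f_itv x i : E x -> 0 <= f x i <= 4 * rho.
  move=> Ex; have [kn bu ux] := hku x Ex.
  have [E0 b0] : E ((ch (ku x).1).1 (u0 (ku x).1)) /\ box d (ch (ku x).1).2 (u0 (ku x).1).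
    by apply: (hu0 _ (ku x).2) => //; rewrite ux.
  have [_ bi _ _] := gc _ kn.
  have := (bi _ _ bu b0).2; rewrite ux.
  have := Erho _ _ Ex E0 => h1 h2.
  have := coord_le_enorm ((ku x).2 - u0 (ku x).1) i; rewrite -eucE !mxE ler_norml.
  by rewrite /f => /andP[? ?]; apply/andP; split; lra.
pose key x : 'I_n.+1 * {ffun 'I_d -> 'I_m} := ((ku x).1, [ffun i => inord (Num.truncn (f x i / h))]).
have fm x i : E x -> (Num.truncn (f x i / h) < m)%N.
  move=> /(f_itv _ i)/andP[f0 f1]; rewrite /m ltnS; apply: le_truncn.
  by rewrite ler_pM2r ?invr_gt0.
have [|a na sa] := @net_of_key A E _ key r EA; last first.
  exists a => //; apply: (@le_trans _ _ (n.+1 * m ^ d)%:R).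
    by rewrite ler_nat; move: sa; rewrite card_prod card_ffun !card_ord.
  rewrite natrM natrX -mulrA ler_pM2l// -exprMn lerXn2r ?nnegrE//.
    by rewrite !mulr_ge0// addr_ge0// divr_ge0// ltW.
  have q0 : 0 <= 4 * rho / h by rewrite divr_ge0 ?mulr_ge0// ltW.
  have /andP[tq _] := truncn_itv q0.
  rewrite /m -natr1; apply: (@le_trans _ _ (4 * rho / h + 1)); first by rewrite lerD2r.
  have -> : 4 * rho / h = 8 * d%:R * (rho / r).
    by rewrite /h; field; rewrite gt_eqF ?gt_eqF.
  rewrite mulrDr lerD2l mulr1.
  have : 1 <= d%:R :> R by rewrite ler1n.
  lra.
move=> x y Ex Ey /eqP; rewrite xpair_eqE => /andP[/eqP kxy /eqP fxy].
have [kn bx ux] := hku x Ex; have [_ bt uy] := hku y Ey.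
have [_ bi _ _] := gc _ kn.
rewrite -ux -uy -kxy; rewrite -kxy in bt; apply: le_trans (bi _ _ bx bt).1 _.
have : edist (ku x).2 (ku y).2 <= d%:R * h.
  rewrite eucE; apply: enorm_le_coord => i; rewrite !mxE.
  have := congr1 (fun g : {ffun 'I_d -> 'I_m} => val (g i)) fxy; rewrite !ffunE /= !inordK ?fm//.
  have /andP[fx0 _] := f_itv x i Ex; have /andP[fy0 _] := f_itv y i Ey.
  have /andP[] := truncn_itv (divr_ge0 fx0 (ltW h0)).
  have /andP[] := truncn_itv (divr_ge0 fy0 (ltW h0)).
  move=> y1 y2 x1 x2 txy; rewrite txy in x1 x2.
  rewrite ler_pdivlMr// in x1; rewrite ltr_pdivrMr// in x2.
  rewrite ler_pdivlMr// in y1; rewrite ltr_pdivrMr// in y2.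
  rewrite -natr1 in x2 y2.
  move: x1 x2 y1 y2; rewrite /f -kxy => x1 x2 y1 y2.
  rewrite ler_norml; apply/andP; split; lra.
move=> hh; apply: le_trans (ler_wpM2l _ hh) _ => //.
by rewrite mulrA mulrC /h divfK// gt_eqF// mulr_gt0.
Qed.

(** [C] depends on [A] alone, while [C'] may depend on [K]. With 1 / r^d of order N the net uses
    O(eps * N) points up to a constant. It is obtained by applying [doubling] to each set of a
    finite cover of [K]. *)
Lemma null_net M A : C1_submanifold d M -> compact A -> A `<=` M ->
  exists2 C : R, 0 < C & forall K (eps : R), compact K -> K `<=` A -> 0 < eps ->
    (Hraw d K < eps%:E)%E ->
    exists C' : R, forall r, 0 < r ->
      exists2 a, net A K r a & (size a)%:R <= C * eps / r ^+ d + C'.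
Proof.
move=> C1M cA AM; have [B B0 hB] := doubling C1M cA AM.
exists (B * 2 ^+ d * (4 ^+ d * 2)); first by rewrite !mulr_gt0 ?exprn_gt0.
move=> K eps cK KA eps0 Keps.
have [s [U [t [t0 Ut cov hs]]]] := Hraw_finite_cover d0 cK eps0 Keps.
exists (B * 2 ^+ d * (size s)%:R) => r r0.
have net_s (l : seq nat) : exists2 a, net A (K `&` [set x | exists2 i, i \in l & U i x]) r a &
    (size a)%:R <= \sum_(i <- l) (B * 2 ^+ d * ((t i / r) ^+ d + 1)).
  elim: l => [|i l [a [aA acov] sa]].
    by exists [::]; [split=> // y [_ []]|rewrite big_nil].
  have [||b [bA bcov] sb] := hB (K `&` U i) (t i) r (ltW (t0 i)) r0.
  - by move=> x [/KA].
  - by move=> x y [_ Ux] [_ Uy]; exact: Ut Ux Uy.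
  exists (b ++ a).
    split=> [x|y [Ky [j]]]; rewrite ?mem_cat.
      by move=> /orP[/bA|/aA].
    rewrite inE => /orP[/eqP -> Uy|jl Uy].
      by have [x xb yx] := bcov y (conj Ky Uy); exists x; rewrite // mem_cat xb.
    have [|x xa yx] := acov y; first by split=> //; exists j.
    by exists x; rewrite // mem_cat xa orbT.
  rewrite size_cat natrD big_cons lerD//; apply: le_trans sb _.
  rewrite -mulrA ler_pM2l//; set q := t i / r.
  have q0 : 0 < q by rewrite divr_gt0.
  apply: (@le_trans _ _ ((2 * Num.max q 1) ^+ d)).
    rewrite lerXn2r ?nnegrE ?mulr_ge0 ?le_max ?ler01 ?orbT//; first by rewrite addr_ge0// ltW.
    have : q <= Num.max q 1 by rewrite le_max lexx.
    have : 1 <= Num.max q 1 by rewrite le_max lexx orbT.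
    lra.
  rewrite exprMn ler_pM2l ?exprn_gt0//.
  by have [_|_] := leP q 1; rewrite ?expr1n ?lerDr ?lerDl ?exprn_ge0// ltW.
have [a [aA acov] sa] := net_s s.
exists a; first by split=> // y Ky; apply: acov; split=> //; exact: cov.
apply: le_trans sa _; rewrite -mulr_sumr big_split/= big_const_seq count_predT iter_addr_0.
rewrite mulrDr lerD//.
have -> : \sum_(i <- s) (t i / r) ^+ d = (\sum_(i <- s) t i ^+ d) / r ^+ d.
  by rewrite mulr_suml; apply: eq_bigr => i _; rewrite expr_div_n.
rewrite mulrA ler_pM2r ?invr_gt0 ?exprn_gt0// -!mulrA ler_pM2l// ler_pM2l ?exprn_gt0//.
by apply: le_trans hs _; rewrite ler_pM2l ?exprn_gt0//; lra.
Qed.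

End Nets.

(** * How many points a given level of potential forces into a piece *)

Section Bounds.
Context {R : realType}.
Variables (d p : nat) (s : R).
Hypotheses (d0 : (0 < d)%N) (ds : d%:R < s).
Let q := s / d%:R.
Let sigma := sigma_sp s d.
Implicit Types (A M : set 'rV[R]_p).

Lemma exponents : [/\ 0 < d%:R :> R, 0 < s, 1 < q & 0 < q].
Proof.
have dR : 0 < d%:R :> R by rewrite ltr0n.
have s0 : 0 < s by apply: lt_trans ds.
split=> //; first by rewrite ltr_pdivlMr// mul1r.
by rewrite divr_gt0.
Qed.

(** Here s > d makes the contribution of distant points, linear in N, negligible against N^(s/d). *)
Lemma eventually_superlinear (a b : R) : 0 < a -> exists N0 : nat, forall N, (N0 <= N)%N ->
  b * N%:R <= a * N%:R `^ q.
Proof.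
move=> a0; have [dR s0 q1 q0] := exponents.
have e0 : 0 < q - 1 by rewrite subr_gt0.
pose c := (`|b| / a) `^ (q - 1)^-1.
have c0 : 0 <= c by exact: powR_ge0.
exists (Num.truncn c).+1 => N hN.
have cN : c <= N%:R.
  by apply: le_trans (ltW (truncnS_gt _)) _; rewrite ler_nat.
have N0 : 0 < N%:R :> R by rewrite ltr0n; apply: leq_trans hN.
have -> : N%:R `^ q = N%:R * N%:R `^ (q - 1).
  by rewrite mulr_powRB1// ltW.
rewrite mulrCA mulrC ler_pM2l//; apply: le_trans (ler_norm b) _.
rewrite -ler_pdivrMl// mulrC.
have -> : `|b| / a = c `^ (q - 1) by rewrite powRVK ?gt_eqF// divr_ge0// ltW.
by rewrite ge0_ler_powR// ?nnegrE// ltW.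
Qed.

(** The summand 1 pays for the infimum possibly not being attained. *)
Lemma subconfig (N : nat) (J : {pred 'I_N}) (c : 'I_N -> 'rV[R]_d) :
  (forall j, j \in J -> cube (c j)) -> exists2 x, cube x &
  (\sum_(j in J) rkern s x (c j) <= (sigma * #|J|%:R `^ q + 1)%:E)%E.
Proof.
move=> cc; have [_ _ ub _] := cube_limit d0 ds.
have [|x cx hx] := @lt_Pconf _ d (@cube R d) s #|J| (fun k => c (enum_val k))
    (sigma * #|J|%:R `^ q + 1)%:E.
  apply: (@le_lt_trans _ _ (sigma * #|J|%:R `^ q)%:E); last by rewrite lte_fin ltrDl.
  apply: le_trans (ub _); apply: Pconf_le_PN => k; apply: cc; exact: enum_valP.
by exists x => //; rewrite big_enum_val ltW.
Qed.

(** The clamped vector is the projection of [b] onto the cube. It allows points of a piece that lie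
    outside the shrunken cube to be moved into it without lowering the potential there. *)
Lemma clamp_contracts n (x b : 'rV[R]_n) : cube x ->
  edist x (\row_i Num.max 0 (Num.min 1 (b ord0 i))) <= edist x b.
Proof.
move=> cx; rewrite /Defs.edist ler_wsqrtr//; apply: ler_sum => i _; rewrite mxE.
have /andP[x0 x1] := cx i; move: (b ord0 i) => t.
rewrite -(@real_normK _ (x ord0 i - Num.max _ _)) ?num_real//.
rewrite -(@real_normK _ (x ord0 i - t)) ?num_real// lerXn2r ?nnegrE//.
have [t1|t1] := leP 1 t.
  rewrite (_ : Num.max 0 1 = 1); last by rewrite max_r.
  by rewrite !ler0_norm ?subr_le0// ?(le_trans x1)//; lra.
have [t0|t0] := leP 0 t => //.
by rewrite !ger0_norm ?subr_ge0// ?(le_trans _ x0) ?ltW//; lra.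
Qed.

(** The count n of points in the piece comes from solving (tau' * N)^q <= B * sigma * n^q, where B =
    (L / l')^s and l' is the side of the shrunken cube. *)
Lemma piece_count M A (L eta l theta tau tau' : R) (phi : 'rV[R]_d -> 'rV[R]_p) :
  A `<=` M -> 0 < L -> 0 < theta < 1 -> 0 <= tau' < tau -> piece M A L eta phi l ->
  exists N0, forall N, (N0 <= N)%N -> forall w : 'I_N -> 'rV[R]_p, (forall j, A (w j)) ->
    (((tau * N%:R) `^ q)%:E <= Pconf A s w)%E ->
    tau' * sigma `^ (- q^-1) * ((1 - theta) * l / L) ^+ d * N%:R <=
      (\sum_(j < N) `[< (phi @` obox d l) (w j) >]%:R).
Proof.
move=> AM L0 /andP[th0 th1] /andP[tau'0 tau'tau] [/andP[l0 _] bi bA [U oU UE]].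
have [dR s0 q1 q0] := exponents.
have [_ sigma0 _ _] := cube_limit d0 ds; rewrite -/sigma in sigma0.
have tau0 : 0 < tau by apply: le_lt_trans tau'tau.
pose v : 'rV[R]_d := const_mx (theta * l / 2).
pose l' := (1 - theta) * l.
have l'0 : 0 < l' by rewrite mulr_gt0// subr_gt0.
pose g (x : 'rV[R]_d) := v + l' *: x.
have thl : 0 < theta * l by rewrite mulr_gt0.
have go x : cube x -> obox d l (g x).
  move=> cx i; rewrite !mxE; have /andP[x0 x1] := cx i.
  have : 0 <= l' * x ord0 i <= l'.
    by rewrite mulr_ge0 ?(ltW l'0)//= ler_piMr// ltW.
  by rewrite /l' => /andP[y0 y1]; apply/andP; split; lra.
have gd x y : edist (g x) (g y) = l' * edist x y.
  rewrite !eucE /g opprD addrACA subrr add0r -scalerBr enormZ gtr0_norm//.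
pose K := (phi \o g) @` @cube R d.
have cK : compact K.
  apply: (@lip_compact _ d p (phi \o g) (L * l')); first exact: mulr_gt0.
    move=> x y cx cy /=; rewrite -mulrA -gd.
    by apply: (bi _ _ _ _).1; apply: obox_sub; exact: go.
  exact: (@compact_cube R d 1).
have KU : K `<=` U.
  move=> _ [x cx <-] /=; have : (phi @` obox d l) (phi (g x)) by exists (g x) => //; exact: go.
  by rewrite UE => -[].
(* Relative openness of the piece keeps all points outside it at distance at least [h] from the test
   point. *)
have [h h0 hh] := euc_separation cK oU KU.
have e0 : 0 < tau `^ q - tau' `^ q.
  by rewrite subr_gt0 gt0_ltr_powR ?nnegrE// ltW.
pose B := (L / l') `^ s.
have B0 : 0 < B by rewrite powR_gt0 ?divr_gt0.
(* The gap between tau^q and tau'^q pays for the distant points and for the summand 1 of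
   [subconfig], which is multiplied by [B]. *)
have [N0 hN0] := eventually_superlinear (h `^ (- s) + B) e0.
exists (maxn N0 1) => N; rewrite geq_max => /andP[N0N N1] w Aw Pw.
have NR : 1 <= N%:R :> R by rewrite ler1n.
pose J : {pred 'I_N} := fun j => `[< (phi @` obox d l) (w j) >].
have -> : \sum_(j < N) (`[< (phi @` obox d l) (w j) >]%:R : R) = #|J|%:R.
  rewrite -sum1_card natr_sum [RHS]big_mkcond/=; apply: eq_bigr => j _.
  by rewrite -topredE/= /J; case: asboolP.
have /choice[b hb] : forall j, exists b, j \in J -> obox d l b /\ phi b = w j.
  move=> j; have [|jJ] := boolP (j \in J); last by exists 0.
  by rewrite -topredE/= => /asboolP[b ob bw]; exists b.
pose c j : 'rV[R]_d := \row_i Num.max 0 (Num.min 1 ((l'^-1 *: (b j - v)) ord0 i)).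
have [|x cx hx] := @subconfig N J c.
  by move=> j _ i; rewrite mxE le_max lexx/= ge_max ler01 ge_min lexx.
have near_le j : j \in J -> (rkern s (phi (g x)) (w j) <= B%:E * rkern s x (c j))%E.
  move=> jJ; have [ob bw] := hb j jJ.
  apply: rkern_lip; rewrite ?(ltW s0) ?divr_gt0//.
  apply: (@le_trans _ _ (edist x (l'^-1 *: (b j - v)))); first exact: clamp_contracts.
  have bE : b j = g (l'^-1 *: (b j - v)).
    by rewrite /g scalerA divff ?gt_eqF// scale1r addrC subrK.
  rewrite mulrAC ler_pdivlMr// mulrC -gd -bE -bw.
  by apply: (bi _ _ _ _).2; apply: obox_sub => //; exact: go.
have far_le j : j \notin J -> (rkern s (phi (g x)) (w j) <= (h `^ (- s))%:E)%E.
  move=> jJ; apply: rkern_le; rewrite ?(ltW s0)// leNgt; apply/negP => hj.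
  have Uw : U (w j) by apply: (hh (phi (g x))) => //; exists x.
  move: jJ; rewrite -topredE/= => /asboolP; apply; rewrite UE; split=> //; exact: AM.
have Ax : A (phi (g x)) by apply: bA; apply: obox_sub; exact: go.
have key : (tau * N%:R) `^ q <= B * (sigma * #|J|%:R `^ q + 1) + N%:R * h `^ (- s).
  rewrite -lee_fin; apply: le_trans Pw _; apply: le_trans (Pconf_le s w Ax) _.
  rewrite (bigID (mem J))/= EFinD; apply: leeD.
    apply: (@le_trans _ _ (\sum_(j in J) B%:E * rkern s x (c j))%E).
      exact: lee_sum.
    rewrite -ge0_sume_distrr; last by move=> *; exact: rkern_ge0.
    by rewrite EFinM lee_pmul2l.
  apply: (@le_trans _ _ (\sum_(j < N | j \notin J) (h `^ (- s))%:E)%E); first exact: lee_sum.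
  rewrite sumEFin lee_fin; apply: (@le_trans _ _ (\sum_(j < N) h `^ (- s))).
    rewrite [leRHS](bigID (mem J))/= lerDr; apply: sumr_ge0 => *; exact: powR_ge0.
  by rewrite sumr_const card_ord mulr_natl.
have := hN0 N N0N.
have N00 : 0 <= N%:R :> R by [].
rewrite powRM ?(ltW tau0)// in key.
move=> key2.
have BN : B <= B * N%:R by rewrite ler_peMr// ltW.
have key3 : tau' `^ q * N%:R `^ q <= B * (sigma * #|J|%:R `^ q) by lra.
have lhs0 : 0 <= tau' * sigma `^ (- q^-1) * ((1 - theta) * l / L) ^+ d * N%:R.
  by rewrite !mulr_ge0 ?powR_ge0 ?exprn_ge0 ?divr_ge0 ?(ltW L0) ?(ltW l'0).
rewrite -(@ler_pXn2r _ 1)// ?nnegrE// !expr1.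
have mono : {in Num.nneg &, {mono (fun t : R => t `^ q) : x y / x <= y}}.
  apply: le_mono_in => a c' a0 c'0 ac; exact: gt0_ltr_powR.
rewrite -mono ?nnegrE//.
have l'L : 0 <= l' / L by rewrite divr_ge0 ?(ltW L0) ?(ltW l'0).
rewrite powRM// ?mulr_ge0 ?powR_ge0 ?exprn_ge0//.
rewrite powRM// ?mulr_ge0 ?powR_ge0 ?exprn_ge0//.
rewrite powRM// ?powR_ge0//.
rewrite -/l' -powRrM mulNr mulVf ?gt_eqF// powR_inv1 ?(ltW sigma0)//.
have -> : ((l' / L) ^+ d) `^ q = B^-1.
  rewrite -powR_mulrn// -powRrM /q mulrCA divff ?gt_eqF// mulr1.
  by rewrite /B -powRN -powR_invl ?divr_ge0 ?(ltW L0) ?(ltW l'0)// invfM invrK mulrC.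
have -> : tau' `^ q / sigma / B * N%:R `^ q = (tau' `^ q * N%:R `^ q) / (B * sigma).
  by rewrite invfM; ring.
by rewrite ler_pdivrMr ?mulr_gt0// [leRHS]mulrC -mulrA.
Qed.

End Bounds.

(** * Construction of configurations with large potential *)

Section LowerBound.
Context {R : realType}.
Variables (d p : nat) (s : R).
Hypotheses (d0 : (0 < d)%N) (ds : d%:R < s).
Let q := s / d%:R.
Let sigma := sigma_sp s d.
Implicit Types (A M : set 'rV[R]_p).

(* Each piece receives about alpha l_i^d N points with alpha slightly larger than
   tau L^d sigma^(-d/s), and the net of the remaining set has radius
   r = (tau N)^(-1/d); the last hypothesis says that N points suffice. *)
Lemma lower_bound A (L tau kappa C' : R) (I : finType)
    (phi : I -> 'rV[R]_d -> 'rV[R]_p) (l : I -> R) :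
  A !=set0 -> 0 < L -> 0 < tau -> 0 <= kappa ->
  (forall i, [/\ 0 < l i, bilip L (box d (l i)) (phi i) &
     forall u, box d (l i) u -> A (phi i u)]) ->
  (forall r, 0 < r -> exists2 a, net A (A `\` [set x | exists i, (phi i @` box d (l i)) x]) r a &
     (size a)%:R <= kappa / r ^+ d + C') ->
  tau * (L ^+ d * sigma `^ (- q^-1) * (\sum_i l i ^+ d) + kappa) < 1 ->
  exists N0, forall N, (N0 <= N)%N -> (((tau * N%:R) `^ q)%:E <= PN A s N)%E.
Proof.
move=> An0 L0 tau0 kappa0 hphi hnet.
have [dR s0 q1 q0] := exponents d0 ds; rewrite -/q in q1 q0.
have [_ sigma0 _ lb] := cube_limit d0 ds; rewrite -/sigma -/q in sigma0 lb.
set gam := L ^+ d * sigma `^ (- q^-1); set S := \sum_i l i ^+ d => h1.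
have gam0 : 0 < gam by rewrite mulr_gt0 ?exprn_gt0 ?powR_gt0.
have li0 i : 0 < l i by have [] := hphi i.
have S0 : 0 <= S by apply: sumr_ge0 => i _; rewrite exprn_ge0// ltW.
(* Raising [tau * gam] to [al] uses at most half of the gap in the last hypothesis; the rest is the
   slack against [C']. Between [al] and [al'] there remains eta / 2 for rounding the numbers of
   points. *)
pose eta := (1 - tau * (gam * S + kappa)) / (2 * (S + 1)).
have S1 : 0 < 2 * (S + 1) by rewrite mulr_gt0// ltr_wpDl.
have eta0 : 0 < eta by rewrite divr_gt0// subr_gt0.
pose al := tau * gam + eta.
pose al' := tau * gam + eta / 2.
have tg0 : 0 < tau * gam by rewrite mulr_gt0.
have al0 : 0 < al by rewrite addr_gt0.
have al'0 : 0 < al' by rewrite addr_gt0// divr_gt0.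
pose slack := 1 - (al * S + kappa * tau).
have slack0 : 0 < slack.
  have E : eta * (2 * (S + 1)) = 1 - tau * (gam * S + kappa) by rewrite /eta divfK// gt_eqF.
  have etaS : 0 <= eta * S by rewrite mulr_ge0// ltW.
  rewrite /slack /al; lra.
(* The cube constant at which al' * l^d * N points in a cube of side l, distorted by L, give exactly
   (tau * N)^q. *)
pose sg' := tau `^ q * L `^ s / al' `^ q.
have gamq : gam `^ q = L `^ s / sigma.
  rewrite /gam powRM ?powR_ge0 ?exprn_ge0 ?(ltW L0)// -powRrM mulNr mulVf ?gt_eqF//.
  rewrite powR_inv1 ?(ltW sigma0)// -powR_mulrn ?(ltW L0)// -powRrM /q mulrCA divff ?mulr1//.
  by rewrite gt_eqF.
have sg'0 : 0 < sg' by rewrite divr_gt0 ?mulr_gt0 ?powR_gt0.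
have sg's : sg' < sigma.
  rewrite /sg' ltr_pdivrMr ?powR_gt0//.
  have : (tau * gam) `^ q < al' `^ q.
    by rewrite gt0_ltr_powR// ?nnegrE ?(ltW tg0) ?(ltW al'0)// ltrDl divr_gt0.
  rewrite powRM ?(ltW tau0) ?(ltW gam0)// gamq mulrA ltr_pdivrMr//.
  by rewrite mulrC [sigma * _]mulrC mulrC.
have [N1 hN1] := lb _ (midf_lt sg's).2.
have mids : sg' < (sg' + sigma) / 2 by have [] := midf_lt sg's.
(* The first term ensures eta / 2 * l^d * N >= 1, which covers the truncation in [k i]; the second
   ensures k i > N1. *)
pose bnd i : R := 2 / (eta * l i ^+ d) + (N1.+1)%:R / (al' * l i ^+ d).
have ld0 i : 0 < l i ^+ d by rewrite exprn_gt0.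
have p1 i : 0 <= 2 / (eta * l i ^+ d) by rewrite divr_ge0// ltW// mulr_gt0.
have p2 i : 0 <= (N1.+1)%:R / (al' * l i ^+ d) by rewrite divr_ge0// ltW// mulr_gt0.
have bnd0 i : 0 <= bnd i by rewrite addr_ge0.
exists (Num.truncn (\sum_i bnd i + `|C'| / slack)).+1 => N hN.
have hN' : \sum_i bnd i + `|C'| / slack <= N%:R.
  by apply: le_trans (ltW (truncnS_gt _)) _; rewrite ler_nat.
have sb0 : 0 <= \sum_i bnd i by apply: sumr_ge0 => i _.
have NR : 0 < N%:R :> R by rewrite ltr0n; apply: leq_trans hN.
pose k i := Num.truncn (al * l i ^+ d * N%:R).
have k_itv i := truncn_itv (mulr_ge0 (mulr_ge0 (ltW al0) (exprn_ge0 d (ltW (li0 i)))) (ltW NR)).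
have hbi i : 2 / (eta * l i ^+ d) <= N%:R /\ (N1.+1)%:R / (al' * l i ^+ d) <= N%:R.
  have : bnd i <= N%:R.
    apply: le_trans hN'; rewrite (bigD1 i)//= -addrA lerDl addr_ge0 ?divr_ge0 ?(ltW slack0)//.
    by apply: sumr_ge0.
  by have := p1 i; have := p2 i; rewrite /bnd; split; lra.
have k_ge i : al' * l i ^+ d * N%:R <= (k i)%:R.
  have /andP[_] := k_itv i; rewrite -/(k i) -natr1.
  have := (hbi i).1; rewrite (ler_pdivrMr _ _ (mulr_gt0 eta0 (ld0 i))).
  rewrite /al /al'; lra.
have N1k i : (N1 < k i)%N.
  rewrite -(ltr_nat R); apply: lt_le_trans (k_ge i).
  have := (hbi i).2; rewrite (ler_pdivrMr _ _ (mulr_gt0 al'0 (ld0 i))) mulrC; apply: lt_le_trans.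
  by rewrite ltr_nat.
have exw : forall i, exists w : 'I_(k i) -> 'rV[R]_d, (forall j, cube (w j)) /\
    ((sg' * (k i)%:R `^ q)%:E < Pconf (@cube R d) s w)%E.
  move=> i; apply: lt_PN; apply: lt_le_trans (hN1 _ (ltnW (N1k i))).
  rewrite lte_fin ltr_pM2r// powR_gt0 ?ltr0n//.
  by apply: leq_trans (N1k i).
pose w i := sval (cid (exw i)).
have hw i : (forall j, cube (w i j)) /\ ((sg' * (k i)%:R `^ q)%:E < Pconf (@cube R d) s (w i))%E.
  exact: svalP (cid (exw i)).
(* At this radius a single net point within distance r contributes r^(-s) = (tau * N)^q. *)
pose r := (tau * N%:R) `^ (- d%:R^-1).
have tN : 0 < tau * N%:R by rewrite mulr_gt0.
have r0 : 0 < r by rewrite powR_gt0.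
have rd : r ^+ d = (tau * N%:R)^-1.
  rewrite /r -powR_mulrn ?powR_ge0// -powRrM mulNr mulVf ?gt_eqF//.
  by rewrite powR_inv1// ltW.
have rs : r `^ (- s) = (tau * N%:R) `^ q.
  by rewrite /r -powRrM mulrNN [_ * s]mulrC.
have [a [aA acov] sa] := hnet r r0.
(* The additional index stands for the net. *)
pose kk (o : I + 'I_1) := if o is inl i then k i else size a.
pose u (o : I + 'I_1) : 'I_(kk o) -> 'rV[R]_p :=
  match o return 'I_(kk o) -> 'rV[R]_p with
  | inl i => fun j => phi i (l i *: w i j)
  | inr _ => fun j => nth 0 a j end.
have lbox i x : cube x -> box d (l i) (l i *: x).
  move=> cx j; rewrite mxE; have /andP[x0 x1] := cx j.
  by rewrite mulr_ge0 ?(ltW (li0 i))//= ler_piMr// ltW.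
have [| |W [AW hW]] := @assemble R p A s (I + 'I_1)%type kk u N An0.
- case=> [i|o] j /=; last by apply: aA; exact: mem_nth.
  by have [_ _ hA] := hphi i; apply: hA; apply: lbox; exact: (hw i).1.
- rewrite big_sumType/= big_ord1 -(ler_nat R) natrD natr_sum addrC.
  apply: (@le_trans _ _ (kappa / r ^+ d + C' + \sum_i al * l i ^+ d * N%:R)).
    by apply: lerD => //; apply: ler_sum => i _; have /andP[] := k_itv i.
  rewrite -mulr_suml -mulr_sumr -/S rd invrK.
  have : `|C'| <= slack * N%:R.
    by rewrite mulrC -ler_pdivrMr//; apply: le_trans hN'; rewrite lerDr.
  have := ler_norm C'; rewrite /slack; lra.
apply: le_trans (Pconf_le_PN s AW); apply: le_Pconf => y Ay.
have [[i [v bv vy]]|ny] := pselect (exists i, (phi i @` box d (l i)) y); last first.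
  have [x xa yx] : exists2 x, x \in a & edist y x <= r by apply: acov.
  apply: le_trans (hW (inr ord0) y) => /=.
  have ia : (index x a < size a)%N by rewrite index_mem.
  rewrite (bigD1 (Ordinal ia))//= nth_index//.
  rewrite -rs; apply: (@le_trans _ _ (rkern s y x)).
    by apply: rkern_ge; rewrite ?(ltW s0) ?(ltW r0).
  by rewrite leeDl//; apply: sume_ge0 => *; exact: rkern_ge0.
apply: le_trans (hW (inl i) y) => /=.
pose x : 'rV[R]_d := (l i)^-1 *: v.
have cx : cube x.
  move=> j; rewrite mxE mulrC; have /andP[v0 v1] := bv j.
  by rewrite divr_ge0 ?(ltW (li0 i))//= ler_pdivrMr// mul1r.
have vE : v = l i *: x by rewrite /x scalerA divff ?scale1r// gt_eqF.
have [_ bi _] := hphi i.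
pose B := (L * l i) `^ s.
have Ll : 0 < L * l i by rewrite mulr_gt0.
have B0 : 0 < B by rewrite powR_gt0.
have cmp j : (rkern s x (w i j) <= B%:E * rkern s y (phi i (l i *: w i j)))%E.
  apply: rkern_lip => //; first exact: ltW.
  rewrite -vy; apply: le_trans (bi _ _ bv (lbox _ _ ((hw i).1 j))).1 _.
  by rewrite vE !eucE -scalerBr enormZ gtr0_norm// mulrA.
rewrite -(@lee_pmul2l _ B%:E)// ?lte_fin//.
rewrite ge0_sume_distrr; last by move=> *; exact: rkern_ge0.
apply: (@le_trans _ _ (\sum_(j < k i) rkern s x (w i j))%E); last exact: lee_sum.
apply: le_trans (Pconf_le s (w i) cx); apply: le_trans (ltW (hw i).2).
rewrite -EFinM lee_fin.
apply: (@le_trans _ _ (sg' * (al' * l i ^+ d * N%:R) `^ q)); last first.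
  rewrite ler_pM2l// ge0_ler_powR ?nnegrE ?(ltW q0)// ?mulr_ge0 ?(ltW al'0) ?(ltW NR) ?(ltW (ld0 i))//.
have ldq : (l i ^+ d) `^ q = l i `^ s.
  rewrite -powR_mulrn ?(ltW (li0 i))// -powRrM /q mulrCA divff ?mulr1//.
  by rewrite gt_eqF.
have -> : (al' * l i ^+ d * N%:R) `^ q = al' `^ q * l i `^ s * N%:R `^ q.
  by rewrite -ldq -!powRM// ?mulr_ge0// ltW.
rewrite (powRM _ (ltW tau0) (ltW NR)) /B (powRM _ (ltW L0) (ltW (li0 i))).
rewrite /sg'; set a' := al' `^ q; have a'0 : a' != 0 by rewrite gt_eqF// powR_gt0.
rewrite le_eqVlt; apply/orP; left; apply/eqP; field.
by [].
Qed.

End LowerBound.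

(** * Masses of the pieces of a decomposition *)

Section Asymptotics.
Context {R : realType}.
Variables (d p : nat) (s : R).
Hypotheses (d0 : (0 < d)%N) (ds : d%:R < s).
Let q := s / d%:R.
Let sigma := sigma_sp s d.
Implicit Types (A M : set 'rV[R]_p).

Definition cube_mass : R := fine (Hraw d (@cube R d)).

Lemma cube_massE : Hraw d (@cube R d) = cube_mass%:E.
Proof. by rewrite /cube_mass fineK// ge0_fin_numE ?Hraw_ge0// Hraw_cube_lty. Qed.

Lemma cube_mass_gt0 : 0 < cube_mass.
Proof. by rewrite -lte_fin -cube_massE Hraw_cube_gt0. Qed.

Lemma Hraw_obox (l : R) : 0 < l -> Hraw d (obox d l) = (l ^+ d * cube_mass)%:E.
Proof.
move=> l0; rewrite EFinM -cube_massE -Hraw_box//; apply/eqP; rewrite eq_le.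
rewrite (Hraw_homo _ (@obox_sub _ d l))/=.
apply: (@le_trans _ _ (Hraw d (obox d l `|` (box d l `\` obox d l)))).
  by apply: Hraw_homo => x bx; have [|] := pselect (obox d l x); [left|right].
by apply: le_trans (HrawU _ _ _) _; rewrite Hraw_box_boundary// adde0.
Qed.

Lemma piece_mass_le M A (L eta l : R) (phi : 'rV[R]_d -> 'rV[R]_p) :
  0 < L -> piece M A L eta phi l ->
  (Hraw d (phi @` obox d l) <= (L ^+ d * (l ^+ d * cube_mass))%:E)%E.
Proof.
move=> L0 [/andP[l0 _] bi _ _]; rewrite EFinM -Hraw_obox//; apply: Hraw_lip => //.
by move=> x y /obox_sub bx /obox_sub bt; exact: (bi _ _ bx bt).1.
Qed.

Lemma piece_mass_ge M A (L eta l : R) (phi : 'rV[R]_d -> 'rV[R]_p) :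
  0 < L -> piece M A L eta phi l ->
  ((l ^+ d * cube_mass)%:E <= (L ^+ d)%:E * Hraw d (phi @` obox d l))%E.
Proof.
move=> L0 [/andP[l0 _] bi _ _]; rewrite -Hraw_obox//.
have /choice[g hg] : forall y, exists u, (phi @` obox d l) y -> obox d l u /\ phi u = y.
  move=> y; have [[u ou uy]|h] := pselect ((phi @` obox d l) y); first by exists u.
  by exists 0.
have gE u : obox d l u -> g (phi u) = u.
  move=> ou; have [og gu] := hg (phi u) (ex_intro2 _ _ u ou erefl).
  apply/eqP; rewrite -euc_eq0 eq_le euc_ge0 andbT.
  by have := (bi _ _ (obox_sub og) (obox_sub ou)).2; rewrite gu eucxx mulr0.
have {1}-> : obox d l = g @` (phi @` obox d l).
  apply/seteqP; split=> [u ou|_ [_ [u ou <-] <-]]; last by rewrite gE.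
  by exists (phi u); [exists u|exact: gE].
apply: Hraw_lip => // _ _ [u ou <-] [v ov <-]; rewrite !gE//.
by exact: (bi _ _ (obox_sub ou) (obox_sub ov)).2.
Qed.

(** The exponent n + 1 gives a root also for n = 0; the cap at 2 bounds the expansion of the charts
    by a fixed constant. *)
Lemma exists_root_gt1 (n : nat) (b : R) : 1 < b -> exists2 L : R, 1 < L <= 2 & L ^+ n <= b.
Proof.
move=> b1; pose c := b `^ (n.+1%:R^-1).
have c1 : 1 < c by rewrite powR_gt1// invr_gt0.
have c0 : 0 <= c by rewrite ltW// (lt_trans ltr01).
exists (Num.min c 2); first by rewrite lt_min c1 ge_min lexx orbT/= ltr1n.
have m1 : 1 <= Num.min c 2 by rewrite le_min ltW//= ler1n.
apply: (@le_trans _ _ (Num.min c 2 ^+ n.+1)).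
  by rewrite exprS ler_peMl// exprn_ge0// (le_trans ler01).
apply: (@le_trans _ _ (c ^+ n.+1)).
  by rewrite lerXn2r ?nnegrE ?(le_trans ler01 m1)// ge_min lexx.
by rewrite -powR_mulrn// powRVK ?pnatr_eq0// ltW// (lt_trans ltr01).
Qed.

Section Decomposed.
Variables (M A : set 'rV[R]_p) (L eta eps : R) (I : finType).
Variables (phi : I -> 'rV[R]_d -> 'rV[R]_p) (l : I -> R).
Hypotheses (cA : compact A) (AM : A `<=` M) (L0 : 0 < L).
Hypothesis dec : decomposition M A L eta eps phi l.
Let G i := phi i @` obox d (l i).

Lemma piece_sub i : G i `<=` A.
Proof. by have [/(_ i)[_ _ h _] _ _] := dec => _ [u /obox_sub/h Au <-]. Qed.

Lemma piece_open i : exists2 U, open U & G i = A `&` U.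
Proof.
have [/(_ i)[_ _ h [U oU UE]] _ _] := dec; exists U => //.
apply/seteqP; split=> x; first by move=> Gx; split; [exact: piece_sub Gx|move: Gx; rewrite /G UE => -[]].
by move=> [/AM Mx Ux]; rewrite /G UE.
Qed.

Lemma piece_measurable i : measurable (G i : set (BorelV R p)).
Proof.
have [U oU ->] := piece_open i; apply: measurableI; last exact: open_borel.
by apply: closed_borel; exact: compact_closed_rV.
Qed.

Lemma pieces_mass_sum : (\sum_i Hraw d (G i) = Hraw d [set x | exists i, G i x])%E.
Proof.
have [_ dis _] := dec.
suff h r : uniq r -> measurable ([set x | exists2 i, i \in r & G i x] : set (BorelV R p)) /\
    (\sum_(i <- r) Hraw d (G i) = Hraw d [set x | exists2 i, i \in r & G i x])%E.
  have [|_ ->] := h (index_enum I); first exact: index_enum_uniq.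
  congr Hraw; apply/seteqP; split=> x; first by move=> [i]; exists i.
  by move=> [i Gx]; exists i; rewrite ?mem_index_enum.
elim: r => [|i r IH] /=.
  move=> _; rewrite big_nil (_ : [set x | _] = set0) ?Hraw_set0//.
  by apply/seteqP; split=> // x [].
move=> /andP[ir /IH[mr sr]].
have -> : [set x | exists2 j, j \in i :: r & G j x] = G i `|` [set x | exists2 j, j \in r & G j x].
  apply/seteqP; split=> x.
    move=> [j]; rewrite inE => /orP[/eqP ->|jr] Gx; first by left.
    by right; exists j.
  move=> [Gx|[j jr Gx]]; first by exists i; rewrite // inE eqxx.
  by exists j; rewrite // inE jr orbT.
split; first by apply: measurableU => //; exact: piece_measurable.
rewrite big_cons sr; apply/esym.
apply: (@measureU _ _ _ (@haus R p d)) => //; first exact: piece_measurable.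
apply/seteqP; split=> // x [Gi [j jr Gj]].
have ij : i != j by apply: contraNneq ir => ->.
by have : (G i `&` G j) x by []; rewrite /G dis.
Qed.

Lemma rest_compact : compact (A `\` [set x | exists i, G i x]).
Proof.
have /choice[U hU] : forall i, exists U, open U /\ G i = A `&` U.
  by move=> i; have [U oU UE] := piece_open i; exists U.
have -> : A `\` [set x | exists i, G i x] = A `&` ~` \bigcup_i U i.
  apply/seteqP; split=> x [Ax nx]; split=> //.
    by move=> [i _ Ux]; apply: nx; exists i; rewrite (hU i).2.
  by move=> [i]; rewrite (hU i).2 => -[_ Ux]; apply: nx; exists i.
apply: compact_closedI => //; apply: open_closedC; apply: bigcup_open => i _.
exact: (hU i).1.
Qed.

Lemma pieces_mass_le : (\sum_i Hraw d (G i) <= Hraw d A)%E.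
Proof. by rewrite pieces_mass_sum; apply: Hraw_homo => x [i /piece_sub]. Qed.

Lemma pieces_mass_ge : (Hraw d A <= \sum_i Hraw d (G i) + eps%:E)%E.
Proof.
have [_ _ le_eps] := dec; rewrite pieces_mass_sum.
apply: le_trans (leeD (lexx _) le_eps); apply: le_trans (HrawU _ _ _).
by apply: Hraw_homo => x Ax; have [|] := pselect (exists i, G i x); [left|right].
Qed.

End Decomposed.

End Asymptotics.

(** * Algebra of the accumulated loss factors *)

Section Rescaling.
Context {R : realType}.
Implicit Types b c m r t x y : R.

Lemma expr_triple b n : b ^+ (3 * n).+1 = b * b ^+ n * b ^+ n * b ^+ n.
Proof. by rewrite exprS !mulSn mul0n addn0 !exprD !mulrA. Qed.

(** In [count_lower], with b = B and y = B^d, the two sides are brought to the common factor c / m *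
    x / (b * y * y). *)
Lemma rescale_lhs r x b y c m : b != 0 -> y != 0 -> m != 0 ->
  r * (y * (x * c) / m) = r * (b * y * y * y) * (c / m * x / (b * y * y)).
Proof. by move=> b0 y0 m0; field; rewrite b0 y0 m0. Qed.

Lemma rescale_rhs t u x b y c m : b != 0 -> y != 0 -> c != 0 -> m != 0 ->
  t / b * u * (y^-1 * x / y) = t * (m / c) * u * (c / m * x / (b * y * y)).
Proof. by move=> b0 y0 c0 m0; field; rewrite b0 y0 c0 m0. Qed.

End Rescaling.

(** * The limit on the manifold *)

Section Limits.
Context {R : realType}.
Variables (d p : nat) (s : R).
Hypotheses (d0 : (0 < d)%N) (ds : d%:R < s).
Let q := s / d%:R.
Let sigma := sigma_sp s d.
Let cm : R := cube_mass d.
Variables (M A : set 'rV[R]_p).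
Hypotheses (C1M : C1_submanifold d M) (nA : null_boundary d M A) (An0 : A !=set0).
Let mA := fine (Hraw d A).
(** The proportion of the N points needed, to first order, to reach the level (tau * N)^q on all of
    [A]; the critical tau is the one where it equals 1. *)
Let density (tau : R) := tau * (mA / cm) * sigma `^ (- q^-1).

Lemma manifold_massE : Hraw d A = mA%:E.
Proof.
have [cA AM _] := nA.
by rewrite /mA fineK// ge0_fin_numE ?Hraw_ge0// (Hraw_lty C1M).
Qed.

Lemma manifold_mass_ge0 : 0 <= mA.
Proof. by rewrite -lee_fin -manifold_massE Hraw_ge0. Qed.

Lemma sigma_pos : 0 < sigma.
Proof. by have [] := cube_limit d0 ds. Qed.

Lemma PN_eventually_ge (tau : R) : 0 < tau -> density tau < 1 ->
  exists N0, forall N, (N0 <= N)%N -> (((tau * N%:R) `^ q)%:E <= PN A s N)%E.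
Proof.
move=> tau0; set x := density tau => x1.
have [cA AM _] := nA.
have cm0 : 0 < cm by exact: cube_mass_gt0.
have mA0 := manifold_mass_ge0.
have x0 : 0 <= x by rewrite /x /density !mulr_ge0 ?invr_ge0 ?powR_ge0 ?(ltW cm0) ?(ltW tau0).
(* One factor L^d comes from comparing the cubes with the measure of [A], the other from
   [lower_bound]. The case x = 0 is separate because of the division by x. *)
have [L /andP[L1 L2] Lx] : exists2 L : R, 1 < L <= 2 & L ^+ (2 * d) * x <= (1 + x) / 2.
  have [x00|xn0] := eqVneq x 0.
    by exists 2; rewrite ?x00 ?mulr0; [apply/andP; split|]; lra.
  have xp : 0 < x by rewrite lt_def xn0.
  have [|L L12 hL] := @exists_root_gt1 R (2 * d) ((1 + x) / 2 / x).
    by rewrite ltr_pdivlMr// mul1r; lra.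
  by exists L => //; rewrite -ler_pdivlMr.
have L0 : 0 < L by apply: lt_trans L1.
have [C C0 hC] := null_net d0 C1M cA AM.
(* The net then costs (1 - x) / 4, and (1 + x) / 2 + (1 - x) / 4 < 1. *)
pose eps := (1 - x) / (4 * tau * C).
have D0 : 0 < 4 * tau * C by rewrite !mulr_gt0.
have eps0 : 0 < eps by rewrite divr_gt0// subr_gt0.
have e20 : 0 < eps / 2 by rewrite divr_gt0.
have [I [phi [l dec]]] := decomposition_exists d0 C1M nA L1 ltr01 e20.
have [pc _ rest] := dec.
pose K := A `\` [set x | exists i, (phi i @` obox d (l i)) x].
have cK : compact K by apply: rest_compact AM dec.
have [|C' hC'] := hC K eps cK (@subIsetl _ _ _) eps0.
  by apply: le_lt_trans rest _; rewrite lte_fin; lra.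
pose S := \sum_i l i ^+ d.
have Sle : S <= L ^+ d * (mA / cm).
  rewrite mulrA ler_pdivlMr// -lee_fin.
  apply: (@le_trans _ _ ((L ^+ d)%:E * Hraw d A)%E); last by rewrite manifold_massE.
  apply: (@le_trans _ _ ((L ^+ d)%:E * \sum_i Hraw d (phi i @` obox d (l i)))%E); last first.
    by rewrite lee_pmul2l ?lte_fin ?exprn_gt0//; exact: pieces_mass_le dec.
  rewrite ge0_sume_distrr; last by move=> *; exact: Hraw_ge0.
  rewrite /S mulr_suml -sumEFin; apply: lee_sum => i _; exact: piece_mass_ge (pc i).
apply: (@lower_bound R d p s d0 ds A L tau (C * eps) C' I phi l) => //.
- by rewrite mulr_ge0// ltW.
- by move=> i; have [/andP[l0 _] bi hA _] := pc i.
- move=> r r0; have [a [aA acov] sa] := hC' r r0; exists a => //; split=> // y [Ay ny].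
  apply: acov; split=> // -[i [u /obox_sub bu uy]]; apply: ny; exists i, u => //.
rewrite -/q -/sigma -/S mulrDr.
have t1 : tau * (C * eps) = (1 - x) / 4.
  have : eps * (4 * tau * C) = 1 - x by rewrite /eps divfK// gt_eqF.
  lra.
have t2 : tau * (L ^+ d * sigma `^ (- q^-1) * S) <= L ^+ (2 * d) * x.
  have -> : L ^+ (2 * d) * x = tau * (L ^+ d * sigma `^ (- q^-1) * (L ^+ d * (mA / cm))).
    by rewrite /x /density mul2n -addnn exprD; ring.
  by rewrite ler_pM2l// ler_wpM2l// mulr_ge0 ?powR_ge0// exprn_ge0// ltW.
rewrite t1; lra.
Qed.

(* All losses (chart distortion, shrinking of the cubes, loss in tau) are powers of
   one factor B > 1 with B^(3d+1) <= density tau / rho. *)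
Lemma count_lower (tau rho eta eps : R) : 0 < mA -> 0 < tau -> 0 < rho < density tau ->
  0 < eta -> 0 < eps ->
  exists (L eta' : R) (I : finType) (phi : I -> 'rV[R]_d -> 'rV[R]_p) (l : I -> R),
  [/\ 0 < L, decomposition M A L eta' eps phi l,
    forall i x y, (phi i @` obox d (l i)) x -> (phi i @` obox d (l i)) y -> edist x y <= eta &
    exists N0, forall N, (N0 <= N)%N -> forall w : 'I_N -> 'rV[R]_p, (forall j, A (w j)) ->
      (((tau * N%:R) `^ q)%:E <= Pconf A s w)%E -> forall i,
      rho * (fine (Hraw d (phi i @` obox d (l i))) / mA) * N%:R <=
      \sum_(j < N) `[< (phi i @` obox d (l i)) (w j) >]%:R].
Proof.
move=> mA0 tau0 /andP[rho0 rhox] eta0 eps0.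
have [cA AM _] := nA.
have cm0 : 0 < cm by exact: cube_mass_gt0.
have dR : 0 < d%:R :> R by rewrite ltr0n.
have [|B /andP[B1 B2] hB] := @exists_root_gt1 R (3 * d).+1 (density tau / rho).
  by rewrite ltr_pdivlMr// mul1r.
have B0 : 0 < B by apply: lt_trans B1.
(* A piece of side l has diameter at most B * d * l, and B <= 2. *)
have eta'0 : 0 < eta / (2 * d%:R) by rewrite divr_gt0// mulr_gt0.
have [I [phi [l dec]]] := decomposition_exists d0 C1M nA B1 eta'0 eps0.
have [pc _ _] := dec.
exists B, (eta / (2 * d%:R)), I, phi, l; split=> //.
  move=> i _ _ [u ou <-] [v ov <-]; have [/andP[l0 le] bi _ _] := pc i.
  apply: le_trans (bi _ _ (obox_sub ou) (obox_sub ov)).1 _.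
  have : edist u v <= d%:R * l i.
    rewrite eucE; apply: enorm_le_coord => k; rewrite !mxE.
    have /andP[u0 u1] := ou k; have /andP[v0 v1] := ov k.
    by rewrite ler_norml; apply/andP; split; lra.
  move=> uv; apply: (@le_trans _ _ (2 * (d%:R * (eta / (2 * d%:R))))).
    apply: ler_pM => //; [exact: ltW|exact: euc_ge0|].
    by apply: le_trans uv _; rewrite ler_pM2l.
  by rewrite mulrA mulrC divfK// gt_eqF// mulr_gt0.
have BV : 0 < B^-1 < 1 by rewrite invr_gt0 B0 invf_lt1.
have th01 : 0 < 1 - B^-1 < 1.
  by move: BV => /andP[h1 h2]; apply/andP; split; lra.
have tt : 0 <= tau / B < tau.
  by rewrite divr_ge0 ?(ltW tau0) ?(ltW B0)//= ltr_pdivrMr// ltr_pMr.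
pose N0 i := sval (cid (piece_count d0 ds AM B0 th01 tt (pc i))).
have hN0 i := svalP (cid (piece_count d0 ds AM B0 th01 tt (pc i))).
exists (\max_i N0 i)%N => N hN w Aw Pw i.
have NiN : (N0 i <= N)%N by apply: leq_trans hN; exact: leq_bigmax.
apply: le_trans (hN0 i N NiN w Aw Pw).
rewrite ler_wpM2r//.
have [/andP[l0 _] _ _ _] := pc i.
have Gle : fine (Hraw d (phi i @` obox d (l i))) <= B ^+ d * (l i ^+ d * cm).
  rewrite -lee_fin fineK; first exact: piece_mass_le (pc i).
  rewrite ge0_fin_numE ?Hraw_ge0//; apply: le_lt_trans (piece_mass_le d0 B0 (pc i)) (ltry _).
apply: (@le_trans _ _ (rho * (B ^+ d * (l i ^+ d * cm) / mA))).
  by rewrite ler_pM2l// ler_pM2r// invr_gt0.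
rewrite subKr.
(* One factor B comes from tau / B, and B^d each from the shrinking, from the distortion in
   [piece_count] and from the mass of the piece. *)
have E : rho * B ^+ (3 * d).+1 <= density tau.
  by rewrite mulrC -ler_pdivlMr.
rewrite -/q -/sigma.
have ld0 : 0 < l i ^+ d by rewrite exprn_gt0.
have Bd0 : 0 < B ^+ d by rewrite exprn_gt0.
have nz : [/\ B != 0, B ^+ d != 0, cm != 0 & mA != 0] by split; rewrite gt_eqF.
case: nz => B_n0 Bd_n0 cm_n0 mA_n0.
rewrite !exprMn !exprVn.
rewrite (rescale_lhs rho (l i ^+ d) cm B_n0 Bd_n0 mA_n0) -expr_triple.
rewrite (rescale_rhs tau (sigma `^ (- q^-1)) (l i ^+ d) B_n0 Bd_n0 cm_n0 mA_n0).
rewrite ler_wpM2r//.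
by rewrite divr_ge0 ?mulr_ge0 ?invr_ge0 ?(ltW cm0) ?(ltW mA0) ?(ltW B0) ?(ltW Bd0) ?(ltW ld0).
Qed.

Lemma indicator_sum_le1 (I : finType) (G : I -> set 'rV[R]_p) (x : 'rV[R]_p) :
  (forall i j, i != j -> G i `&` G j = set0) -> \sum_i (`[< G i x >]%:R : R) <= 1.
Proof.
move=> dis; have [[i Gi]|nG] := pselect (exists i, G i x).
  rewrite (bigD1 i)//= asboolT// big1 ?addr0// => k ki.
  rewrite asboolF// => Gk; have : (G k `&` G i) x by [].
  by rewrite dis.
by rewrite big1 ?ler01// => i _; rewrite asboolF// => Gi; apply: nG; exists i.
Qed.

Lemma counts_le (I : finType) (G : I -> set 'rV[R]_p) N (w : 'I_N -> 'rV[R]_p) :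
  (forall i j, i != j -> G i `&` G j = set0) ->
  \sum_i \sum_(j < N) (`[< G i (w j) >]%:R : R) <= N%:R.
Proof.
move=> dis; rewrite exchange_big/=; apply: (@le_trans _ _ (\sum_(j < N) (1 : R))).
  by apply: ler_sum => j _; exact: indicator_sum_le1.
by rewrite sumr_const card_ord.
Qed.

(** Otherwise some configuration reaches the level, and the counts forced into the disjoint pieces
    add up to more than N. *)
Lemma PN_eventually_le (tau : R) : 0 < mA -> 0 < tau -> 1 < density tau ->
  exists N0, forall N, (N0 <= N)%N -> (PN A s N <= ((tau * N%:R) `^ q)%:E)%E.
Proof.
move=> mA0 tau0; set x := density tau => x1.
have [cA AM _] := nA.
pose rho := (1 + x) / 2.
have rho1 : 1 < rho by rewrite /rho; lra.
(* With this eps, rho * (mA - eps) = mA * (1 + rho) / 2 still exceeds mA. *)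
pose eps := mA * (rho - 1) / (2 * rho).
have eps0 : 0 < eps by rewrite divr_gt0 ?mulr_gt0//; lra.
have [|L [eta' [I [phi [l [L0 dec _ [N0 hN0]]]]]]] := @count_lower tau rho 1 eps mA0 tau0 _ ltr01 eps0.
  by rewrite -/x /rho; apply/andP; split; lra.
exists (maxn N0 1) => N; rewrite geq_max => /andP[N0N N1].
apply: PN_le => w Aw; rewrite leNgt; apply/negP => /ltW Pw.
have NR : 0 < N%:R :> R by rewrite ltr0n.
have [_ dis _] := dec.
have h1 := hN0 N N0N w Aw Pw.
have h2 := counts_le w dis.
have mge := pieces_mass_ge cA AM dec.
have fin i : Hraw d (phi i @` obox d (l i)) \is a fin_num.
  rewrite ge0_fin_numE ?Hraw_ge0//; apply: (@le_lt_trans _ _ (Hraw d A)).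
    by apply: Hraw_homo => y; exact: (piece_sub dec).

  by rewrite manifold_massE ltry.
pose m i := fine (Hraw d (phi i @` obox d (l i))).
have {}mge : mA <= \sum_i m i + eps.
  rewrite -lee_fin -manifold_massE EFinD -sumEFin; apply: le_trans mge _.
  by rewrite leeD2r//; apply: lee_sum => i _; rewrite /m fineK.
have : \sum_i rho * (m i / mA) * N%:R <= N%:R by apply: le_trans h2; apply: ler_sum => i _; exact: h1.
rewrite -mulr_suml -mulr_sumr -mulr_suml -[leRHS]mul1r ler_pM2r// mulrA ler_pdivrMr// mul1r.
have eE : eps * (2 * rho) = mA * (rho - 1) by rewrite /eps divfK// gt_eqF//; lra.
have : rho * mA <= rho * (\sum_i m i + eps) by rewrite ler_pM2l//; lra.
have : 0 < mA * (rho - 1) by rewrite mulr_gt0//; lra.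
lra.
Qed.

Lemma manifold_limit :
  (fun N => nratio (PN A s N) N q) @ \oo --> limval sigma (Hd d A) q.
Proof.
have [dR s0 q1 q0] := exponents d0 ds; rewrite -/q in q1 q0.
have cm0 : 0 < cm by exact: cube_mass_gt0.
have sg0 := sigma_pos.
have mA0 := manifold_mass_ge0.
have -> : Hd d A = (mA / cm)%:E by rewrite /Hd manifold_massE EFinM.
have rootE (t : R) : 0 < t -> (t `^ q^-1) `^ q = t by move=> t0; rewrite powRVK ?gt_eqF// ltW.
have tN (t : R) N : 0 < t -> (t `^ q^-1 * N%:R) `^ q = t * N%:R `^ q.
  by move=> t0; rewrite powRM ?powR_ge0// rootE.
have sgV : (sigma `^ (- q^-1)) `^ q = sigma^-1.
  by rewrite -powRrM mulNr mulVf ?gt_eqF// powR_inv1// ltW.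
(* On a null set [density] vanishes, so every level is eventually reached and the limit is +oo. *)
rewrite /limval; case: eqVneq => [mA00|mAn0].
  apply/cvgeyPge => t.
  pose t' := Num.max t 1.
  have t'0 : 0 < t' by rewrite lt_max ltr01 orbT.
  have [||N0 hN0] := @PN_eventually_ge (t' `^ q^-1); first by rewrite powR_gt0.
    by rewrite /density mA00 mulr0 mul0r ltr01.
  exists (maxn N0 1) => // N /=; rewrite geq_max => /andP[N0N N1].
  have Nq : 0 < N%:R `^ q :> R by rewrite powR_gt0// ltr0n.
  apply: (@le_trans _ _ t'%:E); first by rewrite lee_fin le_max lexx.
  rewrite /nratio lee_pdivlMr// -EFinM -tN//; exact: hN0.
have mAp : 0 < mA / cm by rewrite lt_def mAn0 divr_ge0// ltW.
have mAp' : 0 < mA by move: mAp; rewrite pmulr_lgt0// invr_gt0.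
have Hq : 0 < (mA / cm) `^ q by rewrite powR_gt0.
(* Hence t^(1/q) is subcritical exactly when t lies below the claimed limit. *)
have dens (t : R) : 0 < t -> (density (t `^ q^-1)) `^ q = t / (sigma / (mA / cm) `^ q).
  move=> t0; rewrite /density (powRM q (mulr_ge0 (powR_ge0 _ _) (ltW mAp)) (powR_ge0 _ _)).
  by rewrite (powRM q (powR_ge0 _ _) (ltW mAp)) rootE// sgV invfM invrK mulrA mulrAC.
have dens0 (t : R) : 0 <= density (t `^ q^-1).
  by rewrite /density mulr_ge0 ?powR_ge0// mulr_ge0 ?powR_ge0// ltW.
have S0 : 0 < sigma / (mA / cm) `^ q by rewrite divr_gt0.
apply: nratio_cvg => t ht.
  have [t0|t0] := leP t 0.
    apply: nearW => N; apply: le_trans (PN_ge0 _ _ An0).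
    by rewrite lee_fin mulr_le0_ge0// powR_ge0.
  have [||N0 hN0] := @PN_eventually_ge (t `^ q^-1); first by rewrite powR_gt0.
    rewrite ltNge; apply/negP => h.
    have : 1 `^ q <= density (t `^ q^-1) `^ q by rewrite ge0_ler_powR ?nnegrE// ltW.
    by rewrite dens// powR1 ler_pdivlMr// mul1r leNgt ht.
  by exists N0 => // N /= N0N; rewrite -tN//; exact: hN0.
have t0 : 0 < t by apply: lt_trans ht.
have [||N0 hN0] := @PN_eventually_le (t `^ q^-1) mAp'; first by rewrite powR_gt0.
  rewrite ltNge; apply/negP => h.
  have : density (t `^ q^-1) `^ q <= 1 `^ q by rewrite ge0_ler_powR ?nnegrE// ltW.
  by rewrite dens// powR1 ler_pdivrMr// mul1r leNgt ht.
by exists N0 => // N /= N0N; rewrite -tN//; exact: hN0.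
Qed.

End Limits.

(** * Weak-star convergence *)

Section CompactIntegral.
Context {R : realType}.
Variables (n : nat) (A : set 'rV[R]_n) (mu : {measure set (BorelV R n) -> \bar R}).
Hypotheses (cA : compact A) (muAC : mu (~` A) = 0%E) (muA : (mu A < +oo)%E).

Lemma continuous_borel (f : 'rV[R]_n -> R) : continuous f ->
  measurable_fun setT (f : BorelV R n -> R).
Proof.
move=> cf; apply: (measurability _ (RGenOpens.measurableE R)).
move=> _ [_ [a [b ->]] <-]; rewrite setTI; apply: open_borel.
by apply: open_comp => // x _; exact: cf.
Qed.

Lemma compact_borel : measurable (A : set (BorelV R n)).
Proof. by apply: closed_borel; exact: compact_closed_rV. Qed.

Lemma compact_borelC : measurable (~` A : set (BorelV R n)).
Proof. by apply: measurableC; exact: compact_borel. Qed.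

Lemma compact_fun_bounded (f : 'rV[R]_n -> R) : continuous f ->
  exists2 c : R, 0 < c & forall x, A x -> `|f x| <= c.
Proof.
move=> cf; have : compact (f @` A) by apply: continuous_compact => //; exact: continuous_subspaceT.
move=> /compact_bounded[c [_ hc]]; exists (`|c| + 1); first by rewrite ltr_wpDl.
move=> x Ax; apply: (hc (`|c| + 1)); last by exists x.
by rewrite ltr_pwDr// ler_norm.
Qed.

(** A continuous f may be unbounded on the whole space, but [mu] lives on [A], where f is
    bounded. *)
Lemma compact_integrable (f : 'rV[R]_n -> R) : continuous f ->
  mu.-integrable setT (fun x : BorelV R n => (f x)%:E).
Proof.
move=> cf; have [c c0 fc] := compact_fun_bounded cf.
have mf : measurable_fun setT (fun x : BorelV R n => (f x)%:E).
  by apply/measurable_EFinP; exact: continuous_borel.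
have mabs : measurable_fun setT (fun x : BorelV R n => `|f x|%:E).
  apply/measurable_EFinP; apply: continuous_borel => x.
  by apply: continuous_comp; [exact: cf|exact: norm_continuous].
apply/integrableP; split=> //.
rewrite (@ge0_negligible_integral _ _ _ mu setT (~` A))//=; last exact: compact_borelC.
rewrite setTD setCK.
apply: (@le_lt_trans _ _ (\int[mu]_(x in A) cst c%:E x)%E).
  apply: ge0_le_integral => //; first exact: compact_borel.
  exact: measurable_funTS.
by rewrite integral_cst ?lte_mul_pinfty// ?lee_fin ?(ltW c0)//; exact: compact_borel.
Qed.

Lemma compact_integralE (f : 'rV[R]_n -> R) : continuous f ->
  (\int[mu]_x (f x)%:E = \int[mu]_(x in A) (f x)%:E)%E.
Proof.
move=> cf; rewrite (@negligible_integral _ _ _ mu setT (~` A))//=.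
- by rewrite setTD setCK.
- exact: compact_borelC.
- exact: compact_integrable.
Qed.

(** On [A], f is dominated by the step function equal to the sum of the g i on the sets G i, plus c
    on what they leave uncovered. *)
Lemma compact_integral_le (f : 'rV[R]_n -> R) (c : R) (I : finType)
    (G : I -> set 'rV[R]_n) (g : I -> R) : continuous f ->
  (forall x, A x -> 0 <= f x <= c) -> (forall i, measurable (G i : set (BorelV R n))) ->
  measurable (A `\` [set x | exists i, G i x] : set (BorelV R n)) ->
  (forall i, 0 <= g i) -> (forall i, G i `<=` A) -> (forall i x, G i x -> f x <= g i) ->
  0 <= c ->
  fine (\int[mu]_x (f x)%:E) <=
    \sum_i g i * fine (mu (G i)) + c * fine (mu (A `\` [set x | exists i, G i x])).
Proof.
move=> cf f0c mG mrest g0 GA fg c0.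
have mA := compact_borel.
set rest := A `\` _ in mrest *.
have fin (E : set (BorelV R n)) : measurable E -> E `<=` A -> mu E \is a fin_num.
  move=> mE EA; rewrite ge0_fin_numE ?measure_ge0//; apply: le_lt_trans muA.
  by apply: le_measure; rewrite ?inE.
have ind_ge0 (k : R) (E : set (BorelV R n)) x : 0 <= k -> (0%E <= k%:E * (\1_E x)%:E)%E.
  by move=> k0; rewrite mule_ge0// lee_fin ?indicE.
have ind_meas (k : R) (E : set (BorelV R n)) : measurable E ->
    measurable_fun (A : set (BorelV R n)) (fun x : BorelV R n => k%:E * (\1_E x)%:E)%E.
  move=> mE; apply: emeasurable_funM => //.
  by apply/measurable_EFinP; exact: measurable_indic.
have int_ind (k : R) (E : set (BorelV R n)) : 0 <= k -> measurable E -> E `<=` A ->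
    (\int[mu]_(x in A) (k%:E * (\1_E x)%:E) = (k * fine (mu E))%:E)%E.
  move=> k0 mE EA; rewrite ge0_integralZl_EFin//; last first.
    by apply/measurable_EFinP; exact: measurable_indic.
  by rewrite integral_indic// setIidl// EFinM fineK ?fin.
rewrite compact_integralE// -lee_fin fineK; last first.
  by rewrite -compact_integralE//; apply: integrable_fin_num => //; exact: compact_integrable.
pose F (x : BorelV R n) := (\sum_i (g i)%:E * (\1_(G i) x)%:E + c%:E * (\1_rest x)%:E)%E.
apply: (@le_trans _ _ (\int[mu]_(x in A) F x)%E).
  apply: ge0_le_integral => //.
  - by move=> x Ax; rewrite lee_fin; have /andP[] := f0c x Ax.
  - by apply: measurable_funTS; apply/measurable_EFinP; exact: continuous_borel.
  - apply: emeasurable_funD; last exact: ind_meas.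
    by apply: emeasurable_sum => i; exact: ind_meas.
  - move=> x Ax; have /andP[fx0 fxc] := f0c x Ax; rewrite /F.
    have [[i Gx]|nG] := pselect (exists i, G i x).
      rewrite (bigD1 i)//= indicE mem_set// mule1 -addeA.
      apply: (@le_trans _ _ (g i)%:E); first by rewrite lee_fin fg.
      by rewrite leeDl// adde_ge0 ?ind_ge0//; apply: sume_ge0 => *; exact: ind_ge0.
    have rx : rest x by split.
    rewrite indicE mem_set// mule1; apply: (@le_trans _ _ c%:E); first by rewrite lee_fin.
    by rewrite leeDr//; apply: sume_ge0 => *; exact: ind_ge0.
rewrite /F ge0_integralD//; last 4 first.
- by move=> x _; apply: sume_ge0 => *; exact: ind_ge0.
- by apply: emeasurable_sum => i; exact: ind_meas.
- by move=> x _; exact: ind_ge0.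
- exact: ind_meas.
rewrite ge0_integral_sum//; last 2 first.
- by move=> i; exact: ind_meas.
- by move=> i x _; exact: ind_ge0.
rewrite int_ind//; last by move=> x [].
by rewrite EFinD -sumEFin leeD2r//; apply: lee_sum => i _; rewrite int_ind.
Qed.

End CompactIntegral.

(** * Counting measures of asymptotically optimal sequences *)

Section WeakStar.
Context {R : realType}.
Variables (d p : nat) (s : R).
Hypotheses (d0 : (0 < d)%N) (ds : d%:R < s).
Let q := s / d%:R.
Let sigma := sigma_sp s d.
Let cm : R := cube_mass d.
Variables (M A : set 'rV[R]_p).
Hypotheses (C1M : C1_submanifold d M) (nA : null_boundary d M A) (An0 : A !=set0).
Let mA := fine (Hraw d A).
Hypothesis mA0 : 0 < mA.
Let unit_density := (mA / cm) * sigma `^ (- q^-1).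
Variable w : forall N : nat, 'I_N -> 'rV[R]_p.
Hypothesis wopt : asympt_optimal A s w.

Let cm0 : 0 < cm. Proof. exact: cube_mass_gt0. Qed.

Let unit_density_gt0 : 0 < unit_density.
Proof.
by rewrite /unit_density mulr_gt0 ?divr_gt0// powR_gt0//; exact: sigma_pos.
Qed.

(** [PN] reaches the level of a slightly larger, still subcritical [tau1], and the ratio to [PN]
    eventually exceeds (tau / tau1)^q < 1. *)
Lemma optimal_eventually (tau : R) : 0 < tau -> tau * unit_density < 1 ->
  exists N0, forall N, (N0 <= N)%N -> (((tau * N%:R) `^ q)%:E <= Pconf A s (@w N))%E.
Proof.
move=> tau0 x1; have [dR s0 q1 q0] := exponents d0 ds; rewrite -/q in q1 q0.
set x := tau * unit_density in x1.
have x0 : 0 < x by rewrite mulr_gt0.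
pose tau1 := (1 + x) / 2 / unit_density.
have tau1E : tau1 * unit_density = (1 + x) / 2 by rewrite divfK// gt_eqF.
have tau10 : 0 < tau1 by rewrite !divr_gt0//; lra.
have tt1 : tau < tau1 by rewrite -(ltr_pM2r unit_density_gt0) tau1E -/x; lra.
(* A supercritical value, taken to have [PN A s N] finite, so that [fine] returns its actual
   value. *)
pose tau2 := 2 / unit_density.
have tau20 : 0 < tau2 by rewrite divr_gt0.
have tau2E : tau2 * unit_density = 2 by rewrite divfK// gt_eqF.
have [|N1 hN1] := PN_eventually_ge d0 ds C1M nA An0 tau10.
  by rewrite -mulrA tau1E; lra.
have [|N2 hN2] := PN_eventually_le d0 ds C1M nA mA0 tau20.
  by rewrite -mulrA tau2E ltr1n.
have [Aw ratio] := wopt.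
pose k := (tau / tau1) `^ q.
have k1 : k < 1.
  have -> : 1 = 1 `^ q :> R by rewrite powR1.
  have h1 : tau / tau1 < 1 by rewrite ltr_pdivrMr// mul1r.
  have h0 : 0 <= tau / tau1 by rewrite ltW// divr_gt0.
  by rewrite gt0_ltr_powR// nnegrE.
have k0 : 0 <= k by exact: powR_ge0.
have k10 : 0 < 1 - k by rewrite subr_gt0.
have [N3 _ hN3] := (cvgrPdist_le _ _).1 ratio (1 - k) k10.
exists (maxn (maxn N1 N2) (maxn N3 1)) => N; rewrite !geq_max.
move=> /andP[/andP[/hN1 ge1 /hN2 le2] /andP[/hN3 /= r3 N0]].
have NR : 0 < N%:R :> R by rewrite ltr0n.
have fPN : PN A s N \is a fin_num.
  by rewrite ge0_fin_numE ?PN_ge0//; apply: le_lt_trans le2 (ltry _).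
have leP := Pconf_le_PN s (Aw N).
have fP : Pconf A s (@w N) \is a fin_num.
  by rewrite ge0_fin_numE ?Pconf_ge0//; apply: le_lt_trans leP (le_lt_trans le2 (ltry _)).
have ge1' : (tau1 * N%:R) `^ q <= fine (PN A s N) by rewrite -lee_fin fineK.
have PN0 : 0 < fine (PN A s N).
  by apply: lt_le_trans ge1'; rewrite powR_gt0// mulr_gt0.
have kr : k <= fine (Pconf A s (@w N)) / fine (PN A s N).
  by move: r3; rewrite ler_distlC => /andP[+ _]; lra.
rewrite -[leRHS]fineK// lee_fin; apply: (@le_trans _ _ (k * (tau1 * N%:R) `^ q)).
  have h0 : 0 <= tau / tau1 by rewrite ltW// divr_gt0.
  have h1 : 0 <= tau1 * N%:R by rewrite ltW// mulr_gt0.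
  by rewrite /k -(powRM q h0 h1) mulrA divfK// gt_eqF.
apply: (@le_trans _ _ (k * fine (PN A s N))); first by rewrite ler_wpM2l.
by rewrite -ler_pdivlMr.
Qed.

Variable mu : {measure set (BorelV R p) -> \bar R}.
Hypothesis hmu : forall B : set (BorelV R p), measurable B -> mu B = Hd d (A `&` B).

Let cA : compact A. Proof. by have [] := nA. Qed.
Let AM : A `<=` M. Proof. by have [] := nA. Qed.

Lemma mu_sub (B : set 'rV[R]_p) : measurable (B : set (BorelV R p)) -> B `<=` A ->
  mu B = (fine (Hraw d B) / cm)%:E.
Proof.
move=> mB BA; rewrite hmu// (setIidr BA) /Hd EFinM fineK//.
rewrite ge0_fin_numE ?Hraw_ge0//; apply: (@le_lt_trans _ _ (Hraw d A)); first exact: Hraw_homo.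
exact: Hraw_lty C1M cA AM.
Qed.

Lemma muAE : mu A = (mA / cm)%:E.
Proof. by rewrite mu_sub//; exact: compact_borel. Qed.

Lemma muA_lty : (mu A < +oo)%E. Proof. by rewrite muAE ltry. Qed.

Lemma muAC0 : mu (~` A) = 0%E.
Proof.
rewrite hmu; last exact: compact_borelC.
by rewrite setICr /Hd Hraw_set0 mul0e.
Qed.

(** On a small piece f is nearly constant, so the lower bounds on the counts bound the average of a
    nonnegative f from below. *)
Lemma weak_lower (f : 'rV[R]_p -> R) (c e : R) : continuous f -> 0 < c ->
  (forall x, A x -> 0 <= f x <= c) -> 0 < e ->
  \forall N \near \oo, fine (\int[mu]_x (f x)%:E) / (mA / cm) - e <=
    (\sum_(j < N) f (w j)) / N%:R.
Proof.
move=> cf c0 f0c e0.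
have H0 : 0 < mA / cm by rewrite divr_gt0.
(* Error budget: the deficit 1 - rho of the counts, the oscillation of f on the pieces and the
   uncovered part of [A] cost at most e / 4 each. *)
pose kap := Num.min 2^-1 (e / (4 * c)).
have kap0 : 0 < kap by rewrite lt_min invr_gt0 ltr0n divr_gt0// mulr_gt0.
have kap1 : kap <= 2^-1 by rewrite ge_min lexx.
have kapc : kap * c <= e / 4.
  have : kap <= e / (4 * c) by rewrite ge_min lexx orbT.
  by rewrite ler_pdivlMr ?mulr_gt0//; lra.
pose rho := 1 - kap.
have rho0 : 0 < rho by rewrite /rho; lra.
have rho1 : rho < 1 by rewrite /rho; lra.
pose om := e / 8.
have om0 : 0 < om by rewrite divr_gt0.
pose eps := e * mA / (4 * c).
have eps0 : 0 < eps by rewrite divr_gt0 ?mulr_gt0.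
have epsE : c * eps = e * mA / 4.
  have : eps * (4 * c) = e * mA by rewrite /eps divfK// gt_eqF// mulr_gt0.
  lra.
pose tau := (1 + rho) / 2 / unit_density.
have tauE : tau * unit_density = (1 + rho) / 2 by rewrite divfK// gt_eqF.
have tau0 : 0 < tau by rewrite !divr_gt0//; lra.
have [|N1 hN1] := optimal_eventually tau0; first by rewrite tauE; lra.
have [h h0 hh] := compact_unif_continuous cA cf om0.
have h20 : 0 < h / 2 by rewrite divr_gt0.
have [|L [eta' [I [phi [l [L0 dec diam [N2 hN2]]]]]]] :=
    count_lower d0 ds C1M nA mA0 tau0 _ h20 eps0 (rho := rho).
  by rewrite rho0/= -mulrA tauE; lra.
pose G i := phi i @` obox d (l i).
pose m i := fine (Hraw d (G i)).
have [pc dis rest] := dec.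
have GA i : G i `<=` A by exact: (piece_sub dec).
have mG i : measurable (G i : set (BorelV R p)) by exact: (piece_measurable cA AM dec).
have m0 i : 0 <= m i by rewrite fine_ge0// Hraw_ge0.
pose g i := phi i (const_mx (l i / 2)).
have Gg i : G i (g i).
  exists (const_mx (l i / 2)) => // k; rewrite mxE.
  by have [/andP[l0 _] _ _ _] := pc i; apply/andP; split; lra.
have fg i x : G i x -> `|f (g i) - f x| <= om.
  move=> Gx; apply: hh; first exact/GA/Gg.
  by apply: le_lt_trans (diam i _ _ (Gg i) Gx) _; lra.
have fin i : Hraw d (G i) \is a fin_num.
  rewrite ge0_fin_numE ?Hraw_ge0//; apply: le_lt_trans (Hraw_homo d (GA i)) _.
  exact: Hraw_lty C1M cA AM.
have mle : \sum_i m i <= mA.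
  rewrite -lee_fin -(manifold_massE C1M nA) -sumEFin.
  apply: le_trans (pieces_mass_le cA AM dec); apply: lee_sum => i _; by rewrite /m fineK.
pose K := A `\` [set x | exists i, G i x].
have mK : measurable (K : set (BorelV R p)).
  by apply: closed_borel; apply: compact_closed_rV; exact: (rest_compact cA AM dec).
have muG i : fine (mu (G i)) = m i / cm by rewrite mu_sub.
have muK : c * fine (mu K) <= c * (eps / cm).
  rewrite ler_pM2l// mu_sub//; last by move=> x [].
  rewrite /= ler_pM2r ?invr_gt0// -lee_fin fineK//.
  rewrite ge0_fin_numE ?Hraw_ge0//; apply: le_lt_trans rest (ltry _).
have ag i : 0 <= f (g i) + om.
  by have /andP[f0 _] := f0c _ (GA _ _ (Gg i)); rewrite addr_ge0// ltW.
pose If := fine (\int[mu]_x (f x)%:E).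
have Ile : If <= \sum_i (f (g i) + om) * (m i / cm) + c * (eps / cm).
  have := @compact_integral_le R p A mu cA muAC0 muA_lty f c I G
     (fun i => f (g i) + om) cf f0c mG mK ag GA _ (ltW c0).
  move=> /(_ _)/le_trans; apply.
    by move=> i x /fg; rewrite ler_distlC => /andP[_]; lra.
  by rewrite lerD//; apply: ler_sum => i _; rewrite muG.
have IleH : If / (mA / cm) <= c.
  rewrite ler_pdivrMr//.
  (* With an empty family of pieces the whole of [A] is uncovered, which bounds the integral by c
     times the mass. *)
  have := @compact_integral_le R p A mu cA muAC0 muA_lty f c void (fun=> set0)
     (fun=> 0) cf f0c (fun i => measurable0) _ (fun i => lexx 0) _ _ (ltW c0).
  rewrite (_ : A `\` _ = A); last by apply/seteqP; split=> [x []//|x Ax]; split=> // -[].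
  move=> /(_ (compact_borel cA)); rewrite big1; last by case.
  by rewrite add0r muAE; apply=> -[].
exists (maxn (maxn N1 N2) 1) => // N /=; rewrite !geq_max => /andP[/andP[NN1 NN2] N0].
have NR : 0 < N%:R :> R by rewrite ltr0n.
have [Aw _] := wopt.
have cnt := hN2 N NN2 (@w N) (Aw N) (hN1 N NN1).
have fw j : 0 <= f (w (N := N) j) by have /andP[] := f0c _ (Aw N j).
have key : \sum_i rho * (m i / mA) * N%:R * (f (g i) - om) <= \sum_(j < N) f (w j).
  apply: (@le_trans _ _ (\sum_i \sum_(j < N) (`[< G i (w j) >]%:R * f (w j)))).
    apply: ler_sum => i _.
    (* f (g i) - om may be negative, where a lower bound on the count would act in the wrong
       direction; its positive part is still at most f on the piece. *)
    apply: (@le_trans _ _ (\sum_(j < N) (`[< G i (w j) >]%:R * Num.max 0 (f (g i) - om)))).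
      rewrite -mulr_suml; apply: (@le_trans _ _ (rho * (m i / mA) * N%:R * Num.max 0 (f (g i) - om))).
        rewrite ler_wpM2l ?le_max ?lexx ?orbT//.
        by rewrite !mulr_ge0 ?invr_ge0 ?(ltW rho0) ?(ltW mA0) ?m0.
      by rewrite ler_wpM2r ?le_max ?lexx//; exact: cnt.
    apply: ler_sum => j _; case: asboolP => Gj; rewrite ?mul0r// !mul1r.
    rewrite ge_max fw/=; have := fg i _ Gj; rewrite ler_distlC => /andP[+ _]; lra.
  rewrite exchange_big/=; apply: ler_sum => j _; rewrite -mulr_suml ler_piMl//.
  exact: (indicator_sum_le1 (w j) dis).
rewrite -/If ler_pdivlMr//; apply: le_trans key.
have -> : \sum_i rho * (m i / mA) * N%:R * (f (g i) - om) =
    rho / mA * (\sum_i m i * (f (g i) - om)) * N%:R.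
  by rewrite mulr_sumr mulr_suml; apply: eq_bigr => i _; ring.
rewrite ler_pM2r//.
have cmI : cm * If <= \sum_i m i * (f (g i) - om) + 2 * om * \sum_i m i + c * eps.
  have : cm * If <= cm * (\sum_i (f (g i) + om) * (m i / cm) + c * (eps / cm)).
    by rewrite ler_pM2l.
  move=> /le_trans; apply; rewrite mulrDr.
  have -> : cm * (c * (eps / cm)) = c * eps by field; rewrite gt_eqF.
  rewrite lerD2r 2!mulr_sumr -big_split/=; apply: ler_sum => i _.
  rewrite le_eqVlt; apply/orP; left; apply/eqP; field; by rewrite gt_eqF.
have om_m : 2 * om * \sum_i m i <= 2 * om * mA by rewrite ler_pM2l// mulr_gt0.
have low : cm * If - e * mA / 2 <= \sum_i m i * (f (g i) - om).
  by move: om_m cmI; rewrite epsE /om; lra.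
have : rho / mA * (cm * If - e * mA / 2) <= rho / mA * (\sum_i m i * (f (g i) - om)).
  by rewrite ler_wpM2l// divr_ge0// ltW.
apply: le_trans.
have -> : rho / mA * (cm * If - e * mA / 2) = rho * (If / (mA / cm)) - rho * (e / 2).
  by field; rewrite !gt_eqF.
have : kap * (If / (mA / cm)) <= kap * c by rewrite ler_wpM2l// ltW.
have : rho * (e / 2) <= e / 2 by rewrite ler_piMl//; [lra|exact: ltW].
rewrite /rho; lra.
Qed.

(** With |f| <= c on [A], both f + c and c - f are nonnegative there; the one-sided estimate for the
    two of them bounds the averages of f from both sides. *)
Lemma weak_star (f : 'rV[R]_p -> R) : continuous f ->
  (fun N => (\sum_(j < N) f (w j)) / N%:R) @ \oo -->
    fine (\int[mu]_x (f x)%:E) / (mA / cm).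
Proof.
move=> cf; have H0 : 0 < mA / cm by rewrite divr_gt0.
have [c c0 fc] := compact_fun_bounded cA cf.
have c20 : 0 < 2 * c by rewrite mulr_gt0.
have cf1 : continuous (fun x => f x + c) by move=> x; apply: continuousD; [exact: cf|exact: cst_continuous].
have cf2 : continuous (fun x => c - f x) by move=> x; apply: continuousB; [exact: cst_continuous|exact: cf].
have ccst : continuous (fun _ : 'rV[R]_p => c) by exact: cst_continuous.
have int g (cg : continuous g) := compact_integrable cA muAC0 muA_lty cg.
pose If := fine (\int[mu]_x (f x)%:E).
have Ifin g (cg : continuous g) : (\int[mu]_x (g x)%:E)%E \is a fin_num.
  by apply: integrable_fin_num => //; exact: int.
have Ic : (\int[mu]_x c%:E = (c * (mA / cm))%:E)%E.
  rewrite (compact_integralE cA muAC0 muA_lty ccst) (integral_cst mu (compact_borel cA)) muAE.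
  by rewrite EFinM.
have I1 : fine (\int[mu]_x (f x + c)%:E) = If + c * (mA / cm).
  have -> : (\int[mu]_x (f x + c)%:E = \int[mu]_x (f x)%:E + \int[mu]_x c%:E)%E.
    by rewrite -integralD//; exact: int.
  by rewrite fineD ?Ifin// Ic.
have I2 : fine (\int[mu]_x (c - f x)%:E) = c * (mA / cm) - If.
  have : (\int[mu]_x c%:E = \int[mu]_x (c - f x)%:E + \int[mu]_x (f x)%:E)%E.
    rewrite -integralD//; [|exact: int|exact: int].
    by apply: eq_integral => x _; rewrite -EFinD subrK.
  rewrite Ic => /(congr1 fine); rewrite fineD ?Ifin//= -/If => ->.
  by rewrite addrK.
apply/cvgrPdist_le => e e0; rewrite -/If.
have fc' x : A x -> - c <= f x <= c by move=> /fc; rewrite ler_norml.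
have n1 : \forall N \near \oo, fine (\int[mu]_x (f x + c)%:E) / (mA / cm) - e <=
    (\sum_(j < N) (f (w j) + c)) / N%:R.
  by apply: (weak_lower cf1 c20 _ e0) => x /fc' /andP[? ?]; apply/andP; split; lra.
have n2 : \forall N \near \oo, fine (\int[mu]_x (c - f x)%:E) / (mA / cm) - e <=
    (\sum_(j < N) (c - f (w j))) / N%:R.
  by apply: (weak_lower cf2 c20 _ e0) => x /fc' /andP[? ?]; apply/andP; split; lra.
near=> N.
have N0 : 0 < N%:R :> R by rewrite ltr0n; near: N; exists 1%N.
have : fine (\int[mu]_x (f x + c)%:E) / (mA / cm) - e <= (\sum_(j < N) (f (w j) + c)) / N%:R.
  by near: N.
have : fine (\int[mu]_x (c - f x)%:E) / (mA / cm) - e <= (\sum_(j < N) (c - f (w j))) / N%:R.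
  by near: N.
rewrite I1 I2 !big_split/= sumrN !sumr_const card_ord -!(mulr_natr c) !mulrDl !mulNr.
rewrite !mulfK ?gt_eqF//.
by move=> ? ?; rewrite ler_distlC; apply/andP; split; lra.
Unshelve. all: end_near. Qed.

End WeakStar.

(** * From the relative boundary to the form of the hypothesis used *)

Section NullBoundary.
Context {R : realType}.
Variables (d p : nat).
Hypothesis d0 : (0 < d)%N.

Lemma HdE (E : set 'rV[R]_p) : Hd d E = (Hraw d E * ((cube_mass d)^-1)%:E)%E.
Proof. by []. Qed.

Lemma Hd_eq0 (E : set 'rV[R]_p) : Hd d E = 0%E -> Hraw d E = 0%E.
Proof.
have c0 : (((cube_mass d)^-1 : R)%:E != 0)%E.
  by rewrite eqe invr_eq0 gt_eqF// cube_mass_gt0.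
by move=> /eqP; rewrite HdE mule_eq0 (negbTE c0) orbF => /eqP.
Qed.

Lemma null_boundary_of_rel (M A : set 'rV[R]_p) : compact A -> A `<=` M ->
  Hd d (rel_boundary M A) = 0%E -> null_boundary d M A.
Proof.
move=> cA AM /Hd_eq0 bd0; split=> //.
(* The union of all open sets whose trace on [M] lies in [A]: a point of [A] outside it is not in
   the relative interior, hence in the relative boundary. *)
pose V := \bigcup_(U in [set U : set 'rV[R]_p | open U /\ M `&` U `<=` A]) U.
exists V; split.
- by apply: bigcup_open => U [].
- by move=> x [Mx [U [_ UA] Ux]]; exact: UA.
- apply/eqP; rewrite eq_le Hraw_ge0 andbT -bd0; apply: Hraw_homo => x [Ax nV].
  split; first by split; [exact: subset_closure|exact: AM].
  by move=> [_ [U [oU [Ux UA]]]]; apply: nV; exists U.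
Qed.

Lemma restricted_measure (A : set 'rV[R]_p) : compact A ->
  exists mu : {measure set (BorelV R p) -> \bar R},
    forall B : set (BorelV R p), measurable B -> mu B = Hd d (A `&` B).
Proof.
move=> cA; have mA := compact_borel cA.
have cm0 : 0 <= (cube_mass d)^-1 :> R by rewrite invr_ge0 ltW// cube_mass_gt0.
exists (mscale (NngNum cm0) (mrestr (@haus R p d) mA)) => B mB.
by rewrite /= /mscale/= /mrestr HdE muleC setIC.
Qed.

End NullBoundary.


Theorem theorem1 (R : realType) :
  (forall (p : nat) (s : R), (0 < p)%N -> p%:R < s ->
     ((fun N => nratio (PN (@cube R p) s N) N (s / p%:R)) @ \oo
        --> (sigma_sp s p)%:E) /\ 0 < sigma_sp s p)
  /\
  (forall (p d : nat) (s : R) (M A : set 'rV[R]_p),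
     (0 < d)%N -> (d <= p)%N -> d%:R < s ->
     C1_submanifold d M -> A `<=` M -> compact A -> A !=set0 ->
     Hd d (rel_boundary M A) = 0%E ->
     ((fun N => nratio (PN A s N) N (s / d%:R)) @ \oo
        --> limval (sigma_sp s d) (Hd d A) (s / d%:R))
     /\
     ((0 < Hd d A)%E ->
       exists mu : {measure set (BorelV R p) -> \bar R},
         (forall B : set (BorelV R p), measurable B -> mu B = Hd d (A `&` B)) /\
         forall w : forall N : nat, 'I_N -> 'rV[R]_p,
           asympt_optimal A s w ->
           forall f : 'rV[R]_p -> R, continuous f ->
             (fun N => (\sum_(j < N) f (w N j)) / N%:R) @ \oo
               --> fine (\int[mu]_x (f x)%:E) / fine (Hd d A))).
Proof.
split=> [p s p0 ps|p d s M A d0 dp ds C1M AM cA An0 bd0].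
  by have [] := cube_limit p0 ps.
have nA := null_boundary_of_rel d0 cA AM bd0.
split; first exact: (manifold_limit d0 ds C1M nA An0).
have massE := manifold_massE C1M nA.
have cm0 := cube_mass_gt0 (R := R) d0.
move=> HdA0; have mA0 : 0 < fine (Hraw d A).
  by move: HdA0; rewrite HdE massE -EFinM lte_fin pmulr_lgt0// invr_gt0.
have [mu hmu] := @restricted_measure R d p d0 A cA.
exists mu; split=> // w wopt f cf.
rewrite HdE massE -EFinM.
exact: (weak_star d0 ds C1M nA An0 mA0 wopt hmu cf).
Qed.
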